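(* Let $k$ be a positive integer. Among all simple connected graphs on $n=3k+1$ vertices with diameter $2k$, the graphs of minimum spectral radius are exactly the open quipus $P^{(i,j)}_{(i,\,i+j-1,\,j)}$ for all integers $0\le i\le j$ with $i+j=k$.
   Context: All graphs are finite, simple and undirected. The spectral radius $\rho(G)$ of a graph $G$ is the largest eigenvalue of its adjacency matrix. A pendent path of length $m\ge 0$ attached at a vertex $v$ consists of $m$ new vertices $w_1,\dots,w_m$ with edges $vw_1, w_1w_2,\dots,w_{m-1}w_m$. For integers $r\ge 0$ and $k_0,\dots,k_{r+1},m_0,\dots,m_r\ge 0$, the open quipu $P^{(m_0,m_1,\dots,m_r)}_{(k_0,k_1,\dots,k_r,k_{r+1})}$ is the tree obtained as follows: take vertices $v_0,v_1,\dots,v_r$; for each $1\le i\le r$ join $v_{i-1}$ and $v_i$ by a path having exactly $k_i$ internal vertices; attach a pendent path of length $k_0$ at $v_0$ and a pendent path of length $k_{r+1}$ at $v_r$ (these lie along the main path, on the side of $v_0$ away from $v_1$ and on the side of $v_r$ away from $v_{r-1}$ respectively); and attach a pendent path of length $m_i$ at $v_i$ for each $0\le i\le r$. In particular $P^{(i,j)}_{(i,i+j-1,j)}$ has vertices $v_0,v_1$ joined by a path with $i+j-1$ internal vertices, pendent paths of lengths $i$ and $i$ at $v_0$, and pendent paths of lengths $j$ and $j$ at $v_1$; it has $3(i+j)+1$ vertices. *)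

(* Defs.v *)
From HB Require Import structures.
From mathcomp Require Import all_boot all_order all_algebra.
From mathcomp Require Import classical_sets reals.
Unset Printing Implicit Defensive.
Import Order.TTheory GRing.Theory Num.Theory.

Definition simple_graph (T : finType) (e : rel T) : Prop :=
  symmetric e /\ irreflexive e.

Definition connected_graph (T : finType) (e : rel T) : Prop :=
  forall x y : T, connect e x y.

Definition has_diameter (T : finType) (e : rel T) (D : nat) : Prop :=
  (forall x y : T, exists p : seq T, [/\ path e x p, last x p = y & size p <= D]) /\
  (exists x y : T, forall p : seq T, path e x p -> last x p = y -> D <= size p).

Definition adj_mx (R : realType) (n : nat) (e : rel 'I_n) : 'M[R]_n :=
  \matrix_(i < n, j < n) (e i j)%:R%R.

Definition spectral_radius (R : realType) (n : nat) (e : rel 'I_n) : R :=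
  sup [set x : R | eigenvalue (adj_mx R n e) x].

Definition graph_iso (n : nat) (e1 e2 : rel 'I_n) : Prop :=
  exists f : 'I_n -> 'I_n, bijective f /\ forall x y, e1 x y = e2 (f x) (f y).

(* The open quipu P^{(i,j)}_{(i,k-1,j)} with k = i + j, on vertex set
   {0, ..., 3k}: the main path 0 - 1 - ... - 2k (v0 = i, v1 = 2i+j = i+(k-1)+1),
   a pendent path 2k+1, ..., 2k+i attached at v0, and a pendent path
   2k+i+1, ..., 3k attached at v1.  Each vertex x > 0 is joined to its
   "parent" quipu_par x < x. *)
Definition quipu_par (k i j x : nat) : nat :=
  if x == 0 then 0
  else if x <= 2 * k then x.-1
  else if x == 2 * k + i + 1 then 2 * i + j
  else if x == 2 * k + 1 then i
  else x.-1.

Definition quipu (k i j : nat) : rel 'I_(3 * k).+1 :=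
  fun x y => ((x != 0 :> nat) && (val y == quipu_par k i j x))
          || ((y != 0 :> nat) && (val x == quipu_par k i j y)).

Arguments simple_graph {T} e.
Arguments connected_graph {T} e.
Arguments has_diameter {T} e D.
Arguments adj_mx R {n} e.
Arguments spectral_radius R {n} e.
Arguments graph_iso {n} e1 e2.

(* Main.v *)
(** A connected graph [e] with spectral radius at most [lam] has a positive vector [x] with
    [sum_(w ~ u) x w <= lam * x u]; take [lam = 2 cosh theta] with
    [tanh ((k+1) theta) = 3 tanh theta], the spectral radius of the star with three arms of
    length [k] ([lam = 2] for [k = 2], [lam = sqrt 3] for [k = 1]). Fix a geodesic
    [v_0, ..., v_2k]; [k] vertices lie off it. Local estimates of ratios of [x] along walks
    show that degrees are at most 3, that a component off the geodesic is attached at a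
    single vertex [v_a] and is a pendent path of length [m_a <= min(a, 2k - a)], and that the
    lengths up to [a] sum to at most [a], those from [a] on to at most [2k - a].
    The solution carried past a pendent path of length [mu] attached at [v_mu] is
    [Y_mu(a) = cosh((a - 2 mu) theta) - eta cosh((a - k) theta)] with
    [eta = cosh theta / cosh((k+1) theta)]; it is invariant under [a -> 2k - a],
    [mu -> k - mu], which is why all the quipus have the same spectral radius. The identity
    of [merge_identity] shows that the ratios of consecutive values of [x] along the
    geodesic are at most those of [Y_mu] for the accumulated length [mu], and since
    [Y_k(2k+1) = 0] every comparison is an equality. This leaves a pendent path of length [i]
    at [v_i] and one of length [j] at [v_(2i+j)], so the quipu is a spanning subgraph, and
    pairing [x] with its positive eigenvector excludes further edges. *)

Require Import Defs.
From HB Require Import structures.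
From mathcomp Require Import all_boot all_order all_algebra.
From mathcomp Require Import classical_sets reals.
From mathcomp Require Import ring lra zify.
Import Order.TTheory GRing.Theory Num.Theory.
Local Open Scope ring_scope.

(** * Spectral radius and positive eigenvectors *)

(** A competitor may contain cycles and chords, and only an upper bound on its spectral radius is
    known, so the local arguments have one shape: the branches seen from a vertex [u] give its
    neighbours a total above [lam * x u]. The budget is calibrated by [arm lam k = lam / 3]: three
    arms of length [k] exhaust it exactly. At [v_a] with [a <= k] the geodesic itself supplies an
    arm of length [k] on one side, so all other branches share [2 * lam / 3]. Such estimates decide
    which branches can occur but not where. Their positions come from a comparison along the whole
    geodesic, which is rigid because the values vanish one step beyond either end. The small cases
    stand apart for different reasons. For [k = 1] the radius is below 2, and the bound of all arm
    ratios by 1 fails. For [k = 2] it equals 2, so [theta = 0] and the hyperbolic functions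
    degenerate to affine ones. *)

Lemma spectral_radius_pos_eigen (R : realType) (n : nat) (e : rel 'I_n.+1)
    (y : 'I_n.+1 -> R) (lam : R) :
  symmetric e -> (forall u, 0 < y u) ->
  (forall u, \sum_(w | e u w) y w = lam * y u) -> spectral_radius R e = lam.
Proof.
move=> e_sym y_gt0 y_eig.
have sumE (z : 'I_n.+1 -> R) u : \sum_w z w * adj_mx R e w u = \sum_(w | e u w) z w.
  rewrite [RHS]big_mkcond; apply: eq_bigr => w _; rewrite mxE e_sym.
  by case: (e u w); rewrite ?mulr1 ?mulr0.
have in_lam : eigenvalue (adj_mx R e) lam.
  apply/eigenvalueP; exists (\row_u y u).
    apply/rowP => u; rewrite !mxE -y_eig -sumE.
    by apply: eq_bigr => w _; rewrite !mxE.
  apply/eqP => /rowP /(_ ord0); rewrite !mxE => y0.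
  by have := y_gt0 ord0; rewrite y0 ltxx.
have ub_lam : ubound [set x : R | eigenvalue (adj_mx R e) x]%classic lam.
  move=> mu /= /eigenvalueP[v v_eig v_neq0].
  have mu_le u : `|mu| * `|v 0 u| <= \sum_(w | e u w) `|v 0 w|.
    have := congr1 (fun z : 'rV[R]_n.+1 => z 0 u) v_eig.
    rewrite !mxE sumE => vE; rewrite -normrM -vE; exact: ler_norm_sum.
  have S_gt0 : 0 < \sum_u `|v 0 u| * y u.
    have S_ge0 : 0 <= \sum_u `|v 0 u| * y u.
      by apply: sumr_ge0 => u _; rewrite mulr_ge0 // ltW.
    rewrite lt_neqAle S_ge0 andbT eq_sym psumr_eq0; last first.
      by move=> u _; rewrite mulr_ge0 // ltW.
    apply: contra v_neq0 => /allP S0; apply/eqP/rowP => u; rewrite mxE.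
    have := S0 u (mem_index_enum u).
    by rewrite /= mulf_eq0 normr_eq0 (gt_eqF (y_gt0 u)) orbF => /eqP.
  (* Pairing [mu_le] with the positive vector [y] and moving the symmetric adjacency onto [y] bounds
     [|mu|] by [lam], whatever the signs in [v]. *)
  apply: le_trans (ler_norm mu) _; rewrite -(ler_pM2r S_gt0).
  rewrite mulr_sumr; apply: le_trans (_ : \sum_u (\sum_(w | e u w) `|v 0 w|) * y u <= _).
    by apply: ler_sum => u _; rewrite mulrA ler_wpM2r // ltW.
  under eq_bigr => u _ do rewrite mulr_suml big_mkcond.
  rewrite exchange_big mulr_sumr; apply: ler_sum => w _ /=.
  rewrite -big_mkcond /= -mulr_sumr mulrCA -y_eig.
  by rewrite (eq_bigl (e w)) // => u; rewrite e_sym.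
apply/le_anti/andP; split; first by apply: ge_sup => //; exists lam.
by apply: ub_le_sup => //; exists lam.
Qed.

(** * Rayleigh quotients and the Perron vector *)

Definition bform {R : realType} {n : nat} (B : 'M[R]_n) (u v : 'rV[R]_n) : R :=
  (u *m B *m v^T) 0 0.

Section BilinearForm.
Variables (R : realType) (n : nat) (B : 'M[R]_n).
Hypothesis B_sym : B^T = B.
Implicit Types u v w : 'rV[R]_n.

Lemma bformC u v : bform B u v = bform B v u.
Proof.
have -> : bform B u v = (u *m B *m v^T)^T 0 0 by rewrite [RHS]mxE.
by rewrite trmx_mul trmxK trmx_mul B_sym mulmxA.
Qed.

Lemma bform_lincomb a b u v :
  bform B (a *: u + b *: v) (a *: u + b *: v) =
  a ^+ 2 * bform B u u + 2 * a * b * bform B u v + b ^+ 2 * bform B v v.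
Proof.
have -> : bform B (a *: u + b *: v) (a *: u + b *: v) =
    a ^+ 2 * bform B u u + a * b * bform B u v + a * b * bform B v u
    + b ^+ 2 * bform B v v.
  rewrite /bform linearD !linearZ /= !mulmxDl !mulmxDr -!scalemxAl -!scalemxAr.
  by rewrite !mxE; ring.
by rewrite (bformC v u); ring.
Qed.

Hypothesis B_psd : forall u, 0 <= bform B u u.

Lemma bform_cauchy u v : bform B u v ^+ 2 <= bform B u u * bform B v v.
Proof.
have := B_psd u; have vv_ge0 := B_psd v.
have [vv0|vv_neq0] := eqVneq (bform B v v) 0.
  (* The usual test vector is useless when [v] is null. With this weight on [v] the form evaluates
     to [- bform B u v ^+ 2]. *)
  move=> _; have := B_psd (bform B u v *: u - ((bform B u u + 1) / 2) *: v).
  rewrite -scaleNr bform_lincomb vv0 => H; lra.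
move=> _; have := B_psd (bform B v v *: u - bform B u v *: v).
rewrite -scaleNr bform_lincomb => H.
have vv_gt0 : 0 < bform B v v by rewrite lt_neqAle eq_sym vv_neq0.
rewrite -subr_ge0 -(pmulr_rge0 _ vv_gt0); lra.
Qed.

Lemma bform_null u : bform B u u = 0 -> u *m B = 0.
Proof.
move=> uu0; apply/rowP => i; rewrite [RHS]mxE.
have := bform_cauchy u (delta_mx 0 i).
rewrite uu0 mul0r => H.
have /eqP : bform B u (delta_mx 0 i) ^+ 2 = 0.
  by apply/le_anti; rewrite H sqr_ge0.
by rewrite sqrf_eq0 /bform trmx_delta -colE mxE => /eqP.
Qed.

End BilinearForm.

Lemma sqnorm_ge0 (R : realType) n (v : 'rV[R]_n) : 0 <= (v *m v^T) 0 0.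
Proof. by rewrite mxE; apply: sumr_ge0 => i _; rewrite mxE -expr2 sqr_ge0. Qed.

Lemma sqnorm_gt0 (R : realType) n (v : 'rV[R]_n) : v != 0 -> 0 < (v *m v^T) 0 0.
Proof.
move=> v_neq0; rewrite lt_neqAle sqnorm_ge0 andbT eq_sym.
apply: contra v_neq0; rewrite mxE psumr_eq0; last first.
  by move=> i _; rewrite mxE -expr2 sqr_ge0.
move=> /allP v0; apply/eqP/rowP => i; have := v0 i (mem_index_enum i).
by rewrite !mxE /= mulf_eq0 orbb => /eqP.
Qed.

(** A crude constant is enough to keep Rayleigh quotients bounded, so that a supremum can replace
    compactness of the sphere. It is applied to the adjacency matrix and to an inverse matrix. *)
Lemma bform_bounded (R : realType) n (B : 'M[R]_n) :
  exists2 c : R, 0 < c & forall v, bform B v v <= c * (v *m v^T) 0 0.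
Proof.
pose s := \sum_i \sum_j `|B i j|.
have s_ge0 : 0 <= s by apply: sumr_ge0 => i _; apply: sumr_ge0.
exists (s + 1) => [|v]; first by lra.
have sq_le i : v 0 i ^+ 2 <= (v *m v^T) 0 0.
  rewrite mxE (bigD1 i) //= mxE -expr2 lerDl.
  by apply: sumr_ge0 => j _; rewrite mxE -expr2 sqr_ge0.
apply: le_trans (_ : s * (v *m v^T) 0 0 <= _); last first.
  by rewrite ler_wpM2r ?sqnorm_ge0 // lerDl.
rewrite /bform mxE mulr_suml.
under eq_bigr => j _ do rewrite !mxE mulr_suml.
rewrite exchange_big /=; apply: ler_sum => i _; rewrite mulr_suml.
apply: ler_sum => j _.
have := sq_le i; have := sq_le j.
set N := (_ *m _) _ _; move: (v 0 i) (v 0 j) (B i j) => a b c Hb Ha.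
apply: le_trans (ler_norm _) _; rewrite !normrM mulrAC mulrC.
apply: ler_wpM2l => //.
have := sqr_ge0 (`|a| - `|b|); rewrite sqrrB !real_normK ?num_real // => H; lra.
Qed.

(** The supremum [M] of the Rayleigh quotients is an eigenvalue because [M%:M - A] is singular.
    Taking absolute values of a kernel vector can only raise its quotient, so the result is again in
    the kernel, and a zero entry would spread along edges to the whole graph. *)
Lemma pos_eigenvector (R : realType) (n : nat) (e : rel 'I_n.+1) :
  symmetric e -> connected_graph e ->
  exists (lam : R) (x : 'I_n.+1 -> R),
    (forall u, 0 < x u) /\ (forall u, \sum_(w | e u w) x w = lam * x u).
Proof.
move=> e_sym e_conn; pose A := adj_mx R e.
have A_sym : A^T = A by apply/matrixP => i j; rewrite !mxE e_sym.
pose S := [set r : R | exists2 v : 'rV[R]_n.+1, v != 0 &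
                         r * (v *m v^T) 0 0 = bform A v v]%classic.
have [c c_gt0 c_bound] := bform_bounded _ _ A.
have S_ub : ubound S c.
  move=> r [v v_neq0 rE]; have := c_bound v.
  by rewrite -rE ler_pM2r // sqnorm_gt0.
have S_ne : (S !=set0)%classic.
  have d_neq0 : (delta_mx 0 0 : 'rV[R]_n.+1) != 0.
    apply/eqP => /rowP /(_ 0); rewrite !mxE !eqxx /= => /eqP.
    by rewrite oner_eq0.
  pose d := delta_mx 0 0 : 'rV[R]_n.+1.
  exists (bform A d d / (d *m d^T) 0 0), d => //.
  by rewrite mulfVK // gt_eqF // sqnorm_gt0.
have S_sup : has_sup S by split => //; exists c.
pose M := sup S; pose B := M%:M - A.
have BE v : bform B v v = M * (v *m v^T) 0 0 - bform A v v.
  by rewrite /bform /B mulmxBr mulmxBl mul_mx_scalar -scalemxAl !mxE.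
have B_sym : B^T = B by rewrite /B linearB /= tr_scalar_mx A_sym.
have B_psd v : 0 <= bform B v v.
  have [->|v_neq0] := eqVneq v 0; first by rewrite /bform !mul0mx mxE.
  rewrite BE subr_ge0 -ler_pdivrMr ?sqnorm_gt0 //.
  apply: (sup_upper_bound S_sup); exists v => //.
  by rewrite mulfVK // gt_eqF // sqnorm_gt0.
have detB : \det B == 0.
  apply/negPn/negP => detB.
  have B_unit : B \in unitmx by rewrite unitmxE unitfE.
  (* For invertible [B], Cauchy-Schwarz applied to [v *m invmx B] and [v] keeps every quotient at
     most [M - 1 / d], contrary to the choice of [M]. *)
  have [d d_gt0 d_bound] := bform_bounded _ _ (invmx B).
  have B_low v : (v *m v^T) 0 0 <= d * bform B v v.
    have [->|v_neq0] := eqVneq v 0; first by rewrite /bform !mul0mx mxE mulr0.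
    have := bform_cauchy _ _ _ B_sym B_psd (v *m invmx B) v.
    have E1 : bform B (v *m invmx B) v = (v *m v^T) 0 0.
      by rewrite /bform mulmxKV.
    have E2 : bform B (v *m invmx B) (v *m invmx B) = bform (invmx B) v v.
      by rewrite /bform mulmxKV // trmx_mul trmx_inv B_sym mulmxA.
    rewrite E1 E2 => H; rewrite -(ler_pM2l (sqnorm_gt0 _ _ _ v_neq0)) -expr2.
    apply: le_trans H _.
    by rewrite [leRHS]mulrCA mulrA ler_wpM2r.
  have [r [v v_neq0 rE] r_gt] := sup_adherent (divr_gt0 ltr01 d_gt0) S_sup.
  have := B_low v; rewrite BE -rE -mulrBl mulrA.
  rewrite -[leLHS]mul1r ler_pM2r ?sqnorm_gt0 //.
  move: r_gt; rewrite -/M ltrBlDr -ltrBlDl ltr_pdivlMr // mulrC.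
  by move=> /lt_le_trans /[apply]; rewrite ltxx.
have [v v_neq0 vB] := det0P detB.
pose x := \row_i `|v 0 i|.
have xB : x *m B = 0.
  apply: (bform_null _ _ _ B_sym B_psd); apply/le_anti; rewrite B_psd andbT.
  have vv0 : bform B v v = 0 by rewrite /bform vB mul0mx mxE.
  rewrite -vv0 !BE.
  have -> : (x *m x^T) 0 0 = (v *m v^T) 0 0.
    rewrite !mxE; apply: eq_bigr => i _; rewrite !mxE.
    by rewrite -!expr2 real_normK ?num_real.
  rewrite lerD2l lerN2 /bform !mxE.
  apply: ler_sum => i _; rewrite !mxE !mulr_suml; apply: ler_sum => j _.
  rewrite !mxE; case: (e j i); rewrite ?mulr0 ?mul0r // !mulr1 -normrM.
  exact: ler_norm.
have x_eig u : \sum_(w | e u w) `|v 0 w| = M * `|v 0 u|.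
  have := congr1 (fun z : 'rV[R]_n.+1 => z 0 u) xB.
  rewrite /B mulmxBr mul_mx_scalar !mxE => /eqP; rewrite subr_eq0 => /eqP ->.
  rewrite big_mkcond; apply: eq_bigr => w _; rewrite !mxE e_sym.
  by case: (e w u); rewrite ?mulr1 ?mulr0.
exists M, (fun u => `|v 0 u|); split => // u.
rewrite normr_gt0; apply: contra v_neq0 => /eqP vu0.
have nbr0 a b : v 0 a = 0 -> e a b -> v 0 b = 0.
  move=> va0 eab; have := x_eig a; rewrite va0 normr0 mulr0 => /eqP.
  rewrite psumr_eq0 // => /allP /(_ b (mem_index_enum b)).
  by rewrite eab /= normr_eq0 => /eqP.
apply/eqP/rowP => w; rewrite mxE.
have /connectP[p p_path ->] := e_conn u w.
elim: p u vu0 p_path => //= b p IHp a va0 /andP[eab].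
by apply: IHp; apply: nbr0 eab.
Qed.

Lemma perron_vector (R : realType) (n : nat) (e : rel 'I_n.+1) :
  symmetric e -> connected_graph e ->
  exists x : 'I_n.+1 -> R, (forall u, 0 < x u) /\
    (forall u, \sum_(w | e u w) x w = spectral_radius R e * x u).
Proof.
move=> e_sym e_conn; have [lam [x [x_gt0 x_eig]]] := pos_eigenvector R n e e_sym e_conn.
exists x; split => // u.
by rewrite (spectral_radius_pos_eigen R n e x lam).
Qed.

(** * Arms, forks and profiles *)

Section ArmsAndForks.
Variables (R : realType) (lam : R).

(** For an exact solution along a pendent path of length [m], the value at its first vertex divided
    by the value at the vertex carrying it. Length 0 contributes nothing. *)
Fixpoint arm (m : nat) : R := if m is m'.+1 then (lam - arm m')^-1 else 0.

(** The analogous ratio when the branch ends, [h] steps away, in a vertex with two leaves; [2 / lam]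
    is what these leaves contribute there. *)
Fixpoint fork (h : nat) : R := if h is h'.+1 then (lam - fork h')^-1 else 2 / lam.

Lemma inv_sub_le1 (r : R) : 2 <= lam -> r <= 1 -> (lam - r)^-1 <= 1.
Proof. by move=> lam_ge2 r_le1; rewrite invf_le1; lra. Qed.

Lemma arm_bounds m : 2 <= lam -> 0 <= arm m <= 1.
Proof.
move=> lam_ge2; elim: m => [|m /andP[_ IHm]] /=; first by rewrite lexx ler01.
by rewrite inv_sub_le1 // invr_ge0 andbT; lra.
Qed.

Lemma fork_bounds h : 2 <= lam -> 0 < fork h <= 1.
Proof.
move=> lam_ge2; elim: h => [|h /andP[_ IHh]] /=.
  by rewrite divr_gt0 ?ler_pdivrMr ?mul1r ?lam_ge2 //; lra.
by rewrite inv_sub_le1 // invr_gt0 andbT; lra.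
Qed.

Lemma arm_mono m m' : 2 <= lam -> (m <= m')%N -> arm m <= arm m'.
Proof.
move=> lam_ge2; elim: m m' => [|m IHm] [|m'] //= le_mm'; first by case/andP: (arm_bounds m'.+1 lam_ge2).
have := IHm m' le_mm'; have := arm_bounds m lam_ge2; have := arm_bounds m' lam_ge2 => *.
by rewrite lef_pV2 ?posrE; lra.
Qed.

End ArmsAndForks.
Arguments arm {R}.
Arguments fork {R}.

(* [yy mu n] is the value at vertex [n - 1] of the main path of the solution carried past
   a pendent path of length [mu] attached at vertex [mu]; [yy 0] is the solution on a bare
   path, vanishing one step before its first vertex. *)
Record profile (R : realType) (k : nat) (lam : R) (yy : nat -> nat -> R) : Prop := {
  profile_start : yy 0%N 0%N = 0;
  profile_rec : forall mu n, (mu <= k)%N -> (n <= 2 * k)%N ->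
    yy mu n + yy mu n.+2 = lam * yy mu n.+1;
  profile_gt0 : forall mu n, (mu <= k)%N -> (0 < n <= (2 * k).+1)%N -> 0 < yy mu n;
  profile_refl : forall mu n, (mu <= k)%N -> (n <= (2 * k).+2)%N ->
    yy mu n = yy (k - mu)%N ((2 * k).+2 - n)%N;
  profile_match : forall mu, (mu <= k)%N -> yy mu mu.+1 = yy 0%N mu.+1;
  profile_jump : forall mu, (mu <= k)%N -> yy mu mu.+2 = yy 0%N mu.+2 - yy 0%N mu }.

(* Attaching length [m] at vertex [a] to a path that already carries [mu] lowers the ratio
   of consecutive values at least to that of a single pendent path of length [mu + m]. *)
Definition merging (R : realType) (k : nat) (lam : R) (yy : nat -> nat -> R) :=
  forall mu m a : nat, (0 < m)%N -> (mu + m <= k)%N -> (mu + m <= a)%N -> (a <= k + mu)%N ->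
  yy mu a.+2 * yy (mu + m)%N a.+1 - yy mu a.+1 * yy (mu + m)%N a.+2
     <= arm lam m * (yy mu a.+1 * yy (mu + m)%N a.+1) /\
  (yy mu a.+2 * yy (mu + m)%N a.+1 - yy mu a.+1 * yy (mu + m)%N a.+2
     = arm lam m * (yy mu a.+1 * yy (mu + m)%N a.+1) ->
   a = (2 * mu + m)%N /\ (mu = 0%N \/ (mu + m)%N = k)).

(** The summand [lam / 3] stands for an arm of length [k]. A vertex with such an arm, an arm of
    length [m] and a branching at distance [h < m], in three different directions, would exceed its
    budget. *)
Definition fork_excess (R : realType) (lam : R) :=
  forall h m, (0 < h)%N -> (h < m)%N -> lam < fork lam h + arm lam m + lam / 3.

(** * Hyperbolic functions and the two identities behind merging *)

Section Hyperbolic.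
Variable R : realType.
Implicit Types x y t : R.

(** Twice the hyperbolic cosine and sine of [ln x]. With powers of [t] as arguments all identities
    are rational. *)
Definition ch x : R := x + x^-1.
Definition sh x : R := x - x^-1.

Lemma chV x : ch x^-1 = ch x.
Proof. by rewrite /ch invrK addrC. Qed.

Lemma ch_le x y : 0 < x -> y^-1 <= x -> x <= y -> ch x <= ch y.
Proof.
move=> x_gt0 le1 le2; have y_gt0 : 0 < y by lra.
have xy_ge1 : 1 <= x * y by rewrite -(mulVf (lt0r_neq0 y_gt0)) ler_wpM2r // ltW.
have -> : ch y = ch x + (y - x) * (x * y - 1) / (x * y).
  by rewrite /ch; field; rewrite !gt_eqF.
rewrite lerDl divr_ge0 ?mulr_ge0 ?subr_ge0 //; lra.
Qed.

Lemma ch_lt x y : 1 <= x -> x < y -> ch x < ch y.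
Proof.
move=> x_ge1 lt_xy; have x_gt0 : 0 < x by lra.
have y_gt0 : 0 < y by lra.
have xy_gt1 : 1 < x * y by nra.
have -> : ch y = ch x + (y - x) * (x * y - 1) / (x * y).
  by rewrite /ch; field; rewrite !gt_eqF.
by rewrite ltrDl divr_gt0 ?mulr_gt0 ?subr_gt0.
Qed.

Lemma ch_ge2 x : 0 < x -> 2 <= ch x.
Proof.
move=> x_gt0; have -> : ch x = 2 + (x - 1) ^+ 2 / x.
  by rewrite /ch; field; rewrite gt_eqF.
by rewrite lerDl divr_ge0 ?sqr_ge0 // ltW.
Qed.

Lemma shE x : 0 < x -> sh x = (x - 1) * (x + 1) / x.
Proof. by move=> x_gt0; rewrite /sh; field; rewrite gt_eqF. Qed.

Lemma sh_ge0 x : 1 <= x -> 0 <= sh x.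
Proof.
by move=> x_ge1; rewrite shE ?divr_ge0 ?mulr_ge0 //; lra.
Qed.

Lemma sh_gt0 x : 1 < x -> 0 < sh x.
Proof.
by move=> x_gt1; rewrite shE ?divr_gt0 ?mulr_gt0 //; lra.
Qed.

Lemma sh_eq0 x : 0 < x -> sh x = 0 -> x = 1.
Proof.
move=> x_gt0; rewrite shE // => /eqP.
rewrite !mulf_eq0 invr_eq0 (gt_eqF x_gt0) orbF => /orP[] /eqP; lra.
Qed.

End Hyperbolic.
Arguments ch {R}.
Arguments sh {R}.

(** Used with [p = t^(k-mu-m)], [q = t^mu], [w = t^m], [r = t^(a-2mu-m)]. The first product is that
    of the two profiles at vertex [a]; the second is [sh t * sh (t^(m+1))] times the bracket of the
    Wronskian. A square and a product of two [sh], nonnegative in the admissible range, remain. *)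
Lemma merge_identity (R : realType) (eta p q r w : R) :
  0 < p -> 0 < q -> 0 < r -> 0 < w ->
  (ch (w * r) - eta * ch (q * r / p)) * (ch (r / w) - eta * ch (q * r / p))
  - (ch w - eta * ch (p * q)) * (ch w - eta * ch (p / q))
  = (1 - eta ^+ 2) * sh r ^+ 2
    + eta * (sh (p / r) * sh (q * r)) * (ch w - eta * ch (p / q)).
Proof.
by move=> p_gt0 q_gt0 r_gt0 w_gt0; rewrite /ch /sh; field; rewrite !gt_eqF.
Qed.

(** Both profiles solve one recurrence, so their Wronskian does not depend on [a]; hence [r] is
    absent on the right. *)
Lemma wronskian_identity (R : realType) (t eta p q r w : R) :
  0 < t -> 0 < p -> 0 < q -> 0 < r -> 0 < w ->
  (ch (w * r * t) - eta * ch (q * r * t / p)) * (ch (r / w) - eta * ch (q * r / p))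
  - (ch (w * r) - eta * ch (q * r / p)) * (ch (r * t / w) - eta * ch (q * r * t / p))
  = sh t * sh w * (ch w - eta * ch (p / q)).
Proof.
by move=> t_gt0 p_gt0 q_gt0 r_gt0 w_gt0; rewrite /ch /sh; field; rewrite !gt_eqF.
Qed.

(** * The hyperbolic profile for k at least 3 *)

(* The equation is [sh (t^(k+1)) * ch t = 3 * sh t * ch (t^(k+1))] multiplied out, i.e.
   [tanh ((k+1) theta) = 3 tanh theta] for [t = exp theta]: it expresses that the star with three arms of length [k] has eigenvalue [ch t]. *)
Definition hyperbolic_root (R : realType) (k : nat) (t : R) :=
  [/\ 0 < t, 17 / 10 <= t ^+ 2, t ^+ 2 < 2 &
      t ^+ 2 ^+ k.+1 * (2 - t ^+ 2) = 2 * t ^+ 2 - 1].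

(** With [s = t^2] the equation also has the root [s = 1], which must be excluded. The end 17/10 is
    low enough for a sign change already at [k = 3], as [(17/10)^4 * 3/10 > 24/10], and high enough
    for [s^2 * (s - 1) >= 2], needed in [hyp_fork_excess]. *)
Lemma hyperbolic_root_exists (R : realType) (k : nat) :
  (3 <= k)%N -> exists t : R, hyperbolic_root R k t.
Proof.
move=> k_ge3; pose p : {poly R} := 2 *: 'X - 1 - 'X^(k.+1) * (2 - 'X).
have pE x : p.[x] = 2 * x - 1 - x ^+ k.+1 * (2 - x).
  by rewrite /p !hornerE.
have [] := @poly_ivt R p (17 / 10) 2; first by lra.
  rewrite !pE subrr mulr0; apply/andP; split; last by lra.
  have : (17 / 10 : R) ^+ 4 <= (17 / 10) ^+ k.+1 by apply: ler_weXn2l; [lra | lia].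
  by move: ((17 / 10 : R) ^+ k.+1) => z; rewrite !exprS expr0; lra.
move=> s /andP[s_ge s_le] /rootP; rewrite pE => s_root.
have s_lt2 : s < 2.
  rewrite lt_neqAle s_le andbT; apply/eqP => s2.
  by move: s_root; rewrite s2 subrr mulr0; lra.
have sE : Num.sqrt s ^+ 2 = s by rewrite sqr_sqrtr; lra.
exists (Num.sqrt s); split; rewrite ?sE //; [by rewrite sqrtr_gt0; lra | lra].
Qed.

Section HyperbolicProfile.
Variables (R : realType) (k : nat) (t : R).
Hypothesis t_root : hyperbolic_root R k t.
Hypothesis k_ge3 : (3 <= k)%N.

Lemma root_t_gt0 : 0 < t. Proof. by case: t_root. Qed.
Lemma root_sqr_ge : 17 / 10 <= t ^+ 2. Proof. by case: t_root. Qed.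
Lemma root_sqr_lt : t ^+ 2 < 2. Proof. by case: t_root. Qed.
Lemma root_eq : t ^+ 2 ^+ k.+1 * (2 - t ^+ 2) = 2 * t ^+ 2 - 1.
Proof. by case: t_root. Qed.
Let t_gt0 := root_t_gt0.

Lemma root_t_gt1 : 1 < t.
Proof.
have := t_gt0; have := root_sqr_ge => s_ge t_gt0'.
by rewrite ltNge; apply/negP => t_le1; nra.
Qed.
Let t_gt1 := root_t_gt1.

Lemma tX_gt0 n : 0 < t ^+ n. Proof. exact: exprn_gt0. Qed.

Lemma tX_gt1 n : (0 < n)%N -> 1 < t ^+ n.
Proof. by move=> n_gt0; rewrite exprn_egt1 // -lt0n. Qed.

Lemma tX_le m n : (m <= n)%N -> t ^+ m <= t ^+ n.
Proof. by move=> le_mn; apply: ler_weXn2l => //; apply: ltW t_gt1. Qed.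

Lemma tX_lt m n : (m < n)%N -> t ^+ m < t ^+ n.
Proof. by move=> lt_mn; rewrite ltr_eXn2l. Qed.

Local Notation lam := (ch t).

Lemma lam_ge2 : 2 <= lam. Proof. exact: ch_ge2. Qed.

Lemma lam_sqrE : lam ^+ 2 = t ^+ 2 + 2 + (t ^+ 2)^-1.
Proof. by have := t_gt0 => ?; rewrite /ch; field; rewrite gt_eqF. Qed.

Lemma lam_sqr_lt : lam ^+ 2 < 9 / 2.
Proof.
have := root_sqr_ge; have := root_sqr_lt; rewrite lam_sqrE.
move: (t ^+ 2) => s s_lt s_ge.
have : s^-1 < 5 / 2 - s; last by lra.
have s_gt0 : 0 < s by lra.
by rewrite -(ltr_pM2r s_gt0) mulVf ?gt_eqF //; nra.
Qed.

Lemma armE m : arm lam m = sh (t ^+ m) / sh (t ^+ m.+1).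
Proof.
elim: m => [|m IHm]; first by rewrite /= expr0 /sh invr1 subrr mul0r.
have t0 := t_gt0; have tm := tX_gt0 m.
rewrite [LHS]/= IHm.
have S1 : sh (t ^+ m.+1) != 0 by rewrite gt_eqF // sh_gt0 // tX_gt1.
have S2 : sh (t ^+ m.+2) != 0 by rewrite gt_eqF // sh_gt0 // tX_gt1.
have -> : lam - sh (t ^+ m) / sh (t ^+ m.+1) = sh (t ^+ m.+2) / sh (t ^+ m.+1).
  rewrite -[lam](mulfK S1) -mulrBl; congr (_ / _).
  by rewrite /ch /sh !exprS; field; rewrite !gt_eqF.
by rewrite invf_div.
Qed.

Lemma forkE h : fork lam h = ch (t ^+ h) / ch (t ^+ h.+1).
Proof.
elim: h => [|h IHh]; first by rewrite /= expr0 expr1 {2}/ch invr1.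
have t0 := t_gt0; have th := tX_gt0 h.
have C0 n : ch (t ^+ n) != 0.
  by rewrite gt_eqF // (lt_le_trans _ (ch_ge2 _ _ (tX_gt0 n))).
rewrite [LHS]/= IHh.
have -> : lam - ch (t ^+ h) / ch (t ^+ h.+1) = ch (t ^+ h.+2) / ch (t ^+ h.+1).
  rewrite -[lam](mulfK (C0 h.+1)) -mulrBl; congr (_ / _).
  by rewrite /ch !exprS; field; rewrite !gt_eqF.
by rewrite invf_div.
Qed.

Local Notation U := (t ^+ k.+1).
Definition eta : R := lam / ch U.

Lemma root_sh : sh U * lam = 3 * sh t * ch U.
Proof.
have t0 := t_gt0; have U0 := tX_gt0 k.+1; have := root_eq.
rewrite -exprM mulnC exprM.
move: (U) U0 => u u_gt0 E.
suff : (u ^+ 2 - 1) * (t ^+ 2 + 1) = 3 * (t ^+ 2 - 1) * (u ^+ 2 + 1).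
  have -> : sh u * lam = (u ^+ 2 - 1) * (t ^+ 2 + 1) / (u * t).
    by rewrite /sh /ch; field; rewrite !gt_eqF.
  have -> : 3 * sh t * ch u = 3 * (t ^+ 2 - 1) * (u ^+ 2 + 1) / (u * t).
    by rewrite /sh /ch; field; rewrite !gt_eqF.
  by move=> ->.
lra.
Qed.

Lemma ch_U_gt0 : 0 < ch U.
Proof. by rewrite (lt_le_trans _ (ch_ge2 _ _ (tX_gt0 k.+1))). Qed.

Lemma eta_ch : eta * ch U = lam.
Proof. by rewrite /eta mulfVK // gt_eqF // ch_U_gt0. Qed.

Lemma eta_sh : eta * sh U = 3 * sh t.
Proof.
rewrite /eta mulrAC [lam * _]mulrC root_sh mulfK //.
by rewrite gt_eqF // ch_U_gt0.
Qed.

Lemma arm_k : arm lam k = lam / 3.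
Proof.
have SU : 0 < sh U by rewrite sh_gt0 // tX_gt1.
have E := root_sh; have t0 := t_gt0; have tk := tX_gt0 k.
have E' : 2 * sh (t ^+ k) = sh U * lam - ch U * sh t.
  by rewrite /ch /sh !exprS; field; rewrite !gt_eqF.
have shkE : sh (t ^+ k) = lam / 3 * sh U by lra.
by rewrite armE shkE mulfK // gt_eqF.
Qed.

(** The values of [eta * ch U] and [eta * sh U] turn the addition formula for [ch (U / b)] into an
    expression without [U]. This is how the equation for [t] enters the profiles. *)
Lemma eta_shift b : 0 < b -> eta * ch (U / b) = 2 * ch (b / t) - ch (b * t).
Proof.
move=> b0; have t0 := t_gt0; have U0 := tX_gt0 k.+1.
have -> : ch (U / b) = (ch U * ch b - sh U * sh b) / 2.
  by rewrite /ch /sh; field; rewrite !gt_eqF.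
rewrite mulrA mulrBr !mulrA eta_ch eta_sh.
by rewrite /ch /sh; field; rewrite !gt_eqF.
Qed.

Lemma eta_gt0 : 0 < eta.
Proof. by rewrite /eta divr_gt0 ?ch_U_gt0 // (lt_le_trans _ lam_ge2). Qed.

Lemma eta_lt1 : eta < 1.
Proof.
have lt_tU : t < U by rewrite -[X in X < _]expr1 tX_lt //; lia.
by rewrite /eta ltr_pdivrMr ?ch_U_gt0 // mul1r ch_lt // ltW.
Qed.

(** At the extreme [x = t^k] the shift formula gives [4 - ch (t^2)], which is below 2. Positivity of
    the profiles follows since [ch] is at least 2. *)
Lemma eta_ch_lt2 x : 0 < x -> (t ^+ k)^-1 <= x -> x <= t ^+ k -> eta * ch x < 2.
Proof.
move=> x_gt0 x_ge x_le.
apply: le_lt_trans (_ : eta * ch (t ^+ k) < 2).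
  by rewrite ler_pM2l ?eta_gt0 // ch_le.
have -> : t ^+ k = U / t by rewrite exprS mulrAC mulfV ?mul1r // gt_eqF.
rewrite eta_shift // mulfV ?gt_eqF // {1}/ch invr1.
have : ch 1 < ch (t * t) by rewrite ch_lt // -expr2 tX_gt1.
by rewrite {1}/ch invr1 => ?; lra.
Qed.

Definition hyp_profile (mu n : nat) : R :=
  ch (t ^+ n / t ^+ (2 * mu).+1) - eta * ch (t ^+ n / U).
Local Notation yy := hyp_profile.

Lemma hyp_profile0 n : yy 0 n = sh t * sh (t ^+ n).
Proof.
have t0 := t_gt0; have U0 := tX_gt0 k.+1; have tn := tX_gt0 n.
rewrite /hyp_profile -[ch (_ / U)]chV invf_div eta_shift // expr1.
by rewrite /ch /sh; field; rewrite !gt_eqF.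
Qed.

Lemma hyp_profile_spec : profile R k lam yy.
Proof.
have t0 := t_gt0; have tX := tX_gt0.
split.
- by rewrite hyp_profile0 expr0 {2}/sh invr1 subrr mulr0.
- move=> mu n _ _; rewrite /hyp_profile !exprS.
  rewrite /ch; move: (eta) (t ^+ n) (t ^+ _) (t ^+ k) (tX n) (tX (2 * mu)%N) (tX k).
  by move=> a b c d b0 c0 d0; field; rewrite !gt_eqF.
- move=> mu n mu_le /andP[n_gt0 n_le].
  rewrite /hyp_profile subr_gt0.
  apply: lt_le_trans (_ : 2 <= _); last by rewrite ch_ge2 // divr_gt0.
  apply: eta_ch_lt2; first by rewrite divr_gt0.
    by rewrite ler_pdivlMr // mulrC ler_pdivrMr // -exprD tX_le //; lia.
  by rewrite ler_pdivrMr // -exprD tX_le //; lia.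
- move=> mu n mu_le n_le; rewrite /hyp_profile.
  rewrite -[ch (t ^+ n / U)]chV -[ch (t ^+ n / t ^+ (2 * mu).+1)]chV !invf_div.
  congr (ch _ - _ * ch _); apply/eqP; rewrite (eqr_div _ _ (lt0r_neq0 (tX _)) (lt0r_neq0 (tX _))) -!exprD; apply/eqP;
    congr (_ ^+ _); lia.
- move=> mu mu_le; rewrite /hyp_profile -[ch (t ^+ mu.+1 / t ^+ (2 * mu).+1)]chV.
  congr (ch _ - _); rewrite invf_div.
  by apply/eqP; rewrite (eqr_div _ _ (lt0r_neq0 (tX _)) (lt0r_neq0 (tX _))) -!exprD; apply/eqP; congr (_ ^+ _); lia.
- move=> mu mu_le; rewrite !hyp_profile0 /hyp_profile.
  rewrite -[ch (_ / U)]chV invf_div eta_shift //.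
  have -> : t ^+ (2 * mu).+1 = t ^+ mu * t ^+ mu * t by rewrite exprS mul2n -addnn exprD mulrC.
  rewrite !exprS; move: (t ^+ mu) (tX mu) => a a0.
  by rewrite /ch /sh; field; rewrite !gt_eqF.
Qed.

Lemma hyp_merging : merging R k lam yy.
Proof.
have t0 := t_gt0; have tX := tX_gt0.
move=> mu m a m_gt0 le_k le_a a_le.
have [kap kE] : exists kap, k = (kap + mu + m)%N by exists (k - (mu + m))%N; lia.
pose p := t ^+ kap; pose q := t ^+ mu; pose w := t ^+ m.
pose r := t ^+ a / (q * q * w).
have p0 : 0 < p by rewrite tX_gt0.
have q0 : 0 < q by rewrite tX_gt0.
have w0 : 0 < w by rewrite tX_gt0.
have r0 : 0 < r by rewrite divr_gt0 ?mulr_gt0.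
have taE : t ^+ a = r * (q * q * w) by rewrite mulfVK // gt_eqF ?mulr_gt0.
have UE : U = t * (p * q * w) by rewrite exprS kE !exprD.
have tqE : t ^+ (2 * mu).+1 = t * (q * q) by rewrite exprS mul2n -addnn exprD.
have tqwE : t ^+ (2 * (mu + m)).+1 = t * (q * q * w * w).
  by rewrite exprS mul2n -addnn !exprD /q /w; ring.
have Y1 : yy mu a.+1 = ch (w * r) - eta * ch (q * r / p).
  rewrite /hyp_profile tqE UE exprS taE.
  by congr (ch _ - _ * ch _); field; rewrite !gt_eqF.
have Y2 : yy mu a.+2 = ch (w * r * t) - eta * ch (q * r * t / p).
  rewrite /hyp_profile tqE UE !exprS taE.
  by congr (ch _ - _ * ch _); field; rewrite !gt_eqF.
have Z1 : yy (mu + m) a.+1 = ch (r / w) - eta * ch (q * r / p).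
  rewrite /hyp_profile tqwE UE exprS taE.
  by congr (ch _ - _ * ch _); field; rewrite !gt_eqF.
have Z2 : yy (mu + m) a.+2 = ch (r * t / w) - eta * ch (q * r * t / p).
  rewrite /hyp_profile tqwE UE !exprS taE.
  by congr (ch _ - _ * ch _); field; rewrite !gt_eqF.
have St : 0 < sh t by rewrite sh_gt0.
have Sw : 0 < sh w by rewrite sh_gt0 // tX_gt1.
have Swt : 0 < sh (t ^+ m.+1) by rewrite sh_gt0 // tX_gt1.
have armwE : sh t * sh (t ^+ m.+1) = ch w - eta * ch (p * q).
  rewrite -hyp_profile0 /hyp_profile expr1 UE exprS -/w mulrAC mulfV ?mul1r ?gt_eqF //.
  rewrite -[ch (_ / (t * _))]chV; congr (_ - _ * ch _).
  by field; rewrite !gt_eqF.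
have brk_gt0 : 0 < ch w - eta * ch (p / q).
  rewrite subr_gt0; apply: lt_le_trans (ch_ge2 _ _ w0).
  apply: eta_ch_lt2; first by rewrite divr_gt0.
    by rewrite ler_pdivlMr // mulrC ler_pdivrMr // -exprD tX_le //; clear - kE a_le; lia.
  by rewrite ler_pdivrMr // -exprD tX_le //; clear - kE a_le; lia.
have Spr : 0 <= sh (p / r).
  rewrite sh_ge0 // ler_pdivlMr // mul1r /r ler_pdivrMr ?mulr_gt0 //.
  by rewrite /p /q /w -!exprD tX_le //; clear - kE a_le; lia.
have Sqr : 0 <= sh (q * r).
  have -> : q * r = t ^+ a / (q * w) by rewrite /r; field; rewrite !gt_eqF.
  by rewrite sh_ge0 // ler_pdivlMr ?mulr_gt0 // mul1r /q /w -exprD tX_le.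
have e0 := eta_gt0; have e1 := eta_lt1.
have ident := merge_identity R eta p q r w p0 q0 r0 w0.
have wron := wronskian_identity R t eta p q r w t0 p0 q0 r0 w0.
rewrite -Y1 -Z1 -armwE in ident; rewrite -Y1 -Y2 -Z1 -Z2 in wron.
have eta2 : 0 < 1 - eta ^+ 2 by nra.
rewrite wron; set YZ := yy mu a.+1 * _ in ident *.
set B := ch w - eta * ch (p / q) in ident brk_gt0 *.
set D1 := (1 - eta ^+ 2) * sh r ^+ 2 in ident.
set D2 := eta * (sh (p / r) * sh (q * r)) * B in ident.
have D1_ge0 : 0 <= D1 by rewrite mulr_ge0 ?sqr_ge0 // ltW.
have D2_ge0 : 0 <= D2.
  by apply: mulr_ge0 (ltW brk_gt0); apply: mulr_ge0 (ltW e0) _; apply: mulr_ge0.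
(* The product of the profiles times [arm lam m] is the Wronskian plus a nonnegative remainder. The
   remainder vanishes only for [r = 1], which fixes [a], together with [p = 1] or [q = 1], the two
   alternatives for [mu]. *)
have armYZ : arm lam m * YZ = sh t * sh w * B + sh w / sh (t ^+ m.+1) * (D1 + D2).
  rewrite armE -ident -/w; move: (sh w) (sh t) (sh _) Swt => s1 s2 s3 s3_gt0.
  by field; rewrite gt_eqF.
have ratio_gt0 : 0 < sh w / sh (t ^+ m.+1) by rewrite divr_gt0.
rewrite armYZ; split.
  by rewrite lerDl mulr_ge0 ?addr_ge0 // ltW.
move=> /eqP; rewrite -[X in X == _]addr0 (inj_eq (addrI _)) eq_sym mulf_eq0 (gt_eqF ratio_gt0) /=.
rewrite paddr_eq0 // => /andP[/eqP D10 /eqP D20].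
have r1 : r = 1.
  apply: sh_eq0 => //; move/eqP: D10; rewrite mulf_eq0 (gt_eqF eta2) /=.
  by rewrite sqrf_eq0 => /eqP.
have aE : a = (2 * mu + m)%N.
  apply: (@ieexprIn R t t0 (negbT (gt_eqF t_gt1)) a (2 * mu + m)%N).
  by rewrite taE r1 mul1r mul2n -addnn !exprD.
split => //.
have /eqP : sh (p / r) * sh (q * r) = 0.
  apply: (mulfI (lt0r_neq0 e0)); apply: (mulIf (lt0r_neq0 brk_gt0)).
  by rewrite mulr0 mul0r.
rewrite mulf_eq0 r1 mulr1 divr1; case/orP => /eqP /sh_eq0 E; [right | left].
  have := E p0; have [kap0 _|kap_gt0] := posnP kap; first by rewrite kE kap0.
  by move=> p1; have := tX_gt1 kap kap_gt0; rewrite -/p p1 ltxx.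
have := E q0; have [//|mu_gt0] := posnP mu.
by move=> q1; have := tX_gt1 mu mu_gt0; rewrite -/q q1 ltxx.
Qed.

End HyperbolicProfile.

(** * Rational estimates in [s], the square of [t] *)

Section HyperbolicEstimates.
Variables (R : realType) (k : nat) (t : R).
Hypothesis t_root : hyperbolic_root R k t.
Hypothesis k_ge3 : (3 <= k)%N.
Local Notation lam := (ch t).
Local Notation s := (t ^+ 2).
Let t_gt0 : 0 < t := root_t_gt0 R k t t_root.

Lemma sX_ge n : (0 < n)%N -> s <= s ^+ n.
Proof.
move=> n_gt0; rewrite -[X in X <= _]expr1; apply: ler_weXn2l => //.
by have := root_sqr_ge R k t t_root; lra.
Qed.

Lemma mul_t_lam : t * lam = s + 1.
Proof. by have := t_gt0 => t0; rewrite /ch; field; rewrite gt_eqF. Qed.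

Lemma mul_t_arm n : t * arm lam n = 1 - (s - 1) / (s ^+ n.+1 - 1).
Proof.
have := root_sqr_ge R k t t_root => s_ge; have t0 := t_gt0.
have sn := sX_ge n.+1 isT.
rewrite (armE R k t t_root).
have tn := tX_gt0 R k t t_root n.
have e1 : t ^+ n.+1 = t ^+ n * t by rewrite exprSr.
have e2 : s ^+ n.+1 = (t ^+ n * t) ^+ 2 by rewrite -e1 -!exprM mulnC.
move: sn; rewrite e2 e1; move: (t ^+ n) tn => a a0 at2.
rewrite /sh; field; rewrite !gt_eqF //=.
by rewrite subr_gt0; apply: lt_le_trans at2; lra.
Qed.

Lemma mul_t_fork h : t * fork lam h = 1 + (s - 1) / (s ^+ h.+1 + 1).
Proof.
have t0 := t_gt0; rewrite (forkE R k t t_root).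
have tn := tX_gt0 R k t t_root h.
have e1 : t ^+ h.+1 = t ^+ h * t by rewrite exprSr.
have e2 : s ^+ h.+1 = (t ^+ h * t) ^+ 2 by rewrite -e1 -!exprM mulnC.
rewrite e2 e1; move: (t ^+ h) tn => a a0.
rewrite /ch; field; rewrite !gt_eqF //=.
by rewrite ltr_wpDl ?sqr_ge0.
Qed.

(** After multiplication by [t], the bound [s < 2] reduces the claim to [t * fork + t * arm >= 2],
    with [m = h + 1] as worst case. The two ratios deviate from 1 in opposite directions, and
    comparing the deviations needs [s^(h+1) * (s - 1) >= 2], where [h > 0] supplies two factors
    [s]. *)
Lemma hyp_fork_excess : fork_excess R lam.
Proof.
move=> h m h_gt0 lt_hm; have t0 := t_gt0.
have := root_sqr_ge R k t t_root; have := root_sqr_lt R k t t_root => s_lt s_ge.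
have arm_le : arm lam h.+1 <= arm lam m.
  by apply: arm_mono lt_hm; apply: lam_ge2 t_root.
suff : 2 <= t * fork lam h + t * arm lam h.+1.
  move=> H; rewrite -(ltr_pM2l t0) mul_t_lam.
  have -> : t * (fork lam h + arm lam m + lam / 3) =
            t * fork lam h + t * arm lam m + t * lam / 3 by ring.
  by rewrite mul_t_lam; have := ler_wpM2l (ltW t0) arm_le; lra.
rewrite mul_t_fork mul_t_arm.
have : s * s <= s ^+ h.+1.
  by rewrite [X in _ <= X]exprS ler_wpM2l ?sX_ge //; lra.
rewrite [s ^+ h.+2]exprS; move: (s) (s ^+ h.+1) s_lt s_ge => a b a_lt a_ge b_ge.
have b1 : 0 < b + 1 by nra.
have b2 : 0 < a * b - 1 by nra.
suff : (a - 1) / (a * b - 1) <= (a - 1) / (b + 1) by lra.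
rewrite ler_wpM2l ?lef_pV2 ?posrE //; first by lra.
by nra.
Qed.

(* [slope z] is the ratio [y_1 / y_0] of the solution [y_n = t^n + z t^(-n)]. *)
Definition slope (z : R) : R := (t + z / t) / (1 + z).

Lemma mul_t_slope z : 0 < z -> t * slope z = 1 + (s - 1) / (1 + z).
Proof.
move=> z0; have t0 := t_gt0; rewrite /slope; field.
by rewrite (gt_eqF t0) /= gt_eqF //; lra.
Qed.

(** Enlarging [z2] until [z1 * z2 = z^2] only lowers the right-hand side; then the difference has
    the numerator [(z - 1) * (z - z1)^2]. *)
Lemma inv_sum_ge (z1 z2 z : R) : 0 < z1 -> 0 < z2 -> 1 <= z -> z1 * z2 <= z ^+ 2 ->
  2 / (1 + z) <= (1 + z1)^-1 + (1 + z2)^-1.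
Proof.
move=> z1_gt0 z2_gt0 z_ge1 z_prod.
have q_ge0 : 0 <= z ^+ 2 / z1 by rewrite divr_ge0 ?sqr_ge0 // ltW.
apply: le_trans (_ : (1 + z1)^-1 + (1 + z ^+ 2 / z1)^-1 <= _); last first.
  rewrite lerD2l lef_pV2 ?posrE; last 2 first; [by lra | by lra |].
  by rewrite lerD2l ler_pdivlMr // mulrC.
have d1 : 0 < 1 + z1 by lra.
have d2 : 0 < z1 + z ^+ 2 by nra.
have d3 : 0 < 1 + z by lra.
rewrite -subr_ge0.
have -> : (1 + z1)^-1 + (1 + z ^+ 2 / z1)^-1 - 2 / (1 + z) =
   (z - 1) * (z - z1) ^+ 2 / ((1 + z1) * (z1 + z ^+ 2) * (1 + z)).
  by field; rewrite !gt_eqF.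
apply: divr_ge0; first by apply: mulr_ge0; [lra | exact: sqr_ge0].
by apply: mulr_ge0; [apply: mulr_ge0 |]; apply: ltW.
Qed.

Lemma slope_sum_ge (z1 z2 z : R) : 0 < z1 -> 0 < z2 -> 1 <= z -> z1 * z2 <= z ^+ 2 ->
  2 + 2 * (s - 1) / (1 + z) <= t * (slope z1 + slope z2).
Proof.
move=> z1_gt0 z2_gt0 z_ge1 z_prod; rewrite [t * (_ + _)]mulrDr !mul_t_slope //.
have := inv_sum_ge z1 z2 z z1_gt0 z2_gt0 z_ge1 z_prod.
have := root_sqr_ge R k t t_root; move: (s) => a a_ge H.
have : (a - 1) * (2 / (1 + z)) <= (a - 1) * ((1 + z1)^-1 + (1 + z2)^-1).
  by rewrite ler_wpM2l //; lra.
lra.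
Qed.

(** Two slopes add up to [lam] exactly when their parameters are inverse to each other, as for one
    solution read in both directions. A smaller product makes the sum larger. *)
Lemma slope_sum_ge1 (z1 z2 : R) : 0 < z1 -> 0 < z2 ->
  slope z1 + slope z2 <= lam -> 1 <= z1 * z2.
Proof.
move=> z1_gt0 z2_gt0 le_lam; rewrite leNgt; apply/negP => z_lt1.
have t0 := t_gt0; have := root_sqr_ge R k t t_root => s_ge.
move: le_lam; rewrite -(ler_pM2l t0) [t * (_ + _)]mulrDr mul_t_lam !mul_t_slope //.
have -> : (s - 1) / (1 + z2) = (s - 1) * (1 + z2)^-1 by [].
have : 1 < (1 + z1)^-1 + (1 + z2)^-1.
  have -> : (1 + z1)^-1 + (1 + z2)^-1 = 1 + (1 - z1 * z2) / ((1 + z1) * (1 + z2)).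
    by field; apply/andP; split; rewrite gt_eqF //; lra.
  rewrite ltrDl divr_gt0 ?mulr_gt0 //; lra.
move: (s) s_ge (_^-1) (_^-1) => a a_ge b c bc; nra.
Qed.

Lemma slope_sum_short P z1 z2 : 0 < z1 -> 0 < z2 -> z1 * z2 <= s ^+ P.+1 ^+ 2 ->
  arm lam P + slope z1 + slope z2 <= lam -> P = 0%N.
Proof.
move=> z1_gt0 z2_gt0 z_prod le_lam; have t0 := t_gt0.
have := root_sqr_ge R k t t_root; have := root_sqr_lt R k t t_root => s_lt s_ge.
case: P z_prod le_lam => // P z_prod.
have U_ge := sX_ge P.+1 isT.
have U1 : 1 <= s ^+ P.+2 by have := sX_ge P.+2 isT; lra.
rewrite -addrA -(ler_pM2l t0) [t * (_ + _)]mulrDr mul_t_lam mul_t_arm => le_lam.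
have := slope_sum_ge z1 z2 _ z1_gt0 z2_gt0 U1 z_prod.
move: le_lam; rewrite [s ^+ P.+2]exprS; move: (t * _) => T.
(* An arm of length 1 is treated by itself: [3 - s^2] may still be positive, whereas for longer arms
   the power of [s] exceeds 3 and the upper bound is negative. *)
have U_cases : s ^+ P.+1 = s \/ s * s <= s ^+ P.+1.
  case: (P) => [|Q]; [by left; rewrite expr1 | right].
  by rewrite [X in _ <= X]exprS ler_wpM2l ?sX_ge //; lra.
move: (s) (s ^+ P.+1) s_lt s_ge U_ge U_cases => a b a_lt a_ge b_ge b_cases H1 H2.
have ab1 : 0 < a * b - 1 by nra.
have ab2 : 0 < 1 + a * b by nra.
have : (2 - a) * ((a * b - 1) * (1 + a * b)) <= (a - 1) * (3 - a * b).
  have -> : (a - 1) * (3 - a * b) =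
      ((a - 1) / (a * b - 1) - 2 * (a - 1) / (1 + a * b)) * ((a * b - 1) * (1 + a * b)).
    by field; rewrite !gt_eqF.
  by rewrite ler_wpM2r ?mulr_ge0 //; lra.
move=> H; exfalso; move: b_cases ab1 ab2 H; clear -a_lt a_ge; case=> [->|b_ge] ab1 ab2 H.
  have : (2 - a) * ((a * a - 1) * (1 + a * a)) = (a - 1) * ((2 - a) * ((a + 1) * (1 + a * a))) by ring.
  move=> E; rewrite E ler_pM2l in H; last by lra.
  have : 0 <= (2 - a) * (a + 1) * (a * a) by rewrite !mulr_ge0 //; lra.
  lra.
have : 3 < a * b by nra.
nra.
Qed.

Lemma slope_sum_long Q z1 z2 : (k <= Q.+1)%N -> 0 < z1 -> 0 < z2 ->
  z1 * z2 <= s ^+ k.+1 ^+ 2 -> lam < arm lam Q + slope z1 + slope z2.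
Proof.
move=> Q_ge z1_gt0 z2_gt0 z_prod; have t0 := t_gt0.
have := root_sqr_ge R k t t_root; have := root_sqr_lt R k t t_root => s_lt s_ge.
have := root_eq R k t t_root => U_root.
have U1 : 1 <= s ^+ k.+1 by have := sX_ge k.+1 isT; lra.
have arm_le : arm lam k.-1 <= arm lam Q.
  by apply: arm_mono; [apply: lam_ge2 t_root | lia].
suff : t * lam < t * arm lam Q + t * (slope z1 + slope z2).
  by rewrite -mulrDr addrA ltr_pM2l.
have := slope_sum_ge z1 z2 _ z1_gt0 z2_gt0 U1 z_prod.
have := ler_wpM2l (ltW t0) arm_le.
rewrite (mul_t_arm k.-1) mul_t_lam.
rewrite (prednK (ltn_trans _ k_ge3)) //.
move: (t * arm lam Q) (t * (slope z1 + slope z2)) => T T'.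
move: U_root; rewrite [s ^+ k.+1]exprS.
have := sX_ge k; rewrite (ltn_trans _ k_ge3) // => /(_ isT).
move: (s) (s ^+ k) s_lt s_ge => a b a_lt a_ge b_ge U_root H1 H2.
have b1 : 0 < b - 1 by lra.
have ab2 : 0 < 1 + a * b by nra.
suff : (a - 1) / (b - 1) - 2 * (a - 1) / (1 + a * b) < 2 - a by lra.
have -> : (a - 1) / (b - 1) - 2 * (a - 1) / (1 + a * b) =
   (a - 1) * (3 - (2 - a) * b) / ((b - 1) * (1 + a * b)).
  by field; rewrite !gt_eqF.
rewrite ltr_pdivrMr ?mulr_gt0 //.
(* Otherwise the equation for [t] would give [2 * s - 1 <= 4 * s * (2 - s)], which fails from 17/10
   on. *)
have b_large : 4 < b.
  rewrite ltNge; apply/negP => b_le.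
  have : 0 <= (4 - b) * (a * (2 - a)) by rewrite !mulr_ge0 //; lra.
  by have := sqr_ge0 (a - 17 / 10); lra.
have -> : (2 - a) * ((b - 1) * (1 + a * b)) = (2 - a) * (b - 1) + (b - 1) * (a * b * (2 - a)).
  by ring.
have : 0 <= (a - 1) * ((2 - a) * b) by rewrite !mulr_ge0 //; lra.
have : 0 <= (2 - a) * (b - 1) by rewrite mulr_ge0 //; lra.
have : 0 <= (b - 4) * (2 * a - 1) by rewrite mulr_ge0 //; lra.
by rewrite U_root; lra.
Qed.

End HyperbolicEstimates.

(** * The profiles for k = 1 and k = 2 *)

(** Affine in [n], with slopes 1, 0 and -1 for [mu = 0, 1, 2]. The quipus for [k = 2] are the
    extended Dynkin trees of types E6 and D6. *)
Definition flat_profile (R : realType) (mu n : nat) : R :=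
  (n%:R - 1) * (1 - mu%:R) + mu%:R ^+ 2 + 1.

Lemma flat_profile_spec (R : realType) : profile R 2 2 (flat_profile R).
Proof.
rewrite /flat_profile; split.
- ring.
- by move=> mu n _ _; rewrite -[n.+2]addn2 -[n.+1]addn1 !natrD; ring.
- move=> mu n mu_le /andP[n_gt0 n_le].
  have n_ge1 : 1 <= n%:R :> R by rewrite ler1n.
  have n_le5 : n%:R <= 5 :> R by rewrite ler_nat.
  by case: mu mu_le => [|[|[|]]] // _; lra.
- move=> mu n mu_le n_le; rewrite natrB //.
  by case: mu mu_le => [|[|[|]]] // _; rewrite ?subn0 ?subSS ?subn0; ring.
- by case=> [|[|[|]]] // _; ring.
- by case=> [|[|[|]]] // _; ring.
Qed.

Lemma arm2E (R : realType) m : arm (2 : R) m = m%:R / m.+1%:R.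
Proof.
elim: m => [|m IHm] /=; first by rewrite mul0r.
rewrite IHm -!natr1; have m0 : 0 <= m%:R :> R by rewrite ler0n.
have p1 : 0 < m%:R + 1 :> R by lra.
have p2 : 0 < m%:R + 1 + 1 :> R by lra.
by field; rewrite ?gt_eqF //; lra.
Qed.

Lemma fork2E (R : realType) h : fork (2 : R) h = 1.
Proof.
elim: h => [|h IHh] /=; first by rewrite divff // pnatr_eq0.
by rewrite IHh [2 - 1]addrK invr1.
Qed.

Lemma flat_fork_excess (R : realType) : fork_excess R 2.
Proof.
move=> h m _ lt_hm; rewrite fork2E.
have : arm (2 : R) 1 <= arm 2 m by apply: arm_mono => //; lia.
by rewrite (arm2E R 1); lra.
Qed.

Lemma flat_arm_k (R : realType) : arm (2 : R) 2 = 2 / 3.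
Proof. by rewrite arm2E. Qed.

Lemma flat_merging (R : realType) : merging R 2 2 (flat_profile R).
Proof.
rewrite /flat_profile => mu m a m_gt0 le_k le_a a_le; rewrite arm2E.
case: mu le_k le_a a_le => [|[|mu]] le_k le_a a_le; last by lia.
  case: m m_gt0 le_k le_a => [|[|[|m]]] // _ le_k le_a.
    case: a le_a a_le => [|[|[|a]]] // _ _; first by split; [lra | split; [|left]].
    by split => [|E]; [lra | exfalso; lra].
  case: a le_a a_le => [|[|[|a]]] // _ _.
  by split; [lra | split; [|left]].
case: m m_gt0 le_k le_a => [|[|m]] // _ le_k le_a.
case: a le_a a_le => [|[|[|[|a]]]] // _ _; last by split; [lra | split; [|right]].
by split => [|E]; [lra | exfalso; lra].
Qed.

(** The values [2 * sin (n * pi / 6)], read backwards for [mu = 1]; here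
    [lam = 2 * cos (pi / 6)]. *)
Definition claw_profile (R : realType) (mu n : nat) : R :=
  let c := Num.sqrt 3 in
  if mu is 0%N then nth 0 [:: 0; 1; c; 2; c] n else nth 0 [:: c; 2; c; 1; 0] n.

Lemma claw_profile_spec (R : realType) : profile R 1 (Num.sqrt 3) (claw_profile R).
Proof.
have c_sqr : Num.sqrt 3 * Num.sqrt 3 = 3 :> R by rewrite -expr2 sqr_sqrtr.
have c_gt0 : 0 < Num.sqrt 3 :> R by rewrite sqrtr_gt0.
rewrite /claw_profile; split => //.
- by case=> [|[|]] // [|[|[|]]] //= _ _; lra.
- by case=> [|[|]] // [|[|[|[|]]]] //= _ _; lra.
- by case=> [|[|]] // [|[|[|[|[|]]]]].
- by case=> [|[|]].
- by case=> [|[|]] //= _; lra.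
Qed.

(** * Supersolutions along walks and geodesics *)

Definition supersolution (R : realType) (T : finType) (e : rel T) (lam : R) (x : T -> R) :=
  (forall u, 0 < x u) /\ (forall u, \sum_(w | e u w) x w <= lam * x u).

(** A walk that never turns straight back. It may revisit vertices: the estimates only need two
    distinct neighbours at each inner vertex. *)
Definition chain (T : eqType) (e : rel T) (u : nat -> T) (h : nat) :=
  (forall i, (i < h)%N -> e (u i) (u i.+1)) /\
  (forall i, (i.+1 < h)%N -> u i != u i.+2).

Lemma chain_shift (T : eqType) (e : rel T) u h :
  chain T e u h.+1 -> chain T e (fun i => u i.+1) h.
Proof. by case=> u_edge u_nb; split=> i lt_i; [apply: u_edge | apply: u_nb]. Qed.

Section Supersolutions.
Variables (R : realType) (T : finType) (e : rel T) (lam : R) (x : T -> R).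
Hypothesis e_sym : symmetric e.
Hypothesis x_super : supersolution R T e lam x.
Hypothesis lam_ge2 : 2 <= lam.

Lemma super_gt0 u : 0 < x u.
Proof. by case: x_super. Qed.

Lemma nbr_sum_le (s : seq T) u : uniq s -> all (e u) s -> \sum_(w <- s) x w <= lam * x u.
Proof.
move=> s_uniq /allP s_nbr; case: x_super => _ /(_ u); apply: le_trans.
rewrite big_uniq //= big_mkcond [leRHS]big_mkcond; apply: ler_sum => w _ /=.
case: ifP => [/s_nbr -> //|_]; case: ifP => // _; exact/ltW/super_gt0.
Qed.

Lemma nbr1_le u a : e u a -> x a <= lam * x u.
Proof.
move=> ua; have := nbr_sum_le [:: a] u; rewrite /= ua big_seq1; exact.
Qed.

Lemma nbr2_le u a b : e u a -> e u b -> a != b -> x a + x b <= lam * x u.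
Proof.
move=> ua ub ab; have := nbr_sum_le [:: a; b] u.
by rewrite /= ua ub inE ab !big_cons big_nil addr0; apply.
Qed.

Lemma nbr3_le u a b c : e u a -> e u b -> e u c -> uniq [:: a; b; c] ->
  x a + x b + x c <= lam * x u.
Proof.
move=> ua ub uc abc; have := nbr_sum_le [:: a; b; c] u abc.
by rewrite /= ua ub uc !big_cons big_nil addr0 addrA; apply.
Qed.

Lemma nbr_ge u a : e u a -> x u / lam <= x a.
Proof.
move=> ua; rewrite ler_pdivrMr; last by have := lam_ge2; lra.
by rewrite mulrC nbr1_le // e_sym.
Qed.

Lemma arm_le m u : chain T e u m -> arm lam m * x (u 0%N) <= x (u 1%N).
Proof.
have l2 := lam_ge2; elim: m u => [|m IHm] u u_chain /=; first by rewrite mul0r ltW // super_gt0.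
have := IHm _ (chain_shift _ _ _ _ u_chain); have /andP[_ a_le1] := arm_bounds R lam m l2.
case: u_chain => u_edge u_nb IH.
rewrite ler_pdivrMl; last by lra.
have e01 : e (u 1%N) (u 0%N) by rewrite e_sym u_edge.
case: m IH a_le1 u_edge u_nb {IHm} => [|m] IH a_le1 u_edge u_nb.
  by have := nbr1_le _ _ e01; rewrite /= subr0.
have := nbr2_le _ _ _ e01 (u_edge 1%N isT) (u_nb 0%N isT).
by rewrite mulrBl; lra.
Qed.

(** Both [y] and [z] carry at least [1 / lam] of the value at their neighbour [u h.+1], so two
    leaves are the lightest possible branching. *)
Lemma fork_le h u y z : chain T e u h.+1 -> e (u h.+1) y -> e (u h.+1) z ->
  uniq [:: u h; y; z] -> fork lam h.+1 * x (u 0%N) <= x (u 1%N).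
Proof.
have l2 := lam_ge2; elim: h u => [|h IHh] u u_chain uy uz yz.
  have e01 : e (u 1%N) (u 0%N) by rewrite e_sym; apply: u_chain.1.
  rewrite /= ler_pdivrMl; last first.
    by have := fork_bounds R lam 0 l2; rewrite /=; lra.
  have := nbr3_le _ _ _ _ e01 uy uz yz; have := nbr_ge _ _ uy; have := nbr_ge _ _ uz.
  by rewrite mulrBl; lra.
have := IHh _ (chain_shift _ _ _ _ u_chain) uy uz yz.
have /andP[_ f_le1] := fork_bounds R lam h.+1 l2.
case: u_chain => u_edge u_nb IH.
have e01 : e (u 1%N) (u 0%N) by rewrite e_sym u_edge.
rewrite [fork lam h.+2]/= ler_pdivrMl; last by rewrite /= in f_le1; lra.
have := nbr2_le _ _ _ e01 (u_edge 1%N isT) (u_nb 0%N isT).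
by rewrite /= in IH *; rewrite mulrBl; lra.
Qed.

(** A discrete Riccati comparison: if the ratio of consecutive values starts at most that of an
    exact solution [y], it stays so. *)
Lemma chain_ratio d u (y : nat -> R) : chain T e u d ->
  (forall i, 0 <= y i) -> (forall i, y i + y i.+2 = lam * y i.+1) ->
  x (u 1%N) * y 0%N <= x (u 0%N) * y 1%N ->
  forall i, (i < d)%N -> x (u i.+1) * y i <= x (u i) * y i.+1.
Proof.
case=> u_edge u_nb y_ge0 y_rec base; elim=> [//|i IHi] lt_id.
have := IHi (ltnW lt_id).
have := nbr2_le _ _ _ _ (u_edge _ lt_id) (u_nb _ lt_id).
rewrite e_sym u_edge; last exact: ltnW.
move=> /(_ isT) /(ler_wpM2r (y_ge0 i.+1)).
have -> : y i.+2 = lam * y i.+1 - y i by rewrite -y_rec addrC addKr.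
by lra.
Qed.

End Supersolutions.

(** The subtraction [j - i] is truncated, so only pairs with [i < j] are constrained. *)
Definition geodesic (T : eqType) (e : rel T) (v : nat -> T) (L : nat) :=
  (forall i, (i < L)%N -> e (v i) (v i.+1)) /\
  (forall i j p, (i <= L)%N -> (j <= L)%N -> path e (v i) p -> last (v i) p = v j ->
     (j - i <= size p)%N).

Lemma rev_walk (T : eqType) (e : rel T) (a : T) p : symmetric e -> path e a p ->
  exists q, [/\ path e (last a p) q, last (last a p) q = a & size q = size p].
Proof.
move=> e_sym a_path; exists (rev (belast a p)).
rewrite rev_path size_rev size_belast; split=> //.
  by rewrite (eq_path (e' := e)).
by case: p {a_path} => //= b p; rewrite rev_cons last_rcons.
Qed.

Lemma walk_path (T : eqType) (e : rel T) (v : nat -> T) i n :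
  (forall j, (i <= j < i + n)%N -> e (v j) (v j.+1)) ->
  path e (v i) [seq v j | j <- iota i.+1 n] /\
  last (v i) [seq v j | j <- iota i.+1 n] = v (i + n)%N.
Proof.
elim: n i => [|n IHn] i v_edge; first by rewrite addn0.
have [|IH1 IH2] := IHn i.+1.
  by move=> j /andP[ij jn]; apply: v_edge; lia.
by rewrite /= v_edge ?IH1 ?IH2 ?addSnnS //; lia.
Qed.

Section Geodesics.
Variables (T : finType) (e : rel T) (L : nat).
Hypothesis e_sym : symmetric e.
Implicit Type v : nat -> T.

Lemma geodesic_rev v : geodesic T e v L -> geodesic T e (fun i => v (L - i)%N) L.
Proof.
case=> v_edge v_min; split=> [i lt_iL|i j p i_le j_le p_path p_last].
  by rewrite e_sym -(subnSK lt_iL); apply: v_edge; lia.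
have [q [q_path q_last q_size]] := rev_walk _ _ _ _ e_sym p_path.
rewrite p_last in q_path q_last.
have := v_min (L - j)%N (L - i)%N q (leq_subr _ _) (leq_subr _ _) q_path q_last.
by rewrite q_size; lia.
Qed.

Lemma geodesic_exists : has_diameter e L -> exists v, geodesic T e v L.
Proof.
case=> le_diam [a [b ab_far]].
have [p [p_path p_last p_size]] := le_diam a b.
have pL : size p = L by apply/eqP; rewrite eqn_leq p_size ab_far.
exists (nth a (a :: p)).
have v_edge i : (i < L)%N -> e (nth a (a :: p) i) (nth a (a :: p) i.+1).
  by move=> lt_iL; move/(pathP a): p_path => p_edge; apply: p_edge; rewrite pL.
split=> // i j q i_le j_le q_path q_last.
have [|h1 h2] := walk_path _ e (nth a (a :: p)) 0 i; first by move=> l lt_l; apply: v_edge; lia.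
have [|h3 h4] := walk_path _ e (nth a (a :: p)) j (L - j).
  by move=> l lt_l; apply: v_edge; lia.
have vL : nth a (a :: p) L = b by rewrite -pL -[size p]/((size (a :: p)).-1) nth_last.
rewrite add0n in h2; rewrite subnKC // vL in h4.
(* A walk between two vertices of the diametral path is spliced into that path; were it too short,
   it would bring the two ends closer together. *)
have := ab_far ([seq nth a (a :: p) l | l <- iota 1 i] ++ q ++
          [seq nth a (a :: p) l | l <- iota j.+1 (L - j)]).
rewrite !cat_path !last_cat.
rewrite [path e a _]h1 [last a _]h2 q_path q_last h3 h4.
rewrite !size_cat !size_map !size_iota => /(_ isT erefl); move: (size q) => n; clear - j_le; lia.
Qed.

Section OnPath.
Variable v : nat -> T.
Hypothesis v_geo : geodesic T e v L.

Definition on_path : pred T := fun u => u \in [seq v i | i <- iota 0 L.+1].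

Lemma on_pathP u : reflect (exists2 i, (i <= L)%N & u = v i) (on_path u).
Proof.
apply: (iffP mapP) => [[i]|[i i_le ->]].
  by rewrite mem_iota => i_le ->; exists i.
by exists i => //; rewrite mem_iota.
Qed.

Lemma on_path_v i : (i <= L)%N -> on_path (v i).
Proof. by move=> i_le; apply/on_pathP; exists i. Qed.

Lemma geodesic_inj i j : (i <= L)%N -> (j <= L)%N -> v i = v j -> i = j.
Proof.
move=> i_le j_le vij; have := v_geo.2 i j [::] i_le j_le isT vij.
by have := v_geo.2 j i [::] j_le i_le isT (esym vij); rewrite /=; lia.
Qed.

Lemma geodesic_eq i j : (i <= L)%N -> (j <= L)%N -> (v i == v j) = (i == j).
Proof. by move=> i_le j_le; apply/eqP/eqP => [/geodesic_inj -> //|->]. Qed.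

Lemma card_off_path : #|[pred u | ~~ on_path u]| = (#|T| - L.+1)%N.
Proof.
have on_card : #|[pred u | on_path u]| = L.+1.
  have /card_uniqP : uniq [seq v i | i <- iota 0 L.+1].
    rewrite map_inj_in_uniq ?iota_uniq // => i j; rewrite !mem_iota /= !add0n !ltnS.
    exact: geodesic_inj.
  by rewrite size_map size_iota => <-; apply: eq_card.
by rewrite -(cardC [pred u | on_path u]) on_card addKn; apply: eq_card.
Qed.

Definition off_edge : rel T := [rel a b | [&& e a b, ~~ on_path a & ~~ on_path b]].

Lemma off_edge_sym : symmetric off_edge.
Proof. by move=> a b; rewrite /off_edge /= e_sym [_ && ~~ on_path b]andbC. Qed.

Lemma first_hit w p : ~~ on_path w -> path e w p -> on_path (last w p) ->
  exists p1 b p2, [/\ p = p1 ++ v b :: p2, (b <= L)%N, path off_edge w p1 &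
     e (last w p1) (v b)].
Proof.
elim: p w => [|c p IHp] w /=; first by move=> /negbTE ->.
move=> w_off /andP[wc c_path] hit; have [/on_pathP[b b_le cE]|c_off] := boolP (on_path c).
  by exists [::], b, p; rewrite -cE.
have [p1 [b [p2 [-> b_le p1_path p1_edge]]]] := IHp c c_off c_path hit.
by exists (c :: p1), b, p2; split; rewrite //= p1_path /off_edge /= wc w_off c_off.
Qed.

Lemma chain_right a m : (a + m <= L)%N -> chain T e (fun i => v (a + i)%N) m.
Proof.
move=> am_le; split=> i lt_im; first by rewrite addnS; apply: v_geo.1; lia.
by rewrite geodesic_eq; lia.
Qed.

Lemma chain_left a m : (m <= a)%N -> (a <= L)%N -> chain T e (fun i => v (a - i)%N) m.
Proof.
move=> ma_le a_le; split=> i lt_im.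
  by rewrite e_sym -(subnSK (leq_trans lt_im ma_le)); apply: v_geo.1; lia.
by rewrite geodesic_eq; lia.
Qed.

End OnPath.

Lemma on_path_rev v u : on_path (fun i => v (L - i)%N) u = on_path v u.
Proof.
apply/on_pathP/on_pathP => -[i i_le ->]; first by exists (L - i)%N => //; lia.
by exists (L - i)%N; [lia | rewrite subKn].
Qed.

End Geodesics.

(** * Components off a geodesic attach only once *)

Definition single_attach (T : finType) (e : rel T) (L : nat) (v : nat -> T) :=
  forall w w' a b, ~~ on_path T L v w -> ~~ on_path T L v w' ->
    connect (off_edge T e L v) w w' -> (a <= L)%N -> (b <= L)%N ->
    e (v a) w -> e (v b) w' -> a = b.

Lemma chain_rev (T : eqType) (e : rel T) u d : symmetric e ->
  chain T e u d -> chain T e (fun i => u (d - i)%N) d.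
Proof.
move=> e_sym [u_edge u_nb]; split=> i lt_id.
  by rewrite e_sym -(subnSK lt_id); apply: u_edge; lia.
rewrite eq_sym -(subnSK (ltnW lt_id)) -(subnSK lt_id); apply: u_nb; lia.
Qed.

Lemma chain_of_path (T : eqType) (e : rel T) (a : T) s :
  path e a s -> uniq (a :: s) -> chain T e (nth a (a :: s)) (size s).
Proof.
move=> /(pathP a) s_edge s_uniq; split=> i lt_i; first exact: s_edge.
by rewrite nth_uniq //=; lia.
Qed.

Section Loop.
Variables (R : realType) (T : finType) (e : rel T) (lam : R) (x : T -> R) (k : nat).
Hypothesis e_sym : symmetric e.
Hypothesis x_super : supersolution R T e lam x.
Hypothesis lam_ge2 : 2 <= lam.
Hypothesis T_card : #|T| = (3 * k).+1.

(* The second connection from [v a] to [v b], through the complement of the geodesic. *)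
Lemma detour v w w' a b : geodesic T e v (2 * k) ->
  ~~ on_path T (2 * k) v w -> ~~ on_path T (2 * k) v w' ->
  connect (off_edge T e (2 * k) v) w w' -> (a < b)%N -> (b <= 2 * k)%N ->
  e (v a) w -> e (v b) w' ->
  exists (u : nat -> T) (d : nat),
   [/\ chain T e u d, u 0%N = v a, u d = v b & (b - a <= d <= k.+1)%N] /\
   arm lam a * x (v a) + x (v a.+1) + x (u 1%N) <= lam * x (v a) /\
   arm lam (2 * k - b) * x (v b) + x (v b.-1) + x (u d.-1) <= lam * x (v b).
Proof.
move=> v_geo w_off w'_off /connectP[p0 p0_path w'E] lt_ab b_le va_w vb_w'.
have l2 := lam_ge2; have a_le : (a <= 2 * k)%N by lia.
move: w'E; case/shortenP: p0_path => p p_path p_uniq _ w'E.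
have off_p : all [pred c | ~~ on_path T (2 * k) v c] (w :: p).
  rewrite /= w_off /=; elim: p (w) p_path {w'E p_uniq} => //= c p IHp c0.
  by case/andP=> /and3P[_ _ c_off] /IHp ->; rewrite c_off.
have e_path : path e w p by apply: sub_path p_path => c c' /andP[].
have not_on c : (c <= 2 * k)%N -> v c \notin w :: p.
  move=> c_le; apply/negP => /(allP off_p) /=.
  by rewrite (on_path_v _ _ v).
pose s := w :: rcons p (v b).
have s_path : path e (v a) s.
  by rewrite /s /= va_w rcons_path e_path -w'E e_sym.
have s_uniq : uniq (v a :: s).
  rewrite /s -rcons_cons cons_uniq rcons_uniq not_on // p_uniq andbT.
  by rewrite mem_rcons inE negb_or not_on // (geodesic_eq T e _ v v_geo) // neq_ltn lt_ab.
have s_size : size s = (size p).+2 by rewrite /s /= size_rcons.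
(* The detour runs through distinct vertices off the geodesic, and there are only [k] of them; hence
   [d <= k + 1]. *)
have p_size : ((size p).+1 <= k)%N.
  have /card_uniqP := p_uniq; rewrite /= => <-.
  apply: leq_trans (_ : (#|[pred c | ~~ on_path T (2 * k) v c]| <= _)%N).
    by apply: subset_leq_card; apply/fintype.subsetP => c /(allP off_p).
  by rewrite (card_off_path T e _ v v_geo) // T_card; lia.
exists (nth (v a) (v a :: s)), (size s); split.
  split => //; first exact: chain_of_path.
    by rewrite /s s_size /= nth_rcons ltnn eqxx.
  rewrite s_size !ltnS p_size andbT.
  have := v_geo.2 a b s a_le b_le s_path; rewrite /s /= last_rcons size_rcons.
  exact.
have nthw : nth (v a) (v a :: s) 1 = w by [].
have nthw' : nth (v a) (v a :: s) (size s).-1 = w'.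
  rewrite s_size w'E -[LHS]/(nth (v a) s (size p)) /s -rcons_cons nth_rcons ltnSn.
  by rewrite -[size p]/((size (w :: p)).-1) nth_last.
rewrite nthw nthw' {nthw nthw' s_size s_uniq s_path s p_size not_on e_path off_p p_uniq w'E p_path}.
have neq_off c d : (c <= 2 * k)%N -> ~~ on_path T (2 * k) v d -> v c != d.
  by move=> c_le; apply: contraNneq => <-; apply: on_path_v.
have va_r : e (v a) (v a.+1) by apply: v_geo.1; lia.
have vb_l : e (v b) (v b.-1).
  by rewrite e_sym; have := v_geo.1 b.-1; rewrite prednK; [apply; lia | lia].
split.
  have [a0|a_gt0] := posnP a.
    by rewrite {1}a0 mul0r add0r (nbr2_le _ _ _ _ _ x_super) // neq_off //; lia.
  have va_l : e (v a) (v a.-1).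
    by rewrite e_sym; have := v_geo.1 a.-1; rewrite prednK //; apply; lia.
  have := arm_le R T e lam x e_sym x_super l2 a _ (chain_left T e _ e_sym v v_geo a a (leqnn a) a_le).
  rewrite subn0 subn1.
  have := nbr3_le _ _ _ _ _ x_super _ _ _ _ va_l va_r va_w.
  rewrite /= !inE !negb_or (geodesic_eq T e _ v v_geo) // ?neq_off //; try lia.
  rewrite (_ : (a.-1 != a.+1) = true) /=; [|lia].
  by move=> /(_ isT); lra.
have [b_eq|b_lt] := leqP (2 * k)%N b.
  rewrite (_ : (2 * k - b)%N = 0%N) /=; [|lia].
  by rewrite mul0r add0r (nbr2_le _ _ _ _ _ x_super) // neq_off //; lia.
have vb_r : e (v b) (v b.+1) by apply: v_geo.1.
have bk : (b + (2 * k - b) <= 2 * k)%N by lia.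
have := arm_le R T e lam x e_sym x_super l2 _ _ (chain_right T e _ v v_geo b (2 * k - b) bk).
rewrite addn0 addn1.
have := nbr3_le _ _ _ _ _ x_super _ _ _ _ vb_l vb_r vb_w'.
rewrite /= !inE !negb_or (geodesic_eq T e _ v v_geo) // ?neq_off //; try lia.
rewrite (_ : (b.-1 != b.+1) = true) /=; [|lia].
by move=> /(_ isT); lra.
Qed.

End Loop.

(** * Loops for [k = 2] *)

Lemma flat_decay (R : realType) (T : finType) (e : rel T) (x : T -> R) u d :
  symmetric e -> supersolution R T e 2 x -> chain T e u d ->
  x (u 1%N) < x (u 0%N) ->
  forall i, (i < d)%N -> x (u i.+1) < x (u i) /\ x (u i.+1) < x (u 0%N).
Proof.
move=> e_sym x_super [u_edge u_nb] base; elim=> [//|i IHi] lt_id.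
have [|IH1 IH2] := IHi; first exact: ltnW.
have := nbr2_le _ _ _ _ _ x_super _ _ _ _ (u_edge _ lt_id) (u_nb _ lt_id).
by rewrite e_sym u_edge ?(ltnW lt_id) // => /(_ isT); lra.
Qed.

(** For [lam = 2] values are concave along a walk. If [u] starts downwards, it arrives at [u d]
    still falling, so [u'] read backwards from there must fall as well, all the way to the common
    start. Going round would strictly decrease [x]. *)
Lemma flat_loop (R : realType) (T : finType) (e : rel T) (x : T -> R) u u' d d' P Q :
  symmetric e -> supersolution R T e 2 x -> chain T e u d -> chain T e u' d' ->
  (0 < d)%N -> (0 < d')%N -> u 0%N = u' 0%N -> u d = u' d' ->
  arm 2 P * x (u 0%N) + x (u 1%N) + x (u' 1%N) <= 2 * x (u 0%N) ->
  arm 2 Q * x (u d) + x (u d.-1) + x (u' d'.-1) <= 2 * x (u d) ->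
  x (u 0%N) <= x (u 1%N).
Proof.
move=> e_sym x_super u_chain u'_chain d_gt0 d'_gt0 u0E udE at_0 at_d.
rewrite leNgt; apply/negP => base.
have decay := flat_decay R T e x _ _ e_sym x_super u_chain base.
have [] := decay d.-1; rewrite prednK // => dec1 dec2.
have Q_ge0 : 0 <= arm 2 Q * x (u d).
  apply: mulr_ge0; last exact/ltW/(super_gt0 _ _ _ _ _ x_super).
  by case/andP: (arm_bounds R 2 Q (lexx _)).
have base' : x (u' (d' - 1)%N) < x (u' (d' - 0)%N).
  by rewrite subn0 subn1 -udE; lra.
have [] := flat_decay R T e x _ _ e_sym x_super (chain_rev _ _ _ _ e_sym u'_chain) base' d'.-1.
  by rewrite prednK.
by rewrite prednK // subnn subn0 -udE -u0E; lra.
Qed.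

Lemma flat_single_attach (R : realType) (T : finType) (e : rel T) (x : T -> R) v :
  symmetric e -> supersolution R T e 2 x -> #|T| = 7 -> geodesic T e v (2 * 2) ->
  single_attach T e (2 * 2) v.
Proof.
move=> e_sym x_super T_card v_geo w w' a b w_off w'_off ww' a_le b_le aw bw'.
wlog lt_ab : w w' a b w_off w'_off ww' a_le b_le aw bw' / (a < b)%N.
  move=> IH; case: (ltngtP a b) => // [lt_ab|lt_ba]; first exact: (IH w w').
  apply/esym/(IH w' w) => //.
  by rewrite (sym_connect_sym (off_edge_sym T e _ e_sym v)).
have [u' [d' [[u'_chain u'0 u'd' /andP[dd' d'_le]] [at_a at_b]]]] :=
  detour R T e 2 x 2 e_sym x_super (lexx _) T_card v w w' a b v_geo w_off w'_off ww' lt_ab b_le aw bw'.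
have abL : (a + (b - a) <= 2 * 2)%N by lia.
have u_chain := chain_right T e _ v v_geo a (b - a) abL.
have bE : (a + (b - a))%N = b by lia.
have b1E : (a + (b - a).-1)%N = b.-1 by lia.
have d_gt0 : (0 < b - a)%N by lia.
have d'_gt0 : (0 < d')%N by lia.
have u0E : v (a + 0)%N = u' 0%N by rewrite addn0.
have udE : v (a + (b - a))%N = u' d' by rewrite bE.
have gt0 := super_gt0 _ _ _ _ _ x_super.
have arm_pos n : (0 < n)%N -> 0 < arm (2 : R) n.
  by move=> n_gt0; rewrite arm2E divr_gt0 // ltr0n.
(* Neither walk falls at [v a], so nothing is left for the arm of the geodesic beyond it. The same
   at [v b] leaves only the two ends of the geodesic, at distance 4, while the detour has length at
   most 3. *)
have a0 : a = 0%N.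
  have H1 := flat_loop R T e x _ _ _ _ a (2 * 2 - b) e_sym x_super u_chain u'_chain d_gt0 d'_gt0 u0E udE.
  rewrite addn0 addn1 bE b1E in H1; have {}H1 := H1 at_a at_b.
  have H2 := flat_loop R T e x _ _ _ _ a (2 * 2 - b) e_sym x_super u'_chain u_chain d'_gt0 d_gt0 (esym u0E) (esym udE).
  rewrite addn1 u'0 u'd' b1E in H2; have {}H2 : x (v a) <= x (u' 1%N) by apply: H2; lra.
  apply/eqP; rewrite -leqn0 leqNgt; apply/negP => a_gt0.
  by have := mulr_gt0 (arm_pos a a_gt0) (gt0 (v a)); lra.
have b0 : (2 * 2 - b)%N = 0%N.
  have r_chain := chain_rev _ _ _ _ e_sym u_chain.
  have r'_chain := chain_rev _ _ _ _ e_sym u'_chain.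
  have H1 := flat_loop R T e x _ _ _ _ (2 * 2 - b) a e_sym x_super r_chain r'_chain d_gt0 d'_gt0.
  have H2 := flat_loop R T e x _ _ _ _ (2 * 2 - b) a e_sym x_super r'_chain r_chain d'_gt0 d_gt0.
  rewrite !subn0 !subn1 !subnn !addn0 u'0 u'd' bE b1E in H1 H2.
  rewrite (_ : b - a - (b - a).-1 = 1)%N in H1 H2; last by clear - lt_ab; lia.
  rewrite (_ : d' - d'.-1 = 1)%N in H1 H2; last by clear - d'_gt0; lia.
  rewrite addn1 in H1 H2.
  have {}H1 : x (v b) <= x (v b.-1) by apply: H1 => //; lra.
  have {}H2 : x (v b) <= x (u' d'.-1) by apply: H2 => //; lra.
  apply/eqP; rewrite -leqn0 leqNgt; apply/negP => b_gt0.
  by have := mulr_gt0 (arm_pos _ b_gt0) (gt0 (v b)); lra.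
by clear - a0 b0 dd' d'_le lt_ab; lia.
Qed.

(** * Loops for [k] at least 3 *)

Section HyperbolicLoop.
Variables (R : realType) (k : nat) (t : R).
Hypothesis t_root : hyperbolic_root R k t.
Hypothesis k_ge3 : (3 <= k)%N.
Local Notation lam := (ch t).
Local Notation s := (t ^+ 2).
Variables (T : finType) (e : rel T) (x : T -> R).
Hypothesis e_sym : symmetric e.
Hypothesis x_super : supersolution R T e lam x.
Let t_gt0 : 0 < t := root_t_gt0 R k t t_root.
Let t_gt1 : 1 < t := root_t_gt1 R k t t_root.
Let x_gt0 : forall u, 0 < x u := super_gt0 R T e lam x x_super.

Lemma hyp_decay u d : chain T e u d -> t * x (u 1%N) <= x (u 0%N) ->
  forall i, (i < d)%N -> t * x (u i.+1) <= x (u i) /\ x (u i.+1) < x (u 0%N).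
Proof.
move=> [u_edge u_nb] base; have t0 := t_gt0; have t1 := t_gt1.
have step i : t * x (u i.+1) <= x (u i) -> x (u i.+1) < x (u i).
  move=> le_i; apply: lt_le_trans le_i; rewrite -[ltLHS]mul1r.
  by rewrite ltr_pM2r // x_gt0.
elim=> [|i IHi] lt_id; first by split => //; apply: step.
have [|IH1 IH2] := IHi; first exact: ltnW.
have := nbr2_le _ _ _ _ _ x_super _ _ _ _ (u_edge _ lt_id) (u_nb _ lt_id).
rewrite e_sym u_edge ?(ltnW lt_id) // => /(_ isT) /(ler_wpM2l (ltW t0)).
rewrite mulrA (mul_t_lam R k t t_root).
have sE : s * x (u i.+1) = t * (t * x (u i.+1)) by rewrite expr2 mulrA.
rewrite mulrDr mulrDl mul1r sE => H.
have le1 : t * x (u i.+2) <= x (u i.+1).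
  by have := ler_wpM2l (ltW t0) IH1; lra.
by split => //; apply: lt_trans (step _ le1) IH2.
Qed.

(** The argument of [flat_loop], with decay by the factor [t] per step in place of mere decrease;
    such decay persists because [lam = t + 1 / t]. *)
Lemma hyp_loop_fast u u' d d' P Q : chain T e u d -> chain T e u' d' ->
  (0 < d)%N -> (0 < d')%N -> u 0%N = u' 0%N -> u d = u' d' ->
  arm lam P * x (u 0%N) + x (u 1%N) + x (u' 1%N) <= lam * x (u 0%N) ->
  arm lam Q * x (u d) + x (u d.-1) + x (u' d'.-1) <= lam * x (u d) ->
  x (u 0%N) < t * x (u 1%N).
Proof.
move=> u_chain u'_chain d_gt0 d'_gt0 u0E udE at_0 at_d.
rewrite ltNge; apply/negP => base; have t0 := t_gt0.
have [] := hyp_decay _ _ u_chain base d.-1; rewrite prednK // => dec1 dec2.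
have Q_ge0 : 0 <= arm lam Q * x (u d).
  apply: mulr_ge0; last exact/ltW.
  by case/andP: (arm_bounds R lam Q (lam_ge2 R k t t_root)).
have base' : t * x (u' (d' - 1)%N) <= x (u' (d' - 0)%N).
  rewrite subn0 subn1 -udE.
  have := ler_wpM2l (ltW t0) at_d; rewrite mulrA (mul_t_lam R k t t_root).
  have sE : s * x (u d) = t * (t * x (u d)) by rewrite expr2 mulrA.
  rewrite mulrDl mul1r sE !mulrDr.
  by have := ler_wpM2l (ltW t0) dec1; have := mulr_ge0 (ltW t0) Q_ge0; lra.
have [] := hyp_decay _ _ (chain_rev _ _ _ _ e_sym u'_chain) base' d'.-1.
  by rewrite prednK.
by rewrite prednK // subnn subn0 -udE -u0E; lra.
Qed.

(** A ratio strictly between [1 / t] and [t] is the slope of a positive combination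
    [t^n + z * t^(-n)]. Read backwards from step [d], the same solution has parameter [s^d / z]. *)
Lemma slope_link u d : chain T e u d -> (0 < d)%N ->
  x (u 0%N) < t * x (u 1%N) -> x (u 1%N) < t * x (u 0%N) ->
  exists z, [/\ 0 < z, x (u 1%N) = slope R t z * x (u 0%N) &
    slope R t (s ^+ d / z) * x (u d) <= x (u d.-1)].
Proof.
move=> u_chain d_gt0 lt1 lt2; have t0 := t_gt0; have p0 := x_gt0 (u 0%N).
have n_gt0 : 0 < t * x (u 0%N) - x (u 1%N) by lra.
have m_gt0 : 0 < x (u 1%N) - x (u 0%N) / t.
  by rewrite subr_gt0 ltr_pdivrMr // mulrC.
pose z := (t * x (u 0%N) - x (u 1%N)) / (x (u 1%N) - x (u 0%N) / t).
have z_gt0 : 0 < z by rewrite divr_gt0.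
have z1_gt0 : 0 < 1 + z by lra.
have x1E : x (u 1%N) * (1 + z) = (t + z / t) * x (u 0%N).
  have : z * (x (u 1%N) - x (u 0%N) / t) = t * x (u 0%N) - x (u 1%N).
    by rewrite mulfVK // gt_eqF.
  lra.
pose y i := t ^+ i + z / t ^+ i.
have ti n := tX_gt0 R k t t_root n.
have y_gt0 i : 0 < y i by rewrite addr_gt0 ?divr_gt0.
exists z; split=> //.
  by rewrite /slope mulrAC -x1E mulfK // gt_eqF.
have y_rec i : y i + y i.+2 = lam * y i.+1.
  rewrite /y !exprS /ch; move: (t ^+ i) (ti i) => a a0.
  by field; rewrite !gt_eqF.
have base : x (u 1%N) * y 0%N <= x (u 0%N) * y 1%N.
  by rewrite /y expr0 expr1 divr1 x1E mulrC.
have := chain_ratio R T e lam x e_sym x_super d u y u_chain (fun i => ltW (y_gt0 i)) y_rec base d.-1.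
rewrite prednK // => /(_ (leqnn _)).
have -> : slope R t (s ^+ d / z) = y d.-1 / y d.
  case: (d) d_gt0 => // c _; rewrite /y succnK.
  have e1 : t ^+ c.+1 = t ^+ c * t by rewrite exprSr.
  have -> : s ^+ c.+1 = (t ^+ c * t) ^+ 2 by rewrite -e1 -!exprM mulnC.
  rewrite e1 /slope; move: (t ^+ c) (ti c) => a a0.
  have q1 : 0 < z + (a * t) ^+ 2 by rewrite ltr_pwDl ?sqr_ge0.
  by field; rewrite !gt_eqF //= ltr_wpDl ?sqr_ge0.
by rewrite mulrAC ler_pdivrMr // [y _ * _]mulrC.
Qed.

(** The four parameters multiply to [s^(d+d')], at most [s^(2P+2) * s^(2Q+2)], so at one end the
    product is small and [slope_sum_short] makes the arm there empty. The other arm then has length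
    at least [k - 1], and [slope_sum_ge1] at the first end bounds the product at the second, against
    [slope_sum_long]. *)
Lemma hyp_loop u u' d d' P Q : chain T e u d -> chain T e u' d' ->
  (0 < d)%N -> (0 < d')%N -> u 0%N = u' 0%N -> u d = u' d' ->
  (P + Q + d)%N = (2 * k)%N -> (d <= d')%N -> (d' <= k.+1)%N ->
  arm lam P * x (u 0%N) + x (u 1%N) + x (u' 1%N) <= lam * x (u 0%N) ->
  arm lam Q * x (u d) + x (u d.-1) + x (u' d'.-1) <= lam * x (u d) -> False.
Proof.
move=> u_chain u'_chain d_gt0 d'_gt0 u0E udE PQd dd' d'_le at_0 at_d.
have t0 := t_gt0; have p0 := x_gt0 (u 0%N); have q0 := x_gt0 (u d).
have fast := hyp_loop_fast _ _ _ _ P Q u_chain u'_chain d_gt0 d'_gt0 u0E udE at_0 at_d.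
have fast' : x (u' 0%N) < t * x (u' 1%N).
  apply: (hyp_loop_fast _ _ _ _ P Q u'_chain u_chain) => //.
    by rewrite -u0E; lra.
  by rewrite -udE; lra.
have P_ge0 : 0 <= arm lam P * x (u 0%N).
  apply: mulr_ge0; last exact/ltW.
  by case/andP: (arm_bounds R lam P (lam_ge2 R k t t_root)).
have tlam (c : R) : t * (lam * c) = t * (t * c) + c.
  by rewrite mulrA (mul_t_lam R k t t_root) mulrDl mul1r expr2 mulrA.
have at_0t := ler_wpM2l (ltW t0) at_0; rewrite tlam !mulrDr in at_0t.
have tP_ge0 := mulr_ge0 (ltW t0) P_ge0.
have slow : x (u 1%N) < t * x (u 0%N).
  by rewrite -(ltr_pM2l t0); rewrite -u0E in fast'; lra.
have slow' : x (u' 1%N) < t * x (u' 0%N).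
  by rewrite -(ltr_pM2l t0) -u0E; lra.
have [z1 [z1_gt0 x1E le1]] := slope_link u d u_chain d_gt0 fast slow.
have [z2 [z2_gt0 x2E le2]] := slope_link u' d' u'_chain d'_gt0 fast' slow'.
rewrite -u0E in x2E; rewrite -udE in le2.
have H1 : arm lam P + slope R t z1 + slope R t z2 <= lam.
  rewrite -(ler_pM2r p0).
  have -> : (arm lam P + slope R t z1 + slope R t z2) * x (u 0%N) =
    arm lam P * x (u 0%N) + x (u 1%N) + x (u' 1%N) by rewrite x1E x2E; ring.
  exact: at_0.
have H2 : arm lam Q + slope R t (s ^+ d / z1) + slope R t (s ^+ d' / z2) <= lam.
  rewrite -(ler_pM2r q0); apply: le_trans at_d.
  rewrite [leLHS]mulrDl [X in X + _ <= _]mulrDl; apply: lerD le2.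
  by rewrite lerD2l.
have s_ge := root_sqr_ge R k t t_root.
have sX n : 0 < s ^+ n by rewrite exprn_gt0 //; lra.
have s_le m n : (m <= n)%N -> s ^+ m <= s ^+ n.
  by move=> le_mn; apply: ler_weXn2l => //; lra.
have sqE n : s ^+ n ^+ 2 = s ^+ (n * 2) by rewrite [RHS]exprM.
have z12 : 0 < z1 * z2 by rewrite mulr_gt0.
have z1'_gt0 : 0 < s ^+ d / z1 by rewrite divr_gt0.
have z2'_gt0 : 0 < s ^+ d' / z2 by rewrite divr_gt0.
have prodE : s ^+ d / z1 * (s ^+ d' / z2) = s ^+ (d + d') / (z1 * z2).
  by rewrite mulf_div exprD.
have nat1 : (d + d' <= k.+1 * 2)%N by clear - dd' d'_le; lia.
have nat2 : (d + d' <= Q.+1 * 2 + P.+1 * 2)%N by clear - PQd dd' d'_le; lia.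
have nat3 : P = 0%N -> (k <= Q.+1)%N by clear - PQd dd' d'_le; lia.
have nat4 : Q = 0%N -> (k <= P.+1)%N by clear - PQd dd' d'_le; lia.
have arm_ge0 n : 0 <= arm lam n by case/andP: (arm_bounds R lam n (lam_ge2 R k t t_root)).
have [le12|lt12] := leP (z1 * z2) (s ^+ P.+1 ^+ 2).
  have P0 := slope_sum_short R k t t_root P z1 z2 z1_gt0 z2_gt0 le12 H1.
  have ge1 : 1 <= z1 * z2.
    apply: (slope_sum_ge1 R k t t_root) => //.
    by rewrite -addrA in H1; have := arm_ge0 P; lra.
  have big : s ^+ d / z1 * (s ^+ d' / z2) <= s ^+ k.+1 ^+ 2.
    rewrite prodE ler_pdivrMr // -[s ^+ (d + d')]mulr1.
    by apply: ler_pM => //; [exact/ltW | rewrite sqE s_le].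
  have := slope_sum_long R k t t_root k_ge3 Q _ _ (nat3 P0) z1'_gt0 z2'_gt0 big.
  by rewrite ltNge H2.
have Q0 : Q = 0%N.
  apply: (slope_sum_short R k t t_root Q _ _ z1'_gt0 z2'_gt0 _ H2).
  rewrite prodE ler_pdivrMr //; apply: le_trans (_ : s ^+ Q.+1 ^+ 2 * s ^+ P.+1 ^+ 2 <= _).
    by rewrite !sqE -exprD s_le.
  by rewrite ler_pM2l ?exprn_gt0 // ltW.
have ge1 : 1 <= s ^+ d / z1 * (s ^+ d' / z2).
  apply: (slope_sum_ge1 R k t t_root) => //.
  by rewrite -addrA in H2; have := arm_ge0 Q; lra.
rewrite prodE ler_pdivlMr // mul1r in ge1.
have big : z1 * z2 <= s ^+ k.+1 ^+ 2 by apply: le_trans ge1 _; rewrite sqE s_le.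
have := slope_sum_long R k t t_root k_ge3 P _ _ (nat4 Q0) z1_gt0 z2_gt0 big.
by rewrite ltNge H1.
Qed.

Lemma hyp_single_attach v : #|T| = (3 * k).+1 -> geodesic T e v (2 * k) ->
  single_attach T e (2 * k) v.
Proof.
move=> T_card v_geo w w' a b w_off w'_off ww' a_le b_le aw bw'.
wlog lt_ab : w w' a b w_off w'_off ww' a_le b_le aw bw' / (a < b)%N.
  move=> IH; case: (ltngtP a b) => // [lt_ab|lt_ba]; first exact: (IH w w').
  apply/esym/(IH w' w) => //.
  by rewrite (sym_connect_sym (off_edge_sym T e _ e_sym v)).
have [u' [d' [[u'_chain u'0 u'd' /andP[dd' d'_le]] [at_a at_b]]]] :=
  detour R T e lam x k e_sym x_super (lam_ge2 R k t t_root) T_card v w w' a b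
    v_geo w_off w'_off ww' lt_ab b_le aw bw'.
have bE : (a + (b - a))%N = b by clear - lt_ab; lia.
have b1E : (a + (b - a).-1)%N = b.-1 by clear - lt_ab; lia.
have abL : (a + (b - a) <= 2 * k)%N by rewrite bE.
have u_chain := chain_right T e _ v v_geo a (b - a) abL.
have d_gt0 : (0 < b - a)%N by rewrite subn_gt0.
exfalso; apply: (hyp_loop _ _ _ _ a (2 * k - b) u_chain u'_chain d_gt0) => //.
- exact: leq_trans d_gt0 dd'.
- by rewrite addn0.
- by rewrite bE.
- by clear - lt_ab b_le; lia.
- by rewrite addn0 addn1.
- by rewrite bE b1E.
Qed.

End HyperbolicLoop.

(** * Sweeping along the geodesic *)

Definition mass_before (m : nat -> nat) (a : nat) : nat := (\sum_(b < a) m b)%N.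

Lemma mass_beforeS m a : mass_before m a.+1 = (mass_before m a + m a)%N.
Proof. by rewrite /mass_before big_ord_recr. Qed.

Lemma mass_before_mono m a b : (a <= b)%N -> (mass_before m a <= mass_before m b)%N.
Proof.
move=> /subnK <-; elim: (b - a)%N => // d IHd.
by rewrite addSn mass_beforeS (leq_trans IHd) // leq_addr.
Qed.

(** The induction carries a position [b <= a] that bounds the sum and, unless the sum is 0, has a
    positive length. A later length at [c] then adds at most [c - b]. *)
Lemma mass_before_le m k a : (forall b, (b <= k)%N -> (m b <= b)%N) ->
  (forall b c, (b < c)%N -> (c <= k)%N -> (0 < m b)%N -> (m c <= c - b)%N) ->
  (a <= k)%N -> (mass_before m a.+1 <= a)%N.
Proof.
move=> m_le m_pair a_le.
suff [b [ba bm _]] : exists b, [/\ (b <= a)%N, (mass_before m a.+1 <= b)%N &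
    (mass_before m a.+1 = 0)%N \/ (0 < m b)%N] by exact: leq_trans ba.
elim: a a_le => [|a IHa] a_le.
  exists 0%N; rewrite mass_beforeS /mass_before big_ord0 add0n.
  by have := m_le 0%N isT; rewrite leqn0 => /eqP ->; split => //; left.
have [b [ba bm b_alt]] := IHa (ltnW a_le); rewrite mass_beforeS.
have [->|ma_gt0] := posnP (m a.+1); first by exists b; rewrite addn0; split => //; lia.
exists a.+1; split => //; last by right.
case: b_alt => [->|mb_gt0]; first by rewrite add0n m_le.
by have := m_pair b a.+1 ba a_le mb_gt0; lia.
Qed.

Lemma mass_before_rev m L a : (a <= L)%N ->
  (mass_before (fun i => m (L - i)%N) (L - a).+1 + mass_before m a = mass_before m L.+1)%N.
Proof.
move=> a_le; have [d dE] : exists d, L = (a + d)%N by exists (L - a)%N; lia.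
have -> : (L - a = d)%N by lia.
have E n : (n <= d.+1)%N ->
    (mass_before (fun i => m (L - i)%N) n + mass_before m (L.+1 - n) = mass_before m L.+1)%N.
  elim: n => [|n IHn] n_le; first by rewrite /mass_before big_ord0 add0n subn0.
  rewrite mass_beforeS -[RHS]IHn; last exact: ltnW.
  have -> : (L.+1 - n = (L.+1 - n.+1).+1)%N by lia.
  by rewrite mass_beforeS subSS -addnA [(m _ + _)%N]addnC.
by have := E d.+1 (leqnn _); have -> : (L.+1 - d.+1 = a)%N by lia.
Qed.

Section Sweep.
Variables (R : realType) (k : nat) (lam : R) (yy : nat -> nat -> R).
Hypothesis yy_profile : profile R k lam yy.
Hypothesis yy_merging : merging R k lam yy.
Variables (X : nat -> R) (m : nat -> nat).
Hypothesis X_start : X 0%N = 0.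
Hypothesis X_end : X (2 * k).+2 = 0.
Hypothesis X_gt0 : forall n, (0 < n <= (2 * k).+1)%N -> 0 < X n.
Hypothesis X_super : forall a, (a <= 2 * k)%N ->
  X a + X a.+2 + arm lam (m a) * X a.+1 <= lam * X a.+1.
Local Notation pre := (mass_before m).
Hypothesis m_total : pre (2 * k).+1 = k.
Hypothesis m_left : forall a, (a <= 2 * k)%N -> (pre a.+1 <= a)%N.
Hypothesis m_right : forall a, (a <= 2 * k)%N -> (a <= k + pre a)%N.

(** A discrete Wronskian whose sign compares the ratios of consecutive values of [X] and of the
    current profile. The index is shifted: [X a.+1] belongs to vertex [a]. *)
Definition deficit a := X a * yy (pre a) a.+1 - X a.+1 * yy (pre a) a.

Lemma pre_le a : (a <= (2 * k).+1)%N -> (pre a <= k)%N.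
Proof. by move=> a_le; rewrite -m_total mass_before_mono. Qed.

(** The slack in [merging] when the profile changes from [pre a] to [pre a.+1]. *)
Definition gain a :=
  arm lam (m a) * (yy (pre a) a.+1 * yy (pre a.+1) a.+1)
  - (yy (pre a) a.+2 * yy (pre a.+1) a.+1 - yy (pre a) a.+1 * yy (pre a.+1) a.+2).

Lemma deficit_step a : (a <= 2 * k)%N ->
  deficit a * yy (pre a.+1) a.+1 + X a.+1 * gain a <= deficit a.+1 * yy (pre a) a.+1.
Proof.
move=> a_le; rewrite /deficit /gain; set Y := yy (pre a); set Z := yy (pre a.+1).
have Y0 : 0 < Y a.+1 by apply: (profile_gt0 _ _ _ _ yy_profile); rewrite ?pre_le //; lia.
have Z0 : 0 < Z a.+1 by apply: (profile_gt0 _ _ _ _ yy_profile); rewrite ?pre_le //; lia.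
have Yrec := profile_rec _ _ _ _ yy_profile _ _ (pre_le a (leqW a_le)) a_le.
have := ler_wpM2r (ltW (mulr_gt0 Y0 Z0)) (X_super a a_le).
rewrite -/Y in Yrec; move: (arm lam _) => f H.
have : lam * X a.+1 * (Y a.+1 * Z a.+1) = X a.+1 * Z a.+1 * (Y a + Y a.+2).
  by rewrite Yrec; ring.
by lra.
Qed.

Definition tight a :=
  a = (2 * pre a + m a)%N /\ (pre a = 0%N \/ (pre a + m a)%N = k).

Lemma merge_gain a : (a <= 2 * k)%N ->
  0 <= gain a /\ (gain a = 0 -> (0 < m a)%N -> tight a).
Proof.
move=> a_le; have [m0|m_gt0] := posnP (m a).
  split => //; suff -> : gain a = 0 by [].
  by rewrite /gain mass_beforeS m0 addn0 /=; ring.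
have le_k : (pre a + m a <= k)%N by rewrite -mass_beforeS pre_le.
have le_a : (pre a + m a <= a)%N by rewrite -mass_beforeS m_left.
have [H1 H2] := yy_merging (pre a) (m a) a m_gt0 le_k le_a (m_right a a_le).
rewrite /gain mass_beforeS; split; first by rewrite subr_ge0.
by move=> /eqP; rewrite subr_eq0 => /eqP /esym /H2.
Qed.

Lemma deficit_ge0 a : (a <= (2 * k).+1)%N -> 0 <= deficit a.
Proof.
elim: a => [|a IHa] a_le.
  by rewrite /deficit X_start mul0r /mass_before big_ord0 (profile_start _ _ _ _ yy_profile) mulr0 subr0.
have Y0 : 0 < yy (pre a) a.+1 by apply: (profile_gt0 _ _ _ _ yy_profile); rewrite ?pre_le //; lia.
have Z0 : 0 < yy (pre a.+1) a.+1 by apply: (profile_gt0 _ _ _ _ yy_profile); rewrite ?pre_le //; lia.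
rewrite -(pmulr_lge0 _ Y0); apply: le_trans (deficit_step a a_le).
have [g_ge0 _] := merge_gain a a_le.
by rewrite addr_ge0 // mulr_ge0 ?IHa ?(ltW Z0) ?(ltnW a_le) // ltW // X_gt0.
Qed.

Lemma sweep_tight a : (a <= 2 * k)%N -> (0 < m a)%N -> tight a.
Proof.
move=> a_le m_gt0.
have deficit0 b : (b <= (2 * k).+1)%N -> deficit b = 0.
  (* Both [X] and the last profile vanish one step past the far end. Read backwards, [deficit_step]
     carries this zero to all positions, and then every gain is zero. *)
  have base : deficit (2 * k).+1 = 0.
    rewrite /deficit X_end mul0r m_total (profile_refl _ _ _ _ yy_profile) ?leqnn // subnn subnn.
    by rewrite (profile_start _ _ _ _ yy_profile) mulr0 subr0.
  move=> b_le; have [d dE] : exists d, (2 * k).+1 = (b + d)%N by exists ((2 * k).+1 - b)%N; lia.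
  elim: d b b_le dE => [|d IHd] b b_le dE; first by rewrite -base dE addn0.
  have b_le' : (b <= 2 * k)%N by lia.
  have d0 : deficit b.+1 = 0 by apply: IHd; lia.
  have := deficit_step b b_le'; rewrite d0.
  have Z0 : 0 < yy (pre b.+1) b.+1 by apply: (profile_gt0 _ _ _ _ yy_profile); rewrite ?pre_le //; lia.
  have [g_ge0 _] := merge_gain b b_le'.
  have Xg : 0 <= X b.+1 * gain b.
    by rewrite mulr_ge0 // ltW // X_gt0 //=; lia.
  rewrite mul0r => H; apply/le_anti; rewrite deficit_ge0 // andbT.
  by rewrite -(pmulr_lle0 _ Z0); apply: le_trans H; rewrite lerDl.
have [g_ge0 g_tight] := merge_gain a a_le; apply: g_tight => //.
have := deficit_step a a_le; rewrite !deficit0 ?(leqW a_le) // !mul0r add0r.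
have X0 : 0 < X a.+1 by apply: X_gt0.
by rewrite pmulr_rle0 // => g_le0; apply/le_anti; rewrite g_ge0 g_le0.
Qed.

Lemma sweep_shape : (0 < k)%N ->
  exists i j, [/\ (0 < j)%N, (i + j)%N = k, (i = 0%N \/ m i = i) & m (2 * i + j)%N = j].
Proof.
move=> k_gt0.
have [a [a_le ma_gt0]] : exists a, (a <= 2 * k)%N /\ (0 < m a)%N.
  have : (0 < mass_before m (2 * k).+1)%N by rewrite m_total.
  rewrite lt0n sum_nat_eq0 negb_forall => /existsP[[a a_lt] /= ma].
  by exists a; rewrite -ltnS lt0n.
have ex : exists a, (0 < m a)%N by exists a.
case: (ex_minnP ex) => b mb_gt0 b_min; have b_le : (b <= 2 * k)%N by apply: leq_trans (b_min a ma_gt0) _.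
have pre_b : pre b = 0%N.
  apply/eqP; rewrite /mass_before sum_nat_eq0; apply/forallP => -[c c_lt] /=.
  by rewrite -leqn0 leqNgt; apply/negP => /b_min; rewrite leqNgt c_lt.
have [bE _] := sweep_tight b b_le mb_gt0; rewrite pre_b in bE.
have mbE : m b = b by lia.
have pre_b1 : pre b.+1 = b by rewrite mass_beforeS pre_b mbE.
have [bk|b_neq] := eqVneq b k.
  by exists 0%N, k; rewrite muln0 !add0n -bk mbE; split => //; [rewrite bk | left].
have b_ltk : (b < k)%N.
  by rewrite ltn_neqAle b_neq -pre_b1 pre_le // ltnS.
have [c [c_le lt_bc mc_gt0 c_min]] : exists c, [/\ (c <= 2 * k)%N, (b < c)%N, (0 < m c)%N &
    forall d, (b < d < c)%N -> m d = 0%N].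
  have exc : exists c, (b < c <= 2 * k)%N && (0 < m c)%N.
    suff /existsP[[c c_lt] /= /andP[bc mc]] : [exists c : 'I_(2 * k).+1, (b < c)%N && (0 < m c)%N].
      by exists c; rewrite bc mc andbT -ltnS.
    apply: contraT => /existsPn no_c.
    have E n : (b < n)%N -> (n <= (2 * k).+1)%N -> pre n = b.
      elim: n => // n IHn; rewrite ltnS leq_eqVlt => /orP[/eqP <- //|lt_bn] n_le.
      rewrite mass_beforeS IHn ?(ltnW n_le) //.
      have := no_c (Ordinal n_le); rewrite /= lt_bn /= -leqNgt leqn0 => /eqP ->.
      by rewrite addn0.
    by move: b_neq; rewrite -m_total E ?eqxx // ltnS.
  case: (ex_minnP exc) => c /andP[/andP[lt_bc c_le] mc_gt0] c_min; exists c; split => //.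
  move=> d /andP[bd dc]; apply/eqP; rewrite -leqn0 leqNgt; apply/negP => md.
  by have := c_min d; rewrite bd md (leq_trans (ltnW dc) c_le) => /(_ isT); rewrite leqNgt dc.
have pre_c : pre c = b.
  suff E n : (b < n <= c)%N -> pre n = b by apply: E; rewrite lt_bc leqnn.
  elim: n => // n IHn; rewrite ltnS leq_eqVlt => /andP[/orP[/eqP <- //|lt_bn] n_le].
  by rewrite mass_beforeS IHn ?c_min ?addn0 // ?lt_bn // ltnW.
(* At the second attachment something has accumulated already, so tightness leaves only the
   alternative that the total [k] is reached. *)
have [cE [pre0|tot]] := sweep_tight c c_le mc_gt0; rewrite pre_c in cE *.
  by move: pre0 mbE mb_gt0; rewrite pre_c => ->; lia.
exists b, (m c); rewrite -cE; split => //; last by right.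
by rewrite -pre_c.
Qed.

End Sweep.

(** * Pendent paths along a geodesic *)

Section Structure.
Variables (R : realType) (T : finType) (e : rel T) (lam : R) (x : T -> R) (k : nat).
Hypothesis e_sym : symmetric e.
Hypothesis x_super : supersolution R T e lam x.
Hypothesis lam_ge2 : 2 <= lam.
Hypothesis lam_sqr : lam ^+ 2 < 9 / 2.
Hypothesis arm_k : arm lam k = lam / 3.
Hypothesis excess : fork_excess R lam.
Hypothesis T_card : #|T| = (3 * k).+1.
Hypothesis diam : forall a b : T,
  exists p, [/\ path e a p, last a p = b & (size p <= 2 * k)%N].
Hypothesis attach : forall v, geodesic T e v (2 * k) -> single_attach T e (2 * k) v.

Local Notation L := (2 * k)%N.
Local Notation geo v := (geodesic T e v L).
Local Notation on v := (on_path T L v).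
Local Notation off v := (off_edge T e L v).
Local Notation rev_geo v := (fun i : nat => v (L - i)%N).
Let x_gt0 : forall u, 0 < x u := super_gt0 R T e lam x x_super.

(** The ends of the geodesic are [2 * k] apart, so one of them is at least [k] away from [u]. *)
Lemma long_path v u : geo v ->
  exists p, [/\ path e u p, uniq (u :: p) & (k <= size p)%N].
Proof.
move=> v_geo; have [p0 [p0_path p0_last _]] := diam u (v 0%N).
have [q0 [q0_path q0_last _]] := diam u (v L).
move: p0_last; case/shortenP: p0_path => p p_path p_uniq _ p_last.
move: q0_last; case/shortenP: q0_path => q q_path q_uniq _ q_last.
have [r [r_path r_last r_size]] := rev_walk _ _ _ _ e_sym p_path.
rewrite p_last in r_path r_last.
have := v_geo.2 0%N L (r ++ q) (leq0n _) (leqnn _).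
rewrite cat_path r_path last_cat r_last q_path size_cat r_size => /(_ isT q_last) pq.
have [le_kp|lt_pk] := leqP k (size p); first by exists p.
exists q; split => //; move: pq lt_pk; move: (size p) (size q) => n m; clear; lia.
Qed.

Lemma sum_seq_ge (s : seq T) (c : R) : (forall w, w \in s -> c <= x w) ->
  (size s)%:R * c <= \sum_(w <- s) x w.
Proof.
elim: s => [|w s IHs] s_ge; first by rewrite big_nil mul0r.
rewrite big_cons /= -natr1 mulrDl mul1r addrC lerD ?s_ge ?mem_head //.
by apply: IHs => z zs; apply: s_ge; rewrite inE zs orbT.
Qed.

(** One neighbour starts a path of length [k] and has ratio at least [lam / 3]; three further ones
    have at least [1 / lam] each. The sum exceeds [lam] precisely because [lam^2 < 9/2]. *)
Lemma degree_le3 v u s : geo v -> uniq s -> all (e u) s -> (size s <= 3)%N.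
Proof.
move=> v_geo s_uniq s_nbr; rewrite leqNgt; apply/negP => s_size.
have [k0|k_gt0] := posnP k.
  by have := arm_k; rewrite k0 /=; have := lam_ge2; lra.
have [p [p_path p_uniq p_size]] := long_path v u v_geo.
have l2 := lam_ge2; have ls := lam_sqr; have u0 := x_gt0 u.
have := arm_le R T e lam x e_sym x_super l2 _ _ (chain_of_path T e u p p_path p_uniq).
have := arm_mono R lam k (size p) l2 p_size; rewrite arm_k.
case: p p_path p_uniq p_size => [|y p] /=; first by rewrite leqn0 => _ _ /eqP; lia.
case/andP=> uy _ _ p_size arm1 arm2; rewrite -/(arm lam (size p).+1) in arm1 arm2.
pose s' := [seq w <- s | w != y].
have s'_size : (3 <= size s')%N.
  have -> : size s' = count (predC (pred1 y)) s by rewrite size_filter.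
  have := count_predC (pred1 y) s; rewrite count_uniq_mem //.
  move: s_size; move: (size s) (count _ _) (y \in s) => n m b; clear.
  by case: b => /=; lia.
have := nbr_sum_le R T e lam x x_super (y :: s') u.
rewrite /= filter_uniq // mem_filter eqxx uy /= => /(_ isT).
have -> : all (e u) s' by apply/allP => w; rewrite mem_filter => /andP[_ /(allP s_nbr)].
move=> /(_ isT); rewrite big_cons.
have : (size s')%:R * (x u / lam) <= \sum_(w <- s') x w.
  apply: sum_seq_ge => w; rewrite mem_filter => /andP[_ /(allP s_nbr) uw].
  exact: (nbr_ge R T e lam x e_sym x_super).
have : 3 * (x u / lam) <= (size s')%:R * (x u / lam).
  by rewrite ler_wpM2r ?ler_nat // divr_ge0 ?ltW //; lra.
have : lam / 3 * x u <= arm lam (size p).+1 * x u by rewrite ler_wpM2r // ltW.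
have : lam * (lam * x u) < 9 / 2 * x u by rewrite mulrA -expr2 ltr_pM2r.
have : lam * (x u / lam) = x u by rewrite mulrC mulfVK // gt_eqF //; lra.
move: (x u / lam) (\sum_(_ <- _) _) => q S q1 h1 h2 h3 h4 h5.
have : lam * (3 * q + lam / 3 * x u) <= lam * (lam * x u).
  by rewrite ler_wpM2l //; lra.
by lra.
Qed.

Lemma no_four v u a b c d : geo v -> e u a -> e u b -> e u c -> e u d ->
  uniq [:: a; b; c; d] -> False.
Proof.
move=> v_geo ua ub uc ud abcd; have := degree_le3 v u [:: a; b; c; d] v_geo abcd.
by rewrite /= ua ub uc ud => /(_ isT).
Qed.

Lemma off_last v w p : ~~ on v w -> path (off v) w p -> ~~ on v (last w p).
Proof.
by elim: p w => //= c p IHp w _ /andP[/and3P[_ _ c_off]]; apply: IHp.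
Qed.

(* Any walk from an attached component to the end of the geodesic passes through its
   attachment vertex. *)
Lemma exit_length v a w z : geo v -> (a <= L)%N -> ~~ on v w -> ~~ on v z ->
  e (v a) w -> connect (off v) w z ->
  exists p, [/\ path (off v) z p, e (last z p) (v a) & (size p < a)%N].
Proof.
move=> v_geo a_le w_off z_off aw wz.
have [p [p_path p_last p_size]] := diam z (v L).
have := first_hit T e L v z p z_off p_path.
rewrite p_last on_path_v // => /(_ isT)[p1 [b [p2 [pE b_le p1_path p1_edge]]]].
have ba : b = a.
  apply/esym/(attach v v_geo w (last z p1) a b) => //; first exact: off_last.
    by apply: connect_trans wz _; apply/connectP; exists p1.
  by rewrite e_sym.
exists p1; split; rewrite -?ba //.
move: p_path p_last p_size; rewrite pE cat_path last_cat size_cat /=.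
case/and3P=> _ _ p2_path p2_last.
(* From the attachment vertex on, the walk still needs [L - a] steps, which leaves at most [a] for
   reaching it. *)
have := v_geo.2 b L p2 b_le (leqnn _) p2_path p2_last.
by rewrite ba; clear - a_le; move: (size p1) (size p2) => n1 n2; lia.
Qed.

Lemma attach_gt0 v a w : geo v -> (a <= L)%N -> ~~ on v w -> e (v a) w -> (0 < a)%N.
Proof.
move=> v_geo a_le w_off aw.
have [p [_ _]] := exit_length v a w w v_geo a_le w_off w_off aw (connect0 _ _).
exact: leq_ltn_trans.
Qed.

Lemma attach_inner v a w : geo v -> (a <= L)%N -> ~~ on v w -> e (v a) w -> (0 < a < L)%N.
Proof.
move=> v_geo a_le w_off aw; rewrite (attach_gt0 v a w) //=.
have := attach_gt0 (rev_geo v) (L - a) w (geodesic_rev T e L e_sym v v_geo) (leq_subr _ _).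
by rewrite on_path_rev subKn // subn_gt0; apply.
Qed.

(** Merely a path that leaves [v a] and avoids the geodesic; that nothing branches off it has to be
    proved. *)
Definition hang v a s := [&& path e (v a) s, uniq s & all (fun c => ~~ on v c) s].

Lemma hang_rev v a s : (a <= L)%N -> hang (rev_geo v) (L - a) s = hang v a s.
Proof.
move=> a_le; rewrite /hang subKn //; congr [&& _, _ & _].
by apply: eq_all => c; rewrite on_path_rev.
Qed.

Lemma hang_uniq v a s : (a <= L)%N -> hang v a s -> uniq (v a :: s).
Proof.
move=> a_le /and3P[_ s_uniq s_off]; rewrite /= s_uniq andbT.
by apply/negP => /(allP s_off); rewrite on_path_v.
Qed.

Lemma hang_chain v a s : (a <= L)%N -> hang v a s -> chain T e (nth (v a) (v a :: s)) (size s).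
Proof.
move=> a_le s_hang; apply: chain_of_path; last exact: hang_uniq.
by case/and3P: s_hang.
Qed.

Lemma hang_connect v a w s z : hang v a (w :: s) -> z \in w :: s -> connect (off v) w z.
Proof.
case/and3P=> /= /andP[_ s_path] _ /andP[w_off s_off] zs.
have s_off_path : path (off v) w s.
  elim: s w w_off s_path s_off {zs} => //= c s IHs w w_off /andP[wc s_path] /andP[c_off s_off].
  by rewrite /off_edge /= wc w_off c_off IHs.
exact: (path_connect s_off_path).
Qed.

Lemma hang_arm v a w s : (a <= L)%N -> hang v a (w :: s) ->
  arm lam (size s).+1 * x (v a) <= x w.
Proof.
move=> a_le s_hang.
exact: (arm_le R T e lam x e_sym x_super lam_ge2 _ _ (hang_chain v a _ a_le s_hang)).
Qed.

Lemma left_arm v a : geo v -> (0 < a <= L)%N -> arm lam a * x (v a) <= x (v a.-1).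
Proof.
move=> v_geo /andP[a_gt0 a_le].
have := arm_le R T e lam x e_sym x_super lam_ge2 _ _
  (chain_left T e L e_sym v v_geo a a (leqnn a) a_le).
by rewrite subn0 subn1.
Qed.

Lemma right_arm v a m : geo v -> (a + m <= L)%N -> arm lam m * x (v a) <= x (v a.+1).
Proof.
move=> v_geo am_le.
have := arm_le R T e lam x e_sym x_super lam_ge2 _ _ (chain_right T e L v v_geo a m am_le).
by rewrite addn0 addn1.
Qed.

Lemma tri_vertex v a w : geo v -> (0 < a < L)%N -> ~~ on v w -> e (v a) w ->
  [/\ e (v a) (v a.-1), e (v a) (v a.+1), uniq [:: v a.-1; v a.+1; w] &
      x (v a.-1) + x (v a.+1) + x w <= lam * x (v a)].
Proof.
move=> v_geo /andP[a_gt0 a_lt] w_off aw.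
have e1 : e (v a) (v a.-1).
  by rewrite e_sym; have := v_geo.1 a.-1; rewrite prednK //; apply; clear - a_gt0 a_lt; lia.
have e2 : e (v a) (v a.+1) by apply: v_geo.1.
have u3 : uniq [:: v a.-1; v a.+1; w].
  rewrite /= !inE !negb_or (geodesic_eq T e _ v v_geo); try by clear - a_gt0 a_lt; lia.
  have neq_w i : (i <= L)%N -> v i != w.
    by move=> i_le; apply: contraNneq w_off => <-; apply: on_path_v.
  by rewrite !neq_w ?andbT //; clear - a_gt0 a_lt; lia.
by split=> //; apply: (nbr3_le R T e lam x x_super).
Qed.

(** Seen from [v a] there are the geodesic leftwards for [a] steps, rightwards for at least [k], and
    a branching at distance [j < a]. The position of [z] is arbitrary, so chords are excluded
    too. *)
Lemma hang_fork_half v a s j z : geo v -> (a <= k)%N -> hang v a s ->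
  (0 < j < size s)%N -> (j < a)%N ->
  e (nth (v a) (v a :: s) j) z ->
  z != nth (v a) (v a :: s) j.-1 -> z != nth (v a) (v a :: s) j.+1 -> False.
Proof.
move=> v_geo a_le s_hang /andP[j_gt0 j_lt] ja jz z1 z2.
have a_leL : (a <= L)%N by clear - a_le; lia.
case: s s_hang j_lt jz z1 z2 => // w s s_hang j_lt jz z1 z2.
have [aw w_off] : e (v a) w /\ ~~ on v w by case/and3P: s_hang => /= /andP[-> _] _ /andP[->].
have a_in := attach_inner v a w v_geo a_leL w_off aw.
have [_ _ _ le_lam] := tri_vertex v a w v_geo a_in w_off aw.
have [ch1 ch2] := hang_chain v a _ a_leL s_hang.
have l_arm := left_arm v a v_geo.
have r_arm := right_arm v a k v_geo.
have {}l_arm : arm lam a * x (v a) <= x (v a.-1) by apply: l_arm; clear - a_in; lia.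
have {}r_arm : arm lam k * x (v a) <= x (v a.+1) by apply: r_arm; clear - a_le; lia.
case: j j_gt0 j_lt ja jz z1 z2 => // j _ j_lt ja jz z1 z2.
have sub_chain : chain T e (nth (v a) (v a :: w :: s)) j.+1.
  by split=> i lt_i; [apply: ch1 | apply: ch2]; apply: ltn_trans lt_i j_lt.
have un : uniq [:: nth (v a) (v a :: w :: s) j; nth (v a) (v a :: w :: s) j.+2; z].
  have neq := ch2 j j_lt.
  by rewrite /= !inE !negb_or neq ![_ == z]eq_sym z1 z2.
have f_le := fork_le R T e lam x e_sym x_super lam_ge2 j _ _ z sub_chain (ch1 _ j_lt) jz un.
have := excess j.+1 a isT ja; have a0 := x_gt0 (v a).
have {}f_le : fork lam j.+1 * x (v a) <= x w by exact: f_le.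
rewrite -arm_k -(ltr_pM2r a0) !mulrDl; lra.
Qed.

Lemma hang_fork v a s j z : geo v -> (a <= L)%N -> hang v a s ->
  (0 < j < size s)%N -> (j < a)%N -> (j < L - a)%N ->
  e (nth (v a) (v a :: s) j) z ->
  z != nth (v a) (v a :: s) j.-1 -> z != nth (v a) (v a :: s) j.+1 -> False.
Proof.
move=> v_geo a_le s_hang j_in ja ja'.
have [le_ak|lt_ka] := leqP a k; first exact: hang_fork_half.
have g := hang_fork_half (rev_geo v) (L - a)%N s j z (geodesic_rev T e L e_sym v v_geo).
rewrite hang_rev // subKn // in g; apply: g => //; clear - lt_ka; lia.
Qed.

(** A longer path would be a corridor: no branching at distances below [a], and [w] its only
    entrance from [v a]. The vertex at distance [a + 1] would need [a] steps back to [w], more than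
    [exit_length] allows. *)
Lemma hang_short_half v a s : geo v -> (a <= k)%N -> hang v a s -> (size s <= a)%N.
Proof.
move=> v_geo a_le s_hang; rewrite leqNgt; apply/negP => lt_as.
have a_leL : (a <= L)%N by clear - a_le; lia.
case: s s_hang lt_as => // w s0; set s := w :: s0 => s_hang lt_as.
have /and3P[/andP[aw _] s_uniq s_off] := s_hang.
have w_off : ~~ on v w by case/andP: (s_off).
have a_in := attach_inner v a w v_geo a_leL w_off aw.
have [e1 e2 u3 _] := tri_vertex v a w v_geo a_in w_off aw.
have vs_uniq := hang_uniq v a s a_leL s_hang.
pose u i := nth (v a) (v a :: s) i.
have off_mem z : z \in s -> ~~ on v z by move=> /(allP s_off).
have only_nbr j z : (j.+1 < a)%N -> e (u j.+1) z -> z = u j \/ z = u j.+2.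
  move=> ja jz; have [->|z1] := eqVneq z (u j); first by left.
  have [->|z2] := eqVneq z (u j.+2); first by right.
  case: (hang_fork_half v a s j.+1 z) => //.
  by rewrite (ltn_trans ja lt_as).
pose tgt := nth (v a) s a.
have tgt_s : tgt \in s by rewrite mem_nth.
have [p [p_path p_edge p_size]] :=
  exit_length v a w tgt v_geo a_leL w_off (off_mem _ tgt_s) aw (hang_connect v a w s0 tgt s_hang tgt_s).
(* The position in the corridor, capped at [a + 1] since branching is uncontrolled beyond it; it
   drops by at most 1 per step off the geodesic. *)
pose phi y := minn (index y (v a :: s)) a.+1.
have phi_u i : (phi (u i) <= i)%N.
  rewrite /phi geq_min; have [lt_i|le_i] := ltnP i (size (v a :: s)).
    by rewrite index_uniq // leqnn.
  by apply/orP; right; apply: leq_trans (leqW lt_as) le_i.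
suff walk y q : ~~ on v y -> path (off v) y q -> e (last y q) (v a) -> (phi y <= (size q).+1)%N.
  have := walk tgt p (off_mem _ tgt_s) p_path p_edge.
  have -> : phi tgt = a.+1.
    rewrite /phi -[tgt]/(nth (v a) (v a :: s) a.+1) index_uniq //; first exact: minnn.
  by rewrite ltnS leqNgt p_size.
elim: q y => [|c q IHq] y y_off /=.
  move=> _ ya; suff -> : y = w by apply: (phi_u 1%N).
  apply/eqP/negPn/negP => yw; rewrite e_sym in ya.
  apply: (no_four v (v a) (v a.-1) (v a.+1) w y v_geo e1 e2 aw ya).
  have neq_y i : (i <= L)%N -> v i != y.
    by move=> i_le; apply: contraNneq y_off => <-; apply: on_path_v.
  move: u3; rewrite /= !inE !negb_or [w == y]eq_sym yw => /and3P[/andP[-> ->] -> _] /=.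
  by rewrite !neq_y //; clear - a_in; lia.
case/andP=> /and3P[yc _ c_off] q_path q_edge; have := IHq c c_off q_path q_edge.
have [le_ac|lt_ca] := leqP a (phi c).
  by move=> le_q; apply: leq_trans (geq_minr _ _) _; rewrite !ltnS (leq_trans le_ac).
have lt_ia : (index c (v a :: s) < a)%N by move: lt_ca; rewrite /phi gtn_min => /orP[//|]; rewrite ltnNge leqW.
have c_in : c \in v a :: s by rewrite -index_mem; apply: ltn_trans lt_ia (leqW lt_as).
have cE : c = u (index c (v a :: s)) by rewrite /u nth_index.
have phi_c : phi c = index c (v a :: s) by rewrite /phi; apply/minn_idPl/ltnW/ltnW.
rewrite phi_c; move: cE lt_ia; case: (index c (v a :: s)) => [|j] cE lt_ja.
  by case/negP: c_off; rewrite cE on_path_v.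
move=> le_q; rewrite cE e_sym in yc; case: (only_nbr j y lt_ja yc) => ->.
  exact: leq_trans (phi_u j) (leqW (ltnW le_q)).
by apply: leq_trans (phi_u j.+2) _; rewrite ltnS.
Qed.

Lemma hang_short v a s : geo v -> (a <= L)%N -> hang v a s ->
  (size s <= a)%N /\ (size s <= L - a)%N.
Proof.
move=> v_geo a_le s_hang.
have [le_ak|lt_ka] := leqP a k.
  have := hang_short_half v a s v_geo le_ak s_hang.
  by move: (size s) => n n_le; split => //; clear - n_le le_ak; lia.
have := hang_short_half (rev_geo v) (L - a)%N s (geodesic_rev T e L e_sym v v_geo).
rewrite hang_rev // => /(_ _ s_hang).
have -> : (L - a <= k)%N by clear - lt_ka; lia.
move=> /(_ isT); move: (size s) => n n_le; split => //; clear - n_le lt_ka; lia.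
Qed.

(** From [v a], the vertex [v b] is a branching at distance [a - b] along the geodesic, so
    [fork_excess] bounds the path at [v a] by that distance. *)
Lemma hang_pair v a b w s0 s : geo v -> (b < a)%N -> (a <= k)%N ->
  hang v b (w :: s0) -> hang v a s -> (size s <= a - b)%N.
Proof.
move=> v_geo lt_ba a_le b_hang a_hang; rewrite leqNgt; apply/negP => lt_s.
have a_leL : (a <= L)%N by clear - a_le; lia.
have b_leL : (b <= L)%N by clear - a_le lt_ba; lia.
case: s a_hang lt_s => // y s a_hang lt_s.
have [ay y_off] : e (v a) y /\ ~~ on v y by case/and3P: a_hang => /= /andP[-> _] _ /andP[->].
have [bw w_off] : e (v b) w /\ ~~ on v w by case/and3P: b_hang => /= /andP[-> _] _ /andP[->].
have a_in := attach_inner v a y v_geo a_leL y_off ay.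
have b_in := attach_inner v b w v_geo b_leL w_off bw.
have [_ _ _ le_lam] := tri_vertex v a y v_geo a_in y_off ay.
have [eb1 eb2 ub _] := tri_vertex v b w v_geo b_in w_off bw.
have {}r_arm : arm lam k * x (v a) <= x (v a.+1).
  by apply: right_arm => //; clear - a_le; lia.
have d_arm := hang_arm v a y s a_leL a_hang.
have [h hE] : exists h, (a - b)%N = h.+1 by exists (a - b).-1; clear - lt_ba; lia.
have h_le : (h.+1 <= a)%N by rewrite -hE leq_subr.
have l_chain := chain_left T e L e_sym v v_geo a h.+1 h_le a_leL.
have ahb : (a - h.+1)%N = b by clear - hE lt_ba; lia.
have ahb1 : (a - h)%N = b.+1 by clear - hE lt_ba; lia.
have := fork_le R T e lam x e_sym x_super lam_ge2 h _ (v b.-1) w l_chain.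
rewrite ahb ahb1 subn0 subn1 => /(_ eb1 bw) f_le.
have {}f_le : fork lam h.+1 * x (v a) <= x (v a.-1).
  apply: f_le; move: ub; rewrite /= !inE !negb_or [v b.+1 == v b.-1]eq_sym.
  by case/and3P=> /andP[-> ->] ->.
have := excess h.+1 (size s).+1 isT; rewrite -hE => /(_ lt_s); rewrite hE.
have a0 := x_gt0 (v a); rewrite -arm_k -(ltr_pM2r a0) !mulrDl; lra.
Qed.

(** * Longest hanging paths exhaust the vertices off the geodesic *)

Definition layout v (c : nat -> seq T) :=
  forall a, hang v a (c a) /\ (forall s, hang v a s -> (size s <= size (c a))%N).

Lemma layout_exists v : exists c, layout v c.
Proof.
suff H a : exists c, hang v a c /\ (forall s, hang v a s -> (size s <= size c)%N).
  by have [c c_spec] := boolp.choice H; exists c.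
pose P m := [exists s : m.-tuple T, hang v a s].
have P_hang s : hang v a s -> P (size s).
  by move=> s_hang; apply/existsP; exists (in_tuple s).
have P_le m : P m -> (m <= #|T|)%N.
  case/existsP=> s /and3P[_ /card_uniqP s_uniq _].
  by rewrite -(size_tuple s) -s_uniq max_card.
have P_ex : exists m, P m by exists 0%N; apply: (P_hang [::]).
case: (ex_maxnP P_ex P_le) => m /existsP[c c_hang] m_max.
by exists c; split=> // s /P_hang /m_max; rewrite size_tuple.
Qed.

Section Layout.
Variables (v : nat -> T) (c : nat -> seq T).
Hypothesis v_geo : geo v.
Hypothesis c_layout : layout v c.

Lemma layout_disjoint a b z : (a <= L)%N -> (b <= L)%N -> z \in c a -> z \in c b -> a = b.
Proof.
move=> a_le b_le za zb.
have := (c_layout a).1; have := (c_layout b).1.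
case: (c a) za => // w s za; case: (c b) zb => // w' s' zb b_hang a_hang.
have [aw w_off] : e (v a) w /\ ~~ on v w by case/and3P: a_hang => /= /andP[-> _] _ /andP[->].
have [bw w'_off] : e (v b) w' /\ ~~ on v w' by case/and3P: b_hang => /= /andP[-> _] _ /andP[->].
apply: (attach v v_geo w w') => //.
apply: connect_trans (hang_connect v a w s z a_hang za) _.
rewrite (sym_connect_sym (off_edge_sym T e L e_sym v)).
exact: hang_connect b_hang zb.
Qed.

Lemma layout_off a z : z \in c a -> ~~ on v z.
Proof. by have [/and3P[_ _ /allP c_off] _] := c_layout a; apply: c_off. Qed.

(** A new neighbour would be a fourth neighbour of some [v a], prolong a longest path, possibly an
    empty one, or branch off inside one. *)
Lemma layout_closed u z : e u z -> ~~ on v z ->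
  (on v u || [exists a : 'I_L.+1, u \in c a]) -> [exists a : 'I_L.+1, z \in c a].
Proof.
move=> uz z_off u_in; apply: contraT => /existsPn z_out; exfalso.
have neq_z i : (i <= L)%N -> v i != z.
  by move=> i_le; apply: contraNneq z_off => <-; apply: on_path_v.
have z_outn a : (a <= L)%N -> z \notin c a.
  by move=> a_le; apply: (z_out (Ordinal (a_le : (a < L.+1)%N))).
case/orP: u_in => [/on_pathP[a a_le uE]|/existsP[[a a_lt] /= u_in]].
  subst u; have a_in := attach_inner v a z v_geo a_le z_off uz.
  have [c_hang c_max] := c_layout a; have z_notin := z_outn a a_le.
  case: (c a) c_hang c_max z_notin => [|w s] c_hang c_max z_notin.
    by have := c_max [:: z]; rewrite /hang /= uz z_off => /(_ isT).
  have [aw w_off] : e (v a) w /\ ~~ on v w by case/and3P: c_hang => /= /andP[-> _] _ /andP[->].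
  have [e1 e2 u3 _] := tri_vertex v a w v_geo a_in w_off aw.
  apply: (no_four v (v a) (v a.-1) (v a.+1) w z v_geo e1 e2 aw uz).
  move: z_notin u3; rewrite /= !inE !negb_or [w == z]eq_sym => /andP[-> _] /and3P[/andP[-> ->] -> _] /=.
  by rewrite !neq_z //; clear - a_in; lia.
have a_le : (a <= L)%N by rewrite -ltnS.
have [c_hang c_max] := c_layout a; have z_notin := z_outn a a_le.
have [c_le1 c_le2] := hang_short v a _ v_geo a_le c_hang.
have z_new : z \notin v a :: c a by rewrite inE negb_or eq_sym neq_z.
move: u_in; rewrite -index_mem; set j := index u (c a) => j_lt.
have uE : u = nth (v a) (v a :: c a) j.+1 by rewrite /= nth_index // -index_mem.
have [/eqP j_last|j_inner] := eqVneq j.+1 (size (c a)).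
  suff /c_max : hang v a (rcons (c a) z) by rewrite size_rcons ltnn.
  case/and3P: c_hang => c_path c_uniq c_off.
  rewrite /hang rcons_path rcons_uniq all_rcons c_path c_uniq c_off z_off z_notin /= andbT.
  by rewrite (last_nth (v a)) -(eqP j_last) -uE.
have j_in : (j.+1 < size (c a))%N by rewrite ltn_neqAle j_inner.
apply: (hang_fork v a (c a) j.+1 z v_geo a_le c_hang _ _ _ _ _ _) => //.
- exact: leq_trans j_in c_le1.
- exact: leq_trans j_in c_le2.
- by rewrite -uE.
- by apply: contraNneq z_new => ->; rewrite mem_nth //= ltnS ltnW.
- by apply: contraNneq z_new => ->; rewrite mem_nth.
Qed.

Lemma layout_cover z : ~~ on v z -> exists2 a, (a <= L)%N & z \in c a.
Proof.
move=> z_off; suff /existsP[[a a_lt] za] : [exists a : 'I_L.+1, z \in c a].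
  by exists a; rewrite // -ltnS.
have [p [p_path p_last _]] := diam (v 0%N) z.
have : on v (v 0%N) || [exists a : 'I_L.+1, v 0%N \in c a] by rewrite on_path_v.
elim: p (v 0%N) p_path p_last => [u _ /= ->|w p IHp u /= /andP[uw w_path] w_last u_in].
  by rewrite (negbTE z_off).
apply: IHp w_path w_last _.
by have [//|w_off] := boolP (on v w); apply: layout_closed uw w_off u_in.
Qed.

Lemma layout_total : (\sum_(a < L.+1) size (c a))%N = k.
Proof.
transitivity #|[pred z | ~~ on v z]|; last first.
  by rewrite (card_off_path T e L v v_geo) T_card; clear; lia.
rewrite -sum1_card.
transitivity (\sum_(a < L.+1) \sum_(z | z \in c a) 1)%N.
  apply: eq_bigr => a _; rewrite sum1_card.
  by have [/and3P[_ /card_uniqP -> _] _] := c_layout a.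
rewrite (exchange_big_dep xpredT) //= [RHS]big_mkcond; apply: eq_bigr => z _ /=.
rewrite inE; have [z_on|z_off] := boolP (on v z).
  rewrite big_pred0 // => a; apply/negP => /layout_off; by rewrite z_on.
have [a a_le za] := layout_cover z z_off.
rewrite (big_pred1 (Ordinal (a_le : (a < L.+1)%N))) // => b.
apply/idP/eqP => [zb|->] //; apply/val_inj/(layout_disjoint b a z) => //.
by rewrite -ltnS.
Qed.

End Layout.

Variable yy : nat -> nat -> R.
Hypothesis yy_profile : profile R k lam yy.
Hypothesis yy_merging : merging R k lam yy.
Hypothesis k_gt0 : (0 < k)%N.

Lemma layout_shape v c : geo v -> layout v c ->
  exists i j, [/\ (0 < j)%N, (i + j)%N = k, (i = 0%N \/ size (c i) = i) &
                  size (c (2 * i + j)%N) = j].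
Proof.
move=> v_geo c_layout; pose m a := size (c a).
have c_hang a := (c_layout a).1.
(* The shift by one makes room for the zeros before the first and after the last vertex of the
   geodesic. *)
pose X n := if n is a.+1 then if (a <= L)%N then x (v a) else 0 else 0.
have total : mass_before m L.+1 = k by exact: (layout_total v c v_geo c_layout).
have edge_r a : (a < L)%N -> e (v a) (v a.+1) by apply: v_geo.1.
have edge_l a : (a < L)%N -> e (v a.+1) (v a) by move=> ?; rewrite e_sym edge_r.
have Xsuper a : (a <= L)%N -> X a + X a.+2 + arm lam (m a) * X a.+1 <= lam * X a.+1.
  move=> a_le; rewrite /X a_le; case mE : (m a) => [|n].
    rewrite mul0r addr0; case: a a_le {mE} => [|a] a_le.
      rewrite add0r; have -> : (0 < L)%N by clear - k_gt0; lia.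
      by apply: (nbr1_le R T e lam x x_super); apply: edge_r; clear - k_gt0; lia.
    rewrite (ltnW a_le); case: ifP => [lt_aL|_].
      apply: (nbr2_le R T e lam x x_super); [exact: edge_l | exact: edge_r |].
      by rewrite (geodesic_eq T e L v v_geo) //; clear - a_le; lia.
    by rewrite addr0; apply: (nbr1_le R T e lam x x_super); apply: edge_l.
  move: mE (c_hang a); rewrite /m; case: (c a) => // w s [nE] s_hang.
  have [aw w_off] : e (v a) w /\ ~~ on v w by case/and3P: s_hang => /= /andP[-> _] _ /andP[->].
  have a_in := attach_inner v a w v_geo a_le w_off aw.
  have [_ _ _ le_lam] := tri_vertex v a w v_geo a_in w_off aw.
  have := hang_arm v a w s a_le s_hang; rewrite nE => d_arm.
  case: a a_le a_in le_lam d_arm {s_hang aw} => // a a_le /andP[_ a_lt] le_lam d_arm.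
  by rewrite (ltnW a_le) a_lt; move: le_lam d_arm; rewrite succnK; lra.
have m_le b : (b <= k)%N -> (m b <= b)%N.
  by move=> b_le; apply: hang_short_half v_geo b_le (c_hang b).
have m_pair b d : (b < d)%N -> (d <= k)%N -> (0 < m b)%N -> (m d <= d - b)%N.
  move=> lt_bd d_le mb; have := c_hang b; move: mb; rewrite /m; case: (c b) => // w s _ b_hang.
  exact: hang_pair v_geo lt_bd d_le b_hang (c_hang d).
pose m' b := m (L - b)%N.
have rv_geo := geodesic_rev T e L e_sym v v_geo.
have c'_hang b : (b <= L)%N -> hang (rev_geo v) b (c (L - b)%N).
  by move=> b_le; rewrite -{1}(subKn b_le) hang_rev // leq_subr.
have m'_le b : (b <= k)%N -> (m' b <= b)%N.
  move=> b_le; have b_leL : (b <= L)%N by clear - b_le; lia.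
  exact: hang_short_half rv_geo b_le (c'_hang b b_leL).
have m'_pair b d : (b < d)%N -> (d <= k)%N -> (0 < m' b)%N -> (m' d <= d - b)%N.
  move=> lt_bd d_le mb.
  have b_leL : (b <= L)%N by clear - lt_bd d_le; lia.
  have d_leL : (d <= L)%N by clear - d_le; lia.
  have := c'_hang b b_leL; move: mb; rewrite /m' /m; case: (c (L - b)%N) => // w s _ b_hang.
  exact: hang_pair rv_geo lt_bd d_le b_hang (c'_hang d d_leL).
have m_left a : (a <= L)%N -> (mass_before m a.+1 <= a)%N.
  move=> a_le; have [le_ak|lt_ka] := leqP a k; first exact: (mass_before_le m k).
  apply: leq_trans (ltnW lt_ka); rewrite -[X in (_ <= X)%N]total.
  exact: mass_before_mono.
have m_right a : (a <= L)%N -> (a <= k + mass_before m a)%N.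
  move=> a_le; have := mass_before_rev m L a a_le; rewrite total -/m'.
  have [le_k|lt_k] := leqP (L - a)%N k; last by clear - lt_k; lia.
  by have := mass_before_le m' k (L - a) m'_le m'_pair le_k; clear - a_le; lia.
apply: (sweep_shape R k lam yy yy_profile yy_merging X m _ _ _ Xsuper total m_left m_right k_gt0) => //.
  by rewrite /X ltnn.
by case=> // a /= a_le; rewrite /X -ltnS a_le.
Qed.

Lemma quipu_layout : has_diameter e L ->
  exists (v : nat -> T) i j s1 s2,
    [/\ geo v, (i <= j)%N, (0 < j)%N & (i + j)%N = k] /\
    [/\ hang v i s1, hang v (2 * i + j)%N s2, size s1 = i, size s2 = j & uniq (s1 ++ s2)].
Proof.
case/(geodesic_exists T e L) => v v_geo.
have [c c_layout] := layout_exists v.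
have [i [j [j_gt0 ijk i_alt jE]]] := layout_shape v c v_geo c_layout.
have i_le : (i <= L)%N by clear - ijk; lia.
have ij_le : (2 * i + j <= L)%N by clear - ijk; lia.
pose s1 := if i == 0%N then [::] else c i.
have s1_size : size s1 = i by rewrite /s1; case: i_alt => [->|iE] //; case: eqP => [->|].
have s1_hang : hang v i s1.
  by rewrite /s1; case: eqP => // _; apply: (c_layout i).1.
have s2_hang := (c_layout (2 * i + j)%N).1.
have disj z : z \in s1 -> z \in c (2 * i + j)%N -> False.
  rewrite /s1; case: eqP => // _ z1 z2.
  by have := layout_disjoint v c v_geo c_layout i _ z i_le ij_le z1 z2; clear - j_gt0; lia.
have s1_uniq : uniq s1 by case/and3P: s1_hang.
have s2_uniq : uniq (c (2 * i + j)%N) by case/and3P: s2_hang.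
have [le_ij|lt_ji] := leqP i j.
  exists v, i, j, s1, (c (2 * i + j)%N); split => //; split => //.
  rewrite cat_uniq s1_uniq s2_uniq andbT /=; apply/hasPn => z z2; apply/negP => z1.
  exact: disj z1 z2.
(* Reversal takes the attachment positions [2 * i + j] and [i] to [j] and [2 * j + i]. *)
exists (rev_geo v), j, i, (c (2 * i + j)%N), s1; split.
  split; [exact: geodesic_rev | exact: ltnW | exact: leq_trans lt_ji | by rewrite addnC].
split => //.
- have -> : j = (L - (2 * i + j))%N by clear - ijk; lia.
  rewrite hang_rev //; have -> : (2 * i + (L - (2 * i + j)) = 2 * i + j)%N by clear - ijk; lia.
  by [].
- have -> : (2 * j + i)%N = (L - i)%N by clear - ijk; lia.
  by rewrite hang_rev.
rewrite cat_uniq s1_uniq s2_uniq andbT /=; apply/hasPn => z z1; apply/negP => z2.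
exact: disj z1 z2.
Qed.

End Structure.

(** * The quipus *)

Section Quipu.
Variables (k i j : nat).
Hypothesis le_ij : (i <= j)%N.
Hypothesis ijk : (i + j)%N = k.
Hypothesis k_gt0 : (0 < k)%N.
Local Notation N := (3 * k).+1.
Local Notation par := (quipu_par k i j).
Local Notation Q := (quipu k i j).

Lemma quipu_par_main n : (0 < n <= 2 * k)%N -> par n = n.-1.
Proof. by rewrite /quipu_par => /andP[n_gt0 ->]; case: n n_gt0. Qed.

Lemma quipu_par_first1 : (0 < i)%N -> par (2 * k).+1 = i.
Proof. by rewrite /quipu_par => i_gt0; do !case: ifP; lia. Qed.

Lemma quipu_par_first2 : par (2 * k + i).+1 = (2 * i + j)%N.
Proof. by rewrite /quipu_par; do !case: ifP; lia. Qed.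

Lemma quipu_par_pendent n : (2 * k + 1 < n)%N -> n <> (2 * k + i).+1 -> par n = n.-1.
Proof. by rewrite /quipu_par; do !case: ifP; lia. Qed.

Lemma quipu_parP n : (0 < n <= 3 * k)%N ->
  [\/ (n <= 2 * k)%N /\ par n = n.-1, [/\ n = (2 * k).+1, (0 < i)%N & par n = i],
      n = (2 * k + i).+1 /\ par n = (2 * i + j)%N |
      [/\ (2 * k + 1 < n)%N, n <> (2 * k + i).+1 & par n = n.-1]].
Proof.
move=> /andP[n_gt0 n_le]; have [le1|gt1] := leqP n (2 * k).
  by constructor 1; rewrite quipu_par_main ?n_gt0.
have [->|neq] := eqVneq n (2 * k + i).+1; first by constructor 3; rewrite quipu_par_first2.
have [nE|neq'] := eqVneq n (2 * k).+1.
  have i_gt0 : (0 < i)%N by lia.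
  by constructor 2; rewrite nE quipu_par_first1.
by constructor 4; rewrite quipu_par_pendent; [split=> //; lia| lia | lia].
Qed.

Lemma quipu_par_lt n : (0 < n <= 3 * k)%N -> (par n < n)%N.
Proof. by move=> n_in; case: (quipu_parP n n_in) => [[]|[]|[]|[]] *; lia. Qed.

Lemma quipu_simple : simple_graph Q.
Proof.
split=> [x y|x]; first by rewrite /quipu orbC.
rewrite /quipu orbb; apply/negP => /andP[x_neq0 /eqP xE].
have := quipu_par_lt x; rewrite lt0n x_neq0 -ltnS ltn_ord => /(_ isT).
by rewrite -xE ltnn.
Qed.

Lemma quipu_edge (x y : 'I_N) : (0 < x)%N -> val y = par x -> Q x y.
Proof. by rewrite /quipu lt0n => -> ->; rewrite eqxx. Qed.

Lemma quipu_edgeP (x y : 'I_N) : Q x y ->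
  ((0 < x)%N /\ val y = par x) \/ ((0 < y)%N /\ val x = par y).
Proof. by rewrite /quipu -!lt0n => /orP[]/andP[-> /eqP ->]; [left | right]. Qed.

(** * The diameter of the quipu *)

(** Distance to vertex [k] of the main path, which lies between the branch vertices [i] and
    [2 * i + j = k + i]; every path end is at distance exactly [k] from it. *)
Definition center_dist (n : nat) : nat :=
  if (n <= 2 * k)%N then (n - k + (k - n))%N
  else if (n <= 2 * k + i)%N then (n - 2 * k + (k - i))%N
  else (n - 2 * k - i + i)%N.

Lemma center_dist_le (x : 'I_N) : (center_dist x <= k)%N.
Proof. by have := ltn_ord x; rewrite /center_dist; do !case: ifP; lia. Qed.

Lemma center_dist_step (x : 'I_N) d : center_dist x = d.+1 ->
  exists2 y : 'I_N, Q x y & center_dist y = d.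
Proof.
move=> xd; have x_lt := ltn_ord x; have [x_ltk|x_gek] := ltnP x k.
  have y_lt : (x.+1 < N)%N by lia.
  exists (Ordinal y_lt).
    rewrite (proj1 quipu_simple); apply: quipu_edge => //=.
    by rewrite quipu_par_main //; lia.
  by move: xd; rewrite /center_dist /=; do !case: ifP; lia.
have x_in : (0 < x <= 3 * k)%N by lia.
have y_lt : (par x < N)%N by have := quipu_par_lt x x_in; lia.
exists (Ordinal y_lt); first by apply: quipu_edge => //; lia.
rewrite /=; move: xd; rewrite /center_dist.
by case: (quipu_parP x x_in) => [[? ->]|[? ? ->]|[? ->]|[? ? ->]]; do !case: ifP; lia.
Qed.

Lemma center_walk (x : 'I_N) (c : 'I_N) : val c = k ->
  exists p, [/\ path Q x p, last x p = c & (size p <= k)%N].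
Proof.
move=> cE; suff [p [p_path p_last p_size]] : exists p, [/\ path Q x p, last x p = c &
    size p = center_dist x].
  by exists p; rewrite p_size center_dist_le.
move: {2}(center_dist x) (erefl (center_dist x)) => d; elim: d x => [|d IHd] x xd.
  exists [::]; rewrite xd; split => //=; apply: val_inj; rewrite cE /=.
  by have := ltn_ord x; move: xd; rewrite /center_dist; do !case: ifP; lia.
have [y xy yd] := center_dist_step x d xd.
have [p [p_path p_last p_size]] := IHd y yd.
by exists (y :: p); rewrite /= xy p_path p_last p_size yd xd.
Qed.

(** Folding each pendent path onto its attachment vertex lengthens no step, so vertices [0] and
    [2 * k] keep their distance. *)
Definition main_pos (n : nat) : nat :=
  if (n <= 2 * k)%N then n else if (n <= 2 * k + i)%N then i else (2 * i + j)%N.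

Lemma main_pos_lip (x y : 'I_N) : Q x y -> (main_pos y <= (main_pos x).+1)%N.
Proof.
have par_lip (n : nat) : (0 < n <= 3 * k)%N ->
    ((main_pos (par n) <= (main_pos n).+1) && (main_pos n <= (main_pos (par n)).+1))%N.
  move=> n_in; rewrite /main_pos.
  by case: (quipu_parP n n_in) => [[? ->]|[? ? ->]|[? ->]|[? ? ->]]; do !case: ifP; lia.
have x_lt := ltn_ord x; have y_lt := ltn_ord y.
case/quipu_edgeP=> -[gt0 E].
  by have := par_lip x; rewrite gt0 -ltnS x_lt -E => /(_ isT) /andP[].
by have := par_lip y; rewrite gt0 -ltnS y_lt -E => /(_ isT) /andP[].
Qed.

Lemma quipu_diameter : has_diameter Q (2 * k).
Proof.
have k_lt : (k < N)%N by lia.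
pose c := Ordinal k_lt; split.
  move=> x y; have [p [p_path p_last p_size]] := center_walk x c erefl.
  have [q [q_path q_last q_size]] := center_walk y c erefl.
  have [r [r_path r_last r_size]] := rev_walk _ _ _ _ (proj1 quipu_simple) q_path.
  exists (p ++ r); rewrite cat_path last_cat p_path p_last -q_last r_path r_last size_cat r_size.
  by split=> //; rewrite mul2n -addnn leq_add.
have L_lt : (2 * k < N)%N by lia.
exists ord0, (Ordinal L_lt) => p p_path p_last.
suff H (x : 'I_N) : path Q x p -> (main_pos (last x p) <= main_pos x + size p)%N.
  by have := H ord0 p_path; rewrite p_last /main_pos /= leqnn.
elim: p x {p_path p_last} => [|y p IHp] x /=; first by rewrite addn0.
by case/andP=> /main_pos_lip xy /IHp /leq_trans -> //; rewrite addnS -addSn leq_add2r.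
Qed.

Lemma quipu_connected : connected_graph Q.
Proof.
move=> x y; have [p [p_path p_last _]] := (proj1 quipu_diameter) x y.
by apply/connectP; exists p.
Qed.

Lemma par_eq_nbr (n z : nat) : (0 < z <= 3 * k)%N -> (n == par z) =
  [|| ((n < 2 * k)%N || (2 * k < n < 3 * k)%N && (n != 2 * k + i)%N) && (z == n.+1),
      (0 < i)%N && (n == i) && (z == (2 * k).+1) |
      (n == (2 * i + j)%N) && (z == (2 * k + i).+1)].
Proof.
move=> z_in; case: (quipu_parP z z_in) => [[z_le ->]|[zE i_gt0 ->]|[zE ->]|[z_gt z_neq ->]];
  apply/eqP/or3P.
- move=> nE; constructor 1; apply/andP; split; last by apply/eqP; lia.
  by apply/orP; left; lia.
- by case=> /andP[_ /eqP]; lia.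
- by move=> ->; constructor 2; rewrite i_gt0 eqxx zE eqxx.
- case=> /andP[].
  + by case/orP => [|/andP[]] ? /eqP; lia.
  + by case/andP=> _ /eqP.
  + by move=> _ /eqP; lia.
- by move=> ->; constructor 3; rewrite eqxx zE eqxx.
- case=> /andP[].
  + by case/orP => [|/andP[]] ?; [|move/eqP=> ?] => /eqP; lia.
  + by case/andP=> ? _ /eqP; lia.
  + by move=> /eqP.
- move=> nE; constructor 1; apply/andP; split; last by apply/eqP; lia.
  by apply/orP; right; apply/andP; split; [lia | apply/eqP; lia].
- by case=> /andP[_ /eqP]; lia.
Qed.

Section Eigenvector.
Variables (R : realType) (lam : R) (yy : nat -> nat -> R).
Hypothesis yy_profile : profile R k lam yy.
Local Notation S := (yy 0%N).

(** The bare-path solution [S] from each free end and the profile of [mu = i] between the branch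
    vertices. They agree at [i] by [profile_match], and at [2 * i + j] after a reflection. *)
Definition quipu_vec (n : nat) : R :=
  if (n <= i)%N then S n.+1 else if (n <= 2 * i + j)%N then yy i n.+1
  else if (n <= 2 * k)%N then S ((2 * k).+1 - n)
  else if (n <= 2 * k + i)%N then S ((2 * k + i).+1 - n)
  else S ((3 * k).+1 - n).
Local Notation V := quipu_vec.

Lemma quipu_vec_gt0 (n : nat) : (n <= 3 * k)%N -> 0 < V n.
Proof.
move=> n_le; rewrite /quipu_vec.
by do !case: ifP => ?; apply: (profile_gt0 _ _ _ _ yy_profile); lia.
Qed.

Lemma arm_rec n : (n <= 2 * k)%N -> S n + S n.+2 = lam * S n.+1.
Proof. exact: (profile_rec _ _ _ _ yy_profile). Qed.

Lemma quipu_vec_left n : (n <= i)%N -> V n = S n.+1.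
Proof. by rewrite /quipu_vec => ->. Qed.

Lemma quipu_vec_mid n : (i <= n <= 2 * i + j)%N -> V n = yy i n.+1.
Proof.
move=> /andP[in_le n_le]; rewrite /quipu_vec n_le; case: ifP => // n_le'.
have -> : n = i by lia.
by rewrite (profile_match _ _ _ _ yy_profile) //; lia.
Qed.

Lemma quipu_vec_right n : (2 * i + j <= n <= 2 * k)%N -> V n = S ((2 * k).+1 - n).
Proof.
move=> /andP[n_ge n_le]; have [nE|n_neq] := eqVneq n (2 * i + j)%N.
  rewrite quipu_vec_mid; last by lia.
  rewrite (profile_refl _ _ _ _ yy_profile); try lia.
  have -> : (k - i)%N = j by lia.
  have -> : ((2 * k).+2 - n.+1)%N = j.+1 by lia.
  have -> : ((2 * k).+1 - n)%N = j.+1 by lia.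
  by rewrite (profile_match _ _ _ _ yy_profile) //; lia.
by rewrite /quipu_vec; do !case: ifP => //; lia.
Qed.

Lemma quipu_vec_pend1 n : (2 * k < n <= 2 * k + i)%N -> V n = S ((2 * k + i).+1 - n).
Proof. by move=> n_in; rewrite /quipu_vec; do !case: ifP => //; lia. Qed.

Lemma quipu_vec_pend2 n : (2 * k + i < n)%N -> V n = S ((3 * k).+1 - n).
Proof. by move=> n_in; rewrite /quipu_vec; do !case: ifP => //; lia. Qed.

Definition quipu_nbrs (n : nat) : seq nat :=
  (if (0 < n)%N then [:: par n] else [::]) ++
  (if (n < 2 * k)%N || (2 * k < n < 3 * k)%N && (n != 2 * k + i)%N then [:: n.+1] else [::]) ++
  (if (0 < i)%N && (n == i) then [:: (2 * k).+1] else [::]) ++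
  (if n == (2 * i + j)%N then [:: (2 * k + i).+1] else [::]).

Lemma mem_quipu_nbrs (x z : 'I_N) : Q x z = (val z \in quipu_nbrs x).
Proof.
have x_lt := ltn_ord x; have z_lt := ltn_ord z.
have memE : (val z \in quipu_nbrs x) =
   [|| (0 < x)%N && (val z == par x),
       ((x < 2 * k)%N || (2 * k < x < 3 * k)%N && (val x != 2 * k + i)%N) && (val z == x.+1),
       (0 < i)%N && (val x == i) && (val z == (2 * k).+1) |
       (val x == (2 * i + j)%N) && (val z == (2 * k + i).+1)].
  by rewrite /quipu_nbrs !mem_cat; do !case: ifP => _; rewrite ?inE.
rewrite memE /quipu -!lt0n; congr (_ || _); rewrite -![val _]/(nat_of_ord _).
have [z0|z_gt0] := posnP z; first by rewrite z0 /= !andbF.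
by rewrite par_eq_nbr // z_gt0 -ltnS.
Qed.

Lemma sum_quipu_nbrs (x : 'I_N) :
  \sum_(z | Q x z) V z = \sum_(n <- quipu_nbrs x) V n.
Proof.
have x_lt := ltn_ord x.
have nb_lt n : n \in quipu_nbrs x -> (n < N)%N.
  rewrite /quipu_nbrs !mem_cat; case: (posnP x) => [x0|x_gt0].
    by do !case: ifP => ?; rewrite ?inE; lia.
  have := quipu_par_lt x; rewrite x_gt0 -ltnS x_lt => /(_ isT) p_lt.
  by do !case: ifP => ?; rewrite ?inE; lia.
have nb_uniq : uniq (quipu_nbrs x).
  rewrite /quipu_nbrs; case: (posnP x) => [x0|x_gt0].
    by do !case: ifP => ? //=; rewrite ?inE; lia.
  have := quipu_par_lt x; rewrite x_gt0 -ltnS x_lt => /(_ isT) p_lt.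
  by do !case: ifP => ? //=; rewrite ?inE; lia.
transitivity (\sum_(z < N | val z \in quipu_nbrs x) V z).
  by apply: eq_bigl => z; rewrite mem_quipu_nbrs.
rewrite -(big_mkord (fun n => n \in quipu_nbrs x) V).
rewrite -big_filter; apply: perm_big; apply: uniq_perm => //.
  by rewrite filter_uniq // iota_uniq.
move=> n; rewrite mem_filter mem_index_iota /=.
by apply/andb_idr => /nb_lt.
Qed.

Lemma quipu_nbrs_sum (n : nat) : \sum_(m <- quipu_nbrs n) V m =
  (if (0 < n)%N then V (par n) else 0) +
  (if (n < 2 * k)%N || (2 * k < n < 3 * k)%N && (n != 2 * k + i)%N then V n.+1 else 0) +
  (if (0 < i)%N && (n == i) then V (2 * k).+1 else 0) +
  (if n == (2 * i + j)%N then V (2 * k + i).+1 else 0).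
Proof.
rewrite /quipu_nbrs !big_cat /= !addrA.
by do !case: ifP => _; rewrite ?big_nil ?big_seq1.
Qed.

Lemma quipu_vec_eigen (x : 'I_N) : \sum_(z | Q x z) V z = lam * V x.
Proof.
have S0 : S 0%N = 0 := profile_start _ _ _ _ yy_profile.
have Srec := arm_rec; have yrec := profile_rec _ _ _ _ yy_profile.
have jump := profile_jump _ _ _ _ yy_profile; have refl := profile_refl _ _ _ _ yy_profile.
rewrite sum_quipu_nbrs; have := ltn_ord x; move: (nat_of_ord x) => n n_lt.
rewrite quipu_nbrs_sum.
have [n_lti|n_gei] := ltnP n i.
  have -> : (n < 2 * k)%N by lia.
  rewrite (_ : (0 < i)%N && (n == i) = false); last by lia.
  rewrite (_ : (n == (2 * i + j)%N) = false); last by lia.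
  rewrite orTb !addr0 (quipu_vec_left n.+1); last by lia.
  rewrite (quipu_vec_left n); last by lia.
  case: n n_lt n_lti => [|n] n_lt n_lti /=.
    by rewrite add0r -Srec // S0 add0r.
  rewrite quipu_par_main; last by lia.
  rewrite quipu_vec_left; last by lia.
  by rewrite Srec //; lia.
have [nE|n_neqi] := eqVneq n i.
  have -> : (n < 2 * k)%N by lia.
  rewrite (_ : (n == (2 * i + j)%N) = false); last by lia.
  rewrite orTb addr0 nE andbT (quipu_vec_left i) // (quipu_vec_mid i.+1); last by lia.
  (* The jump removes [S i], exactly the value at the first vertex of the pendent path, so the
     recurrence of [S] remains. *)
  rewrite jump; last by lia.
  case: ifP => i_gt0; last first.
    have i0 : i = 0%N by lia.
    by rewrite i0 S0 add0r addr0 subr0 -Srec // S0 add0r.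
  rewrite quipu_par_main; last by lia.
  rewrite quipu_vec_left; last by lia.
  rewrite quipu_vec_pend1; last by lia.
  rewrite prednK // subSS addKn -Srec; last by lia.
  by ring.
have n_gt0 : (0 < n)%N by lia.
rewrite n_gt0 andbF addr0.
have [n_lt1|n_ge1] := ltnP n (2 * i + j).
  have -> : (n < 2 * k)%N by lia.
  rewrite (_ : (n == (2 * i + j)%N) = false); last by lia.
  rewrite orTb addr0 quipu_par_main; last by lia.
  rewrite (quipu_vec_mid n.-1); last by lia.
  rewrite (quipu_vec_mid n.+1); last by lia.
  rewrite (quipu_vec_mid n); last by lia.
  by rewrite prednK // yrec //; lia.
have [nE|n_neq1] := eqVneq n (2 * i + j)%N.
  have -> : (n < 2 * k)%N by lia.
  rewrite orTb quipu_par_main; last by lia.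
  rewrite (quipu_vec_mid n.-1); last by lia.
  rewrite (quipu_vec_right n.+1); last by lia.
  rewrite (quipu_vec_right n); last by lia.
  rewrite quipu_vec_pend2; last by lia.
  (* Reflection turns the second branch vertex into the first one of the quipu with [i] and [j]
     exchanged. *)
  rewrite prednK // (refl i n); try lia.
  have -> : (k - i)%N = j by lia.
  have -> : ((2 * k).+2 - n)%N = j.+2 by lia.
  have -> : ((2 * k).+1 - n.+1)%N = j by lia.
  have -> : ((2 * k).+1 - n)%N = j.+1 by lia.
  have -> : ((3 * k).+1 - (2 * k + i).+1)%N = j by lia.
  rewrite jump; last by lia.
  rewrite -Srec; last by lia.
  by ring.
rewrite addr0.
have [n_le2|n_gt2] := leqP n (2 * k).
  rewrite quipu_par_main; last by lia.
  rewrite (quipu_vec_right n.-1); last by lia.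
  rewrite (quipu_vec_right n); last by lia.
  have [d dE] : exists d, n = (2 * k - d)%N /\ (d <= 2 * k)%N by exists (2 * k - n)%N; lia.
  have -> : ((2 * k).+1 - n.-1)%N = d.+2 by lia.
  have -> : ((2 * k).+1 - n)%N = d.+1 by lia.
  rewrite -Srec; last by lia.
  case: ifP => [n_lt2|n_ge2].
    rewrite quipu_vec_right; last by lia.
    have -> : ((2 * k).+1 - n.+1)%N = d by lia.
    by rewrite addrC.
  have -> : d = 0%N by lia.
  by rewrite S0 addrC.
rewrite ltnNge (ltnW n_gt2) /=.
have n_in : (0 < n <= 3 * k)%N by lia.
have [n_le3|n_gt3] := leqP n (2 * k + i).
  have [d dE] : exists d, (n + d = 2 * k + i)%N by exists (2 * k + i - n)%N; lia.
  rewrite (quipu_vec_pend1 n); last by lia.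
  have -> : ((2 * k + i).+1 - n)%N = d.+1 by lia.
  have -> : V (par n) = S d.+2.
    case: (quipu_parP n n_in) => [[? _]|[nE ? ->]|[? _]|[? ? ->]]; [lia| |lia|].
      by rewrite quipu_vec_left //; congr S; lia.
    by rewrite quipu_vec_pend1; [congr S; lia | lia].
  rewrite -Srec; last by lia.
  case: ifP => n_lt3.
    rewrite quipu_vec_pend1; last by lia.
    have -> : ((2 * k + i).+1 - n.+1)%N = d by lia.
    by rewrite addrC.
  have -> : d = 0%N by lia.
  by rewrite S0 addrC.
have [d dE] : exists d, (n + d = 3 * k)%N by exists (3 * k - n)%N; lia.
rewrite (quipu_vec_pend2 n); last by lia.
have -> : ((3 * k).+1 - n)%N = d.+1 by lia.
have -> : V (par n) = S d.+2.
  case: (quipu_parP n n_in) => [[? _]|[? ? _]|[? ->]|[? ? ->]]; [lia|lia| |].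
    by rewrite quipu_vec_right; [congr S; lia | lia].
  by rewrite quipu_vec_pend2; [congr S; lia | lia].
rewrite -Srec; last by lia.
case: ifP => n_lt3.
  rewrite quipu_vec_pend2; last by lia.
  have -> : ((3 * k).+1 - n.+1)%N = d by lia.
  by rewrite addrC.
have -> : d = 0%N by lia.
by rewrite S0 addrC.
Qed.

End Eigenvector.

End Quipu.

(** * Classification *)

Lemma quipu_embedding (T : finType) (e : rel T) (k i j : nat) v s1 s2 :
  symmetric e -> (0 < k)%N -> (i <= j)%N -> (i + j)%N = k -> geodesic T e v (2 * k) ->
  hang T e k v i s1 -> hang T e k v (2 * i + j)%N s2 ->
  size s1 = i -> size s2 = j -> uniq (s1 ++ s2) ->
  exists g : 'I_(3 * k).+1 -> T, injective g /\
    forall u w, quipu k i j u w -> e (g u) (g w).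
Proof.
move=> e_sym k_gt0 le_ij ijk v_geo /and3P[p1 _ off1] /and3P[p2 _ off2] z1 z2 u12.
(* The concatenation follows the vertex numbering of [quipu]: main path, first pendent path, second
   pendent path. *)
pose al := [seq v n | n <- iota 0 (2 * k).+1] ++ s1 ++ s2.
have al_size : size al = (3 * k).+1.
  by rewrite !size_cat size_map size_iota z1 z2; clear - ijk; lia.
have al_uniq : uniq al.
  rewrite cat_uniq u12 andbT; apply/andP; split.
    rewrite map_inj_in_uniq ?iota_uniq // => a b; rewrite !mem_iota /= !add0n !ltnS.
    exact: (geodesic_inj T e _ v v_geo).
  apply/hasPn => c; rewrite mem_cat; case/orP.
    exact: (allP off1).
  exact: (allP off2).
pose gn n := nth (v 0%N) al n.
have gv n : (n <= 2 * k)%N -> gn n = v n.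
  move=> n_le; rewrite /gn nth_cat size_map size_iota ltnS n_le.
  by rewrite (nth_map 0%N) ?size_iota // nth_iota.
have g1 l : (l < i)%N -> gn ((2 * k).+1 + l)%N = nth (v 0%N) s1 l.
  move=> l_lt; rewrite /gn nth_cat size_map size_iota ltnNge leq_addr addKn /=.
  by rewrite nth_cat z1 l_lt.
have g2 l : gn ((2 * k).+1 + (i + l))%N = nth (v 0%N) s2 l.
  rewrite /gn nth_cat size_map size_iota ltnNge leq_addr addKn /=.
  by rewrite nth_cat z1 ltnNge leq_addr addKn.
have edge1 l : (l < i)%N -> e (nth (v 0%N) (v i :: s1) l) (nth (v 0%N) s1 l).
  by move=> l_lt; move/(pathP (v 0%N)): p1; apply; rewrite z1.
have edge2 l : (l < j)%N -> e (nth (v 0%N) (v (2 * i + j)%N :: s2) l) (nth (v 0%N) s2 l).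
  by move=> l_lt; move/(pathP (v 0%N)): p2; apply; rewrite z2.
have par_edge n : (0 < n <= 3 * k)%N -> e (gn n) (gn (quipu_par k i j n)).
  move=> n_in; rewrite e_sym.
  case: (quipu_parP k i j le_ij ijk k_gt0 n n_in) => [[n_le ->]|[nE i_gt0 ->]|[nE ->]|[n_gt n_neq ->]].
  - rewrite !gv //; last by clear - n_le; lia.
    by have := v_geo.1 n.-1; rewrite prednK; [apply; lia | lia].
  - rewrite gv; last by lia.
    by have := g1 0%N i_gt0; rewrite addn0 nE => ->; apply: (edge1 0%N).
  - rewrite gv; last by lia.
    have -> : n = ((2 * k).+1 + (i + 0))%N by lia.
    by rewrite g2; apply: (edge2 0%N); lia.
  have [n_le|n_gt'] := leqP n (2 * k + i).
    have [l lE] : exists l, n = ((2 * k).+1 + l.+1)%N by exists (n - (2 * k + 2))%N; lia.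
    have -> : n.-1 = ((2 * k).+1 + l)%N by lia.
    rewrite lE !g1; [|lia|lia].
    by apply: (edge1 l.+1); lia.
  have [l lE] : exists l, n = ((2 * k).+1 + (i + l.+1))%N by exists (n - (2 * k + i + 2))%N; lia.
  have -> : n.-1 = ((2 * k).+1 + (i + l))%N by lia.
  by rewrite lE !g2; apply: (edge2 l.+1); lia.
exists (fun u => gn u); split.
  move=> u w /eqP; rewrite /gn nth_uniq ?al_size ?ltn_ord // => /eqP.
  exact: val_inj.
move=> u w /quipu_edgeP[[u_gt0 wE]|[w_gt0 uE]].
  by rewrite [val w]wE; apply: par_edge; rewrite u_gt0 -ltnS ltn_ord.
by rewrite e_sym [val u]uE; apply: par_edge; rewrite w_gt0 -ltnS ltn_ord.
Qed.

(* Pairing the supersolution of [e] with the eigenvector of [q] leaves no room for an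
   edge of [e] outside the image of [q]. *)
Lemma spanning_subgraph_eq (R : realType) (T : finType) (e q : rel T) (lam : R)
    (x y : T -> R) (g : T -> T) :
  symmetric q -> supersolution R T e lam x -> (forall u, 0 < y u) ->
  (forall u, \sum_(w | q u w) y w = lam * y u) ->
  injective g -> (forall u w, q u w -> e (g u) (g w)) ->
  forall u w, e (g u) (g w) = q u w.
Proof.
move=> q_sym [x_gt0 x_super] y_gt0 y_eig g_inj g_hom u w.
pose F a b : R := ((e (g a) (g b))%:R - (q a b)%:R) * (y a * x (g b)).
have F_ge0 a b : 0 <= F a b.
  rewrite mulr_ge0 //; last by rewrite mulr_ge0 // ltW.
  rewrite subr_ge0 ler_nat; case qab : (q a b) => //.
  by rewrite g_hom.
(* The sum pairs [y] with the [e]-neighbour sums of [x], at most [lam] times [x], and subtracts the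
   pairing of [x] with the [q]-neighbour sums of [y], exactly [lam] times [y]. *)
have sum_le0 : \sum_a \sum_b F a b <= 0.
  have -> : \sum_a \sum_b F a b = \sum_a (y a * \sum_(b | e (g a) (g b)) x (g b))
      - \sum_b (x (g b) * \sum_(a | q b a) y a).
    have -> : \sum_b (x (g b) * \sum_(a | q b a) y a) = \sum_a \sum_b (q a b)%:R * (y a * x (g b)).
      rewrite exchange_big /=; apply: eq_bigr => b _; rewrite mulr_sumr big_mkcond /=.
      by apply: eq_bigr => a _; rewrite q_sym; case: (q a b); rewrite ?mul1r ?mul0r // mulrC.
    rewrite -sumrB; apply: eq_bigr => a _; rewrite mulr_sumr [X in X - _]big_mkcond -sumrB.
    by apply: eq_bigr => b _; rewrite /F; case: (e _ _); rewrite ?mulrBl ?mul1r ?mul0r ?sub0r.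
  rewrite subr_le0; apply: ler_sum => a _; rewrite y_eig.
  have [g' gK g'K] := injF_bij g_inj.
  have -> : x (g a) * (lam * y a) = y a * (lam * x (g a)) by ring.
  rewrite ler_pM2l //; apply: le_trans (x_super (g a)).
  by rewrite [leRHS](reindex g) //; apply: onW_bij; exists g'.
have F0 : F u w = 0.
  apply/le_anti; rewrite F_ge0 andbT; apply: le_trans sum_le0.
  rewrite (bigD1 u) //= (bigD1 w) //= -addrA lerDl addr_ge0 //; first exact: sumr_ge0.
  by apply: sumr_ge0 => a _; apply: sumr_ge0.
move/eqP: F0; rewrite !mulf_eq0 (gt_eqF (y_gt0 u)) (gt_eqF (x_gt0 (g w))) !orbF.
by rewrite subr_eq0 eqr_nat; case: (e _ _); case: (q u w).
Qed.

Lemma embedding_iso (R : realType) (n : nat) (e q : rel 'I_n) (lam : R) x y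
    (g : 'I_n -> 'I_n) :
  symmetric q -> supersolution R 'I_n e lam x -> (forall u, 0 < y u) ->
  (forall u, \sum_(w | q u w) y w = lam * y u) ->
  injective g -> (forall u w, q u w -> e (g u) (g w)) -> graph_iso e q.
Proof.
move=> q_sym x_super y_gt0 y_eig g_inj g_hom.
have [g' gK g'K] := injF_bij g_inj; exists g'; split; first by exists g.
move=> u w; rewrite -{1}(g'K u) -{1}(g'K w).
exact: (spanning_subgraph_eq R _ e q lam x y g).
Qed.

(** If the fourth vertex missed the middle of the geodesic, diameter 2 would join it to both ends,
    and adding the four inequalities around this 4-cycle would give [2 <= sqrt 3]. *)
Lemma claw_embedding (R : realType) (e : rel 'I_4) (x : 'I_4 -> R) :
  simple_graph e -> has_diameter e (2 * 1) -> supersolution R 'I_4 e (Num.sqrt 3) x ->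
  exists g : 'I_4 -> 'I_4, injective g /\ forall u w, quipu 1 0 1 u w -> e (g u) (g w).
Proof.
move=> [e_sym e_irr] e_diam x_super.
have [v v_geo] := geodesic_exists 'I_4 e (2 * 1) e_diam.
have off_card := card_off_path 'I_4 e (2 * 1) v v_geo; rewrite card_ord in off_card.
have /card_gt0P[w w_off] : (0 < #|[pred u | ~~ on_path 'I_4 (2 * 1) v u]|)%N by rewrite off_card.
have w_uniq z : ~~ on_path 'I_4 (2 * 1) v z -> z = w.
  have /card_le1_eqP H : (#|[pred u | ~~ on_path 'I_4 (2 * 1) v u]| <= 1)%N by rewrite off_card.
  by move=> z_off; apply: H.
rewrite inE in w_off.
suff vw : e (v 1%N) w.
  apply: (quipu_embedding 'I_4 e 1 0 1 v [::] [:: w]) => //.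
  by rewrite /hang /= vw w_off.
apply: contraT => vw.
have w_nbr z : e w z -> z = v 0%N \/ z = v 2%N.
  move=> wz; have [/on_pathP[[|[|[|b]]] // _ zE]|/w_uniq zw] := boolP (on_path 'I_4 (2 * 1) v z).
  - by left.
  - by case/negP: vw; rewrite -zE e_sym.
  - by right.
  by move: wz; rewrite zw e_irr.
have no_chord : ~~ e (v 0%N) (v 2%N).
  apply/negP => e02; have := v_geo.2 0%N 2%N [:: v 2%N] isT isT.
  by rewrite /= e02 => /(_ isT erefl).
have direct b b' : (b = 0%N /\ b' = 2%N) \/ (b = 2%N /\ b' = 0%N) -> e w (v b).
  move=> bb'; have [p [p_path p_last p_size]] := e_diam.1 w (v b).
  have vb_on : on_path 'I_4 (2 * 1) v (v b) by apply: on_path_v; case: bb' => -[-> _].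
  case: p p_path p_last p_size => [|y [|y' [|? ?]]] //=.
  - by move=> _ wE; rewrite wE vb_on in w_off.
  - by move=> /andP[wy _] <-.
  move=> /and3P[wy yy' _] y'E _; rewrite y'E in yy'.
  have {}yy' : y = v b \/ e (v b') (v b).
    by case: bb' wy yy' => -[-> ->] /w_nbr[->|->]; rewrite ?e_irr //; auto.
  case: yy' => [yE|]; first by rewrite -yE.
  by case: bb' => -[-> ->]; rewrite ?(negbTE no_chord) // e_sym (negbTE no_chord).
have w0 : e w (v 0%N) by apply: (direct 0%N 2%N); left.
have w2 : e w (v 2%N) by apply: (direct 2%N 0%N); right.
have e01 : e (v 0%N) (v 1%N) by apply: v_geo.1.
have e12 : e (v 1%N) (v 2%N) by apply: v_geo.1.
have n02 : v 0%N != v 2%N by rewrite (geodesic_eq 'I_4 e (2 * 1) v v_geo).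
have nw : w != v 1%N by apply: contraNneq w_off => ->; apply: on_path_v.
have sup := nbr2_le R _ e _ x x_super.
have i1 := sup w _ _ w0 w2 n02.
have i2 : x w + x (v 1%N) <= Num.sqrt 3 * x (v 0%N) by apply: sup; rewrite // e_sym.
have i3 : x w + x (v 1%N) <= Num.sqrt 3 * x (v 2%N) by apply: sup; rewrite // e_sym.
have i4 : x (v 0%N) + x (v 2%N) <= Num.sqrt 3 * x (v 1%N) by apply: sup; rewrite // e_sym.
have s_lt2 : Num.sqrt 3 < 2 :> R.
  have -> : 2 = Num.sqrt (2 ^+ 2) :> R by rewrite sqrtr_sqr ger0_norm.
  by rewrite ltr_sqrt; [lra | rewrite exprn_gt0].
have gt0 := super_gt0 R _ e _ x x_super.
have := gt0 w; have := gt0 (v 0%N); have := gt0 (v 1%N); have := gt0 (v 2%N).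
move: (x w) (x (v 0%N)) (x (v 1%N)) (x (v 2%N)) i1 i2 i3 i4 => a b c d i1 i2 i3 i4 d0 c0 b0 a0.
have : Num.sqrt 3 * (a + b + c + d) < 2 * (a + b + c + d) by rewrite ltr_pM2r //; lra.
lra.
Qed.

Lemma critical_value (R : realType) (k : nat) : (0 < k)%N ->
  exists (lam : R) (yy : nat -> nat -> R), profile R k lam yy /\
    forall (e : rel 'I_(3 * k).+1) x, simple_graph e -> has_diameter e (2 * k) ->
      supersolution R _ e lam x ->
      exists i j, [/\ (i <= j)%N, (i + j)%N = k &
        exists g : 'I_(3 * k).+1 -> 'I_(3 * k).+1, injective g /\
          forall u w, quipu k i j u w -> e (g u) (g w)].
Proof.
move=> k_gt0.
suff general (lam : R) yy : 2 <= lam -> lam ^+ 2 < 9 / 2 -> arm lam k = lam / 3 ->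
    fork_excess R lam -> profile R k lam yy -> merging R k lam yy ->
    (forall (e : rel 'I_(3 * k).+1) x v, symmetric e -> supersolution R _ e lam x ->
        geodesic _ e v (2 * k) -> single_attach _ e (2 * k) v) ->
    profile R k lam yy /\
    forall (e : rel 'I_(3 * k).+1) x, simple_graph e -> has_diameter e (2 * k) ->
      supersolution R _ e lam x ->
      exists i j, [/\ (i <= j)%N, (i + j)%N = k &
        exists g : 'I_(3 * k).+1 -> 'I_(3 * k).+1, injective g /\
          forall u w, quipu k i j u w -> e (g u) (g w)].
  case: k k_gt0 general => [|[|[|k]]] // _ general.
  - exists (Num.sqrt 3), (claw_profile R); split; first exact: claw_profile_spec.
    move=> e x e_simple e_diam x_super; exists 0%N, 1%N; split => //.
    exact: (claw_embedding R e x).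
  - exists 2, (flat_profile R); apply: general => //.
    + by lra.
    + exact: flat_arm_k.
    + exact: flat_fork_excess.
    + exact: flat_profile_spec.
    + exact: flat_merging.
    move=> e x v e_sym x_super; apply: (flat_single_attach R _ e x) => //.
    by rewrite card_ord.
  have [t t_root] := hyperbolic_root_exists R k.+3 isT.
  exists (ch t), (hyp_profile R k.+3 t); apply: general.
  - exact: lam_ge2 t_root.
  - exact: lam_sqr_lt t_root.
  - exact: arm_k.
  - exact: hyp_fork_excess t_root.
  - exact: hyp_profile_spec.
  - exact: hyp_merging.
  move=> e x v e_sym x_super; apply: (hyp_single_attach R k.+3 t t_root isT _ e x) => //.
  by rewrite card_ord.
move=> l2 lsq armk exc prof merg att; split => // e x [e_sym e_irr] e_diam x_super.
have [v [i [j [s1 [s2 [[v_geo le_ij _ ijk] [h1 h2 z1 z2 u12]]]]]]] :=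
  quipu_layout R _ e lam x k e_sym x_super l2 lsq armk exc (card_ord _) e_diam.1
    (fun v => att e x v e_sym x_super) yy prof merg k_gt0 e_diam.
exists i, j; split => //.
exact: (quipu_embedding _ e k i j v s1 s2).
Qed.

Lemma iso_diameter (n : nat) (e q : rel 'I_n) D :
  graph_iso e q -> has_diameter q D -> has_diameter e D.
Proof.
case=> f [[f' fK f'K] f_edge] [q_le [a [b q_ge]]].
have to_q x p : path e x p -> path q (f x) (map f p) /\ last (f x) (map f p) = f (last x p).
  move=> p_path; rewrite last_map path_map; split => //.
  by rewrite (eq_path (e' := e)) // => u w /=; rewrite f_edge.
have to_e x p : path q x p -> path e (f' x) (map f' p) /\ last (f' x) (map f' p) = f' (last x p).
  move=> p_path; rewrite last_map path_map; split => //.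
  by rewrite (eq_path (e' := q)) // => u w /=; rewrite f_edge !f'K.
split=> [x y|].
  have [p [p_path p_last p_size]] := q_le (f x) (f y).
  have [h1 h2] := to_e _ _ p_path; exists (map f' p).
  by rewrite size_map; rewrite p_last !fK in h1 h2.
exists (f' a), (f' b) => p p_path p_last.
have [h1 h2] := to_q _ _ p_path; rewrite p_last !f'K in h1 h2.
by have := q_ge _ h1 h2; rewrite size_map.
Qed.

Lemma iso_spectral_radius (R : realType) (n : nat) (e q : rel 'I_n.+1) (y : 'I_n.+1 -> R) lam :
  graph_iso e q -> symmetric q -> (forall u, 0 < y u) ->
  (forall u, \sum_(w | q u w) y w = lam * y u) -> spectral_radius R e = lam.
Proof.
case=> f [f_bij f_edge] q_sym y_gt0 y_eig.
apply: (spectral_radius_pos_eigen R n e (fun u => y (f u))) => //.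
  by move=> u w; rewrite !f_edge q_sym.
move=> u; rewrite -y_eig [RHS](reindex f) /=; last exact: onW_bij.
by apply: eq_bigl => w; rewrite f_edge.
Qed.

Lemma diameter_connected (n : nat) (e : rel 'I_n) D : has_diameter e D -> connected_graph e.
Proof.
move=> e_diam x y; have [p [p_path p_last _]] := e_diam.1 x y.
by apply/connectP; exists p.
Qed.

Theorem theorem1p2 (R : realType) (k : nat) (e : rel 'I_(3 * k).+1) :
  (0 < k)%N -> simple_graph e ->
  ((connected_graph e /\ has_diameter e (2 * k) /\
    forall e' : rel 'I_(3 * k).+1,
      simple_graph e' -> connected_graph e' -> has_diameter e' (2 * k) ->
      spectral_radius R e <= spectral_radius R e')
   <->
   exists i j : nat, [/\ (i <= j)%N, (i + j)%N = k & graph_iso e (quipu k i j)]).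
Proof.
move=> k_gt0 e_simple.
have [lam [yy [yy_profile embed]]] := critical_value R k k_gt0.
have y_gt0 i j : (i <= j)%N -> (i + j)%N = k ->
    forall u : 'I_(3 * k).+1, 0 < quipu_vec k i j R yy u.
  move=> le_ij ijk u; apply: (quipu_vec_gt0 k i j le_ij ijk k_gt0 R lam yy yy_profile).
  by rewrite -ltnS.
have y_eig i j (le_ij : (i <= j)%N) (ijk : (i + j)%N = k) :=
  quipu_vec_eigen k i j le_ij ijk k_gt0 R lam yy yy_profile.
have q_simple i j (le_ij : (i <= j)%N) (ijk : (i + j)%N = k) :=
  quipu_simple k i j le_ij ijk k_gt0.
have q_diam i j (le_ij : (i <= j)%N) (ijk : (i + j)%N = k) :=
  quipu_diameter k i j le_ij ijk k_gt0.
have rho_iso (e' : rel 'I_(3 * k).+1) i j : (i <= j)%N -> (i + j)%N = k ->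
    graph_iso e' (quipu k i j) -> spectral_radius R e' = lam.
  move=> le_ij ijk iso.
  apply: (iso_spectral_radius R _ e' _ (fun u => quipu_vec k i j R yy u) lam iso).
  - exact: (proj1 (q_simple i j le_ij ijk)).
  - exact: y_gt0.
  - exact: y_eig.
have classify (e' : rel 'I_(3 * k).+1) : simple_graph e' -> connected_graph e' ->
    has_diameter e' (2 * k) -> spectral_radius R e' <= lam ->
    exists i j : nat, [/\ (i <= j)%N, (i + j)%N = k & graph_iso e' (quipu k i j)].
  move=> e'_simple e'_conn e'_diam rho_le.
  have [x [x_gt0 x_eig]] := perron_vector R _ e' e'_simple.1 e'_conn.
  have x_super : supersolution R _ e' lam x.
    by split=> // u; rewrite x_eig ler_wpM2r // ltW.
  have [i [j [le_ij ijk [g [g_inj g_hom]]]]] := embed e' x e'_simple e'_diam x_super.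
  exists i, j; split => //.
  apply: (embedding_iso R _ e' _ lam x (fun u => quipu_vec k i j R yy u) g) => //.
  - exact: (proj1 (q_simple i j le_ij ijk)).
  - exact: y_gt0.
  - exact: y_eig.
split=> [[e_conn [e_diam e_min]]|[i [j [le_ij ijk iso]]]].
  apply: classify => //.
  (* Any quipu would do for the comparison; this one is the star with three arms of length [k]. *)
  have id_iso : graph_iso (quipu k 0 k) (quipu k 0 k).
    by exists id; split => //; exists id.
  rewrite -(rho_iso (quipu k 0 k) 0%N k) //.
  apply: e_min; [exact: q_simple | exact: quipu_connected | exact: q_diam].
have e_diam := iso_diameter _ e _ _ iso (q_diam i j le_ij ijk).
split; first exact: diameter_connected e_diam.
split=> // e' e'_simple e'_conn e'_diam; rewrite (rho_iso e i j) //.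
rewrite leNgt; apply/negP => rho_lt.
have [i' [j' [le_ij' ijk' iso']]] := classify e' e'_simple e'_conn e'_diam (ltW rho_lt).
by move: rho_lt; rewrite (rho_iso e' i' j') // ltxx.
Qed.
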